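(* Let $\mathscr A$ be the operator described in the context, satisfying the standing hypotheses listed there, let $\{T(t)\}$ be the associated semigroup and $(A,D(A))$ its infinitesimal generator (as defined in the context). Then $$D(A)=\Big\{f\in C_b(\mathbb R^N):\ \exists\{f_n\}\subset C_b^2(\mathbb R^N),\ \exists g\in C_b(\mathbb R^N):\ f_n\to f,\ \mathscr Af_n\to g\ \text{locally uniformly in }\mathbb R^N\ \text{and}\ \sup_{n\in\mathbb N}\big(\|f_n\|_\infty+\|\mathscr Af_n\|_\infty\big)<+\infty\Big\}.$$ Moreover, $Af=\mathscr Af$ for any $f\in D(A)$, where $\mathscr Af$ is meant in the sense of distributions.
   Context: Standing hypotheses. $\mathbb N_0=\mathbb N\cup\{0\}$; the length of a multi-index $\alpha$ is $\|\alpha\|=\sum_i\alpha_i$. Let $r\ge1$ and let $p_0\ge p_1\ge\dots\ge p_r$ be positive integers with $p_0+\dots+p_r=N$ (so $p_0<N$). The operator is $$\mathscr A\varphi(x)=\sum_{i,j=1}^{p_0}q_{ij}(x)D_{ij}\varphi(x)+\sum_{i,j=1}^Nb_{ij}x_jD_i\varphi(x)+\sum_{j=1}^{p_0}F_j(x)D_j\varphi(x),\quad x\in\mathbb R^N,$$ and for some integer $\kappa\ge3$: (1) $Q(x)=(q_{ij}(x))$ is a symmetric $p_0\times p_0$ matrix with $q_{ij}\in C^\kappa(\mathbb R^N)$, and there is a function $\nu:\mathbb R^N\to\,]0,+\infty[$ with $\inf\nu=\nu_0>0$, $\sum_{i,j=1}^{p_0}q_{ij}(x)\xi_i\xi_j\ge\nu(x)|\xi|^2$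 for $x\in\mathbb R^N$, $\xi\in\mathbb R^{p_0}$, and $|D^\alpha q_{ij}(x)|\le C_{\|\alpha\|}(1+|x|)^{(1-\|\alpha\|)^+}\sqrt{\nu(x)}$ for all $x\in\mathbb R^N$, $i,j\le p_0$, $\|\alpha\|\le\kappa$ (where $a^+=\max\{a,0\}$); (2) $B=(b_{ij})$ is a real $N\times N$ matrix which, written in blocks according to $N=p_0+\dots+p_r$ (blocks of rows and columns numbered $0,\dots,r$), has zero blocks in positions $(h,k)$ with $h\ge k+2$, and whose block $B_h$ in position $(h,h-1)$, a $p_h\times p_{h-1}$ matrix, has rank $p_h$ for $h=1,\dots,r$ (other blocks arbitrary); (3) $F=(F_1,\dots,F_{p_0})\in C^\kappa(\mathbb R^N,\mathbb R^{p_0})$ and $|D^\alpha F(x)|\le C\sqrt{\nu(x)}$ for $x\in\mathbb R^N$, $\|\alpha\|\le\kappa$. $C_b(\mathbb R^N)$: bounded continuous functions with sup norm; $C_b^2(\mathbb R^N)$: functions in $C^2(\mathbb R^N)$ bounded together with their first and second order derivatives. Semigroup. For $f\in C_b(\mathbb R^N)$, $T(t)f:=u(t,\cdot)$, where $u$ is the unique classical solution (it exists) of $D_tu=\mathscr Au$ in $]0,+\infty[\times\mathbb R^N$, $u(0,\cdot)=f$, i.e. the unique solution which is $C^1$ in $t$ and $C^2$ in $x$ in $]0,+\infty[\times\mathbb R^N$, continuous in $[0,+\infty[\times\mathbb R^N$ and bounded in $[0,T_0]\times\mathbb R^N$ for every $T_0>0$; $\{T(t)\}$ is a positivity preserving semigroup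 of linear contractions on $C_b(\mathbb R^N)$. Generator. Let $\tau_c$ be the topology of locally uniform convergence on $C_b(\mathbb R^N)$. Then $$D(A):=\Big\{f\in C_b(\mathbb R^N):\ \exists\,\tau_c\text{-}\lim_{t\to0^+}\tfrac{T(t)f-f}{t}\in C_b(\mathbb R^N)\ \text{and}\ \sup_{t\in]0,1]}\tfrac{\|T(t)f-f\|_\infty}{t}<+\infty\Big\},\quad Af:=\tau_c\text{-}\lim_{t\to0^+}\tfrac{T(t)f-f}{t}.$$ For every $\lambda>0$ the resolvent is $R(\lambda,A)f=\int_0^{+\infty}e^{-\lambda t}T(t)f\,dt$ (integral in the topology $\tau_c$). *)

(* Defs.v *)
From HB Require Import structures.
From mathcomp Require Import all_boot all_order all_algebra.
From mathcomp Require Import all_classical all_reals all_analysis.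

Set Implicit Arguments.
Unset Strict Implicit.
Unset Printing Implicit Defensive.

Import Order.TTheory GRing.Theory Num.Theory.
Import numFieldNormedType.Exports.

Local Open Scope classical_set_scope.
Local Open Scope ring_scope.

Section Calculus.
Context {R : realType} {n : nat}.
Local Notation E := 'rV[R]_n.
Implicit Types (f : E -> R) (x : E) (alpha : 'I_n -> nat) (i : 'I_n).

(* The library norm on row vectors is the sup norm. *)
Definition enorm x : R := Num.sqrt (\sum_i x 0 i ^+ 2).

Definition partial i f : E -> R := fun x => 'D_(delta_mx 0 i) f x.

Definition mlength alpha : nat := (\sum_i alpha i)%N.

(* The order in which the derivatives are taken is immaterial: this is only
   used for functions of class C^k with k >= mlength alpha. *)
Definition mpartial alpha f : E -> R :=
  foldr (fun i g => iter (alpha i) (partial i) g) f (enum 'I_n).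

Fixpoint classC (k : nat) f : Prop :=
  continuous f /\
  if k is k'.+1 then
    forall i, (forall x, derivable f x (delta_mx 0 i)) /\ classC k' (partial i f)
  else True.

Definition Cb : set (E -> R) := [set f | continuous f /\ bounded_fun f].

Definition Cb2 : set (E -> R) :=
  [set f | classC 2 f /\
    forall alpha, (mlength alpha <= 2)%N -> bounded_fun (mpartial alpha f)].

Definition test_function : set (E -> R) :=
  [set phi | (forall k, classC k phi) /\
             compact (closure [set x | phi x != 0])].

(* Convergence in tau_c: uniform on compact sets. *)
Definition cvg_tauc (G : set_system (E -> R)) f : Prop :=
  {family compact, G --> f}.

(* Extended-real valued, so that it is +oo on unbounded functions. *)
Definition supnorm f : \bar R := ereal_sup (range (fun x => `|f x|%:E)).

End Calculus.

(* Integration over R^n with respect to Lebesgue measure, as an iterated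
   integral.  It is only applied to continuous functions with compact support,
   for which Fubini's theorem makes this the Lebesgue integral. *)
Fixpoint rV_integral {R : realType} (n : nat) : ('rV[R]_n -> R) -> R :=
  match n with
  | 0 => fun f => f 0
  | m.+1 => fun f =>
      \int[lebesgue_measure]_t
        rV_integral (fun y : 'rV[R]_m => f (row_mx (t%:M : 'rV[R]_1) y))
  end.

(* A distribution is represented by its action on functions R^n -> R.  The
   product by a coefficient a of class C^k that is not smooth makes sense
   because the distributions below have finite order and extend to compactly
   supported functions of class C^k. *)
Section Distributions.
Context {R : realType} {n : nat}.
Local Notation E := 'rV[R]_n.
Implicit Types (u : (E -> R) -> R) (phi : E -> R).

Definition dist_of (f : E -> R) : (E -> R) -> R :=
  fun phi => rV_integral (fun x => f x * phi x).

Definition dist_partial (i : 'I_n) u : (E -> R) -> R :=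
  fun phi => - u (partial i phi).

Definition dist_mul (a : E -> R) u : (E -> R) -> R :=
  fun phi => u (fun x => a x * phi x).

End Distributions.

Section Operator.
Context {R : realType} {r : nat} {p : 'I_r.+1 -> nat}.
Local Notation N := (\sum_i p i)%N.
Local Notation p0 := (p ord0).
Local Notation E := 'rV[R]_N.

Variables (Q : E -> 'M[R]_p0) (B : 'M[R]_N) (F : E -> 'rV[R]_p0).

(* The inclusion of the indices of the first block, of value i. *)
Definition first_block (i : 'I_p0) : 'I_N := tagnat.Rank ord0 i.
Local Notation fb := first_block.

Definition opA (f : E -> R) : E -> R := fun x =>
  \sum_i \sum_j Q x i j * partial (fb i) (partial (fb j) f) x
  + \sum_i \sum_j B i j * x 0 j * partial i f x
  + \sum_j F x 0 j * partial (fb j) f x.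

Definition dist_opA (u : (E -> R) -> R) : (E -> R) -> R := fun phi =>
  \sum_i \sum_j
     dist_mul (fun x => Q x i j) (dist_partial (fb i) (dist_partial (fb j) u)) phi
  + \sum_i \sum_j dist_mul (fun x => B i j * x 0 j) (dist_partial i u) phi
  + \sum_j dist_mul (fun x => F x 0 j) (dist_partial (fb j) u) phi.

Record block_sizes : Prop := {
  r_ge1 : (1 <= r)%N;
  p_gt0 : forall h, (0 < p h)%N;
  p_noninc : forall h k : 'I_r.+1, (h <= k)%N -> (p k <= p h)%N }.

Record diffusion_hyp (kappa : nat) (nu : E -> R) : Prop := {
  Q_sym : forall x, (Q x)^T = Q x;
  Q_classC : forall i j, classC kappa (fun x => Q x i j);
  nu_gt0 : forall x, 0 < nu x;
  nu_inf_gt0 : 0 < inf (range nu);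
  Q_elliptic : forall (x : E) (xi : 'rV[R]_p0),
    \sum_i \sum_j Q x i j * xi 0 i * xi 0 j >= nu x * enorm xi ^+ 2;
  Q_growth : exists C : nat -> R,
    forall (x : E) (i j : 'I_p0) (alpha : 'I_N -> nat),
    (mlength alpha <= kappa)%N ->
    `|mpartial alpha (fun y => Q y i j) x| <=
      C (mlength alpha) * (1 + enorm x) ^+ (1 - mlength alpha)%N
      * Num.sqrt (nu x) }.

Record drift_matrix_hyp : Prop := {
  B_zero : forall h k : 'I_r.+1, (k + 2 <= h)%N -> submxblock B h k = 0;
  B_rank : forall h k : 'I_r.+1, (h : nat) = k.+1 ->
    \rank (submxblock B h k) = p h }.

Record drift_field_hyp (kappa : nat) (nu : E -> R) : Prop := {
  F_classC : forall j, classC kappa (fun x => F x 0 j);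
  F_growth : exists C : R, forall (x : E) (alpha : 'I_N -> nat),
    (mlength alpha <= kappa)%N ->
    enorm (\row_j mpartial alpha (fun y => F y 0 j) x) <=
      C * Num.sqrt (nu x) }.

Record standing_hyp (kappa : nat) (nu : E -> R) : Prop := {
  sizes : block_sizes;
  kappa_ge3 : (3 <= kappa)%N;
  hyp_diffusion : diffusion_hyp kappa nu;
  hyp_drift_matrix : drift_matrix_hyp;
  hyp_drift_field : drift_field_hyp kappa nu }.

(* "C^1 in t and C^2 in x" means that the derivatives involved exist and are
   continuous in (t, x) jointly. *)
Record classical_solution (f : E -> R) (u : R -> E -> R) : Prop := {
  sol_t_derivable : forall (t : R) (x : E), 0 < t -> derivable (u^~ x) t 1;
  sol_t_continuous : {in [set z : R * E | 0 < z.1],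
    continuous (fun z : R * E => 'D_1 (u^~ z.2) z.1)};
  sol_x_derivable : forall (t : R) (x : E) (i : 'I_N), 0 < t ->
    derivable (u t) x (delta_mx 0 i);
  sol_x_continuous : forall i : 'I_N, {in [set z : R * E | 0 < z.1],
    continuous (fun z : R * E => partial i (u z.1) z.2)};
  sol_xx_derivable : forall (t : R) (x : E) (i j : 'I_N), 0 < t ->
    derivable (partial j (u t)) x (delta_mx 0 i);
  sol_xx_continuous : forall i j : 'I_N, {in [set z : R * E | 0 < z.1],
    continuous (fun z : R * E => partial i (partial j (u z.1)) z.2)};
  sol_continuous : {within [set z : R * E | 0 <= z.1],
    continuous (fun z : R * E => u z.1 z.2)};
  sol_bounded : forall T0 : R, 0 < T0 ->
    exists M : R, forall (t : R) (x : E), 0 <= t <= T0 -> `|u t x| <= M;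
  sol_eq : forall (t : R) (x : E), 0 < t -> 'D_1 (u^~ x) t = opA (u t) x;
  sol_init : forall x, u 0 x = f x }.

(* T t f is relevant only for 0 <= t and f in Cb. *)
Definition is_semigroup (T : R -> (E -> R) -> (E -> R)) : Prop :=
  forall f, Cb f ->
    classical_solution f (fun t => T t f) /\
    forall u, classical_solution f u -> forall (t : R) (x : E), 0 <= t -> u t x = T t f x.

End Operator.

Section Generator.
Context {R : realType} {n : nat}.
Local Notation E := 'rV[R]_n.
Variable T : R -> (E -> R) -> (E -> R).

Definition diff_quotient (f : E -> R) (t : R) : E -> R :=
  fun x => (T t f x - f x) / t.

Definition is_gen (f g : E -> R) : Prop :=
  cvg_tauc (diff_quotient f @ 0^'+) g.

Definition gen_domain : set (E -> R) :=
  [set f | [/\ Cb f,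
    exists g, Cb g /\ is_gen f g &
    (ereal_sup [set supnorm (fun x => (T t f x - f x)%R) * (t^-1)%:E
               | t in `]0%R, 1%R]%classic] < +oo)%E]].

(* Compact convergence is separated, so this is the limit when it exists. *)
Definition gen (f : E -> R) : E -> R := xget (fun=> 0) (is_gen f).

End Generator.

(* Main.v *)
Require Import Defs.
From HB Require Import structures.
From mathcomp Require Import all_boot all_order all_algebra.
From mathcomp Require Import all_classical all_reals all_analysis.
From mathcomp Require Import ring lra.

Set Implicit Arguments.
Unset Strict Implicit.
Unset Printing Implicit Defensive.

Import Order.TTheory GRing.Theory Num.Theory.
Import numFieldNormedType.Exports.

Local Open Scope classical_set_scope.
Local Open Scope ring_scope.

(** The proof rests on comparison principles for classical solutions of u_t = A u
    with bounded initial values, and on weights that confine the argument to compact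
    sets. For V(x) = 1 + |x|^2, |A V| <= C V and Gam(V, V) <= C V^2, where Gam
    is the square field operator (lemma Lyapunov). Consequently the semigroup is
    tight (solution_tight): what an initial value does far away has little influence
    on a fixed compact set. Similarly decay like 1/V is preserved.

    Limits of smooth functions are in the domain (generates_limit). For a function h
    of class C^2 with h and A h bounded, the barrier
    h + a t + k (t (1 + c t) |x - x0|^2 + C t^2), with a slightly larger than A h(x0),
    shows that T(t) h - h - t A h(x0) = o(t) at x0 (short_time_estimate), with bounds
    that depend only on bounds of h, of A h and of the oscillation of A h near x0.
    These estimates pass to bounded, locally uniform limits.

    Conversely let f be in the domain, g = A f, psi = f - g, so that
    f = R(1, A) psi. Then f is approximated by theta h (smooth_approximation), where
    h is a Riemann sum of the integral of exp(-t) T(t) psi', psi' is a compactly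
    supported smooth approximation of psi, and theta is a cutoff. Telescoping
    exp(-t) T(t) psi' along the mesh yields A h = h - psi' up to small errors. The
    error A (theta h) - theta A h contains Gam(theta, h), and this requires decay of
    the gradient of h: it is the only place where the derivatives of the semigroup
    are estimated. Since psi' is smooth, it is enough to propagate the weighted
    Lipschitz bound (u(x) - u(y))^2 <= K |x - y|^2 V(x)^-2
    (weighted_lipschitz). It is proved by doubling the variables: at a maximum of
    (u(x) - u(y))^2 + |x - y|^2 u(x)^2 - K |x - y|^2 V(x)^-2, discounted in time, the
    second order terms at x and y are compared along a coupling of the diffusions
    (coupling). The hypotheses on the derivatives of Q and F bound
    the increments of the coefficients by the quadratic form of Q.

    Finally, A f is computed in the sense of distributions by integrating by parts
    for the smooth approximations f_n and passing to the limit (dist_Aop_limit). *)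

(** * Calculus along lines *)

Section Lines.
Context {R : realType} {V : normedModType R}.
Implicit Types (f : V -> R) (x v : V).

Lemma is_derive_line f x v (s l : R) :
  is_derive (s *: v + x) v f l -> is_derive s 1 (fun s => f (s *: v + x)) l.
Proof.
have E : (fun h : R => h^-1 *: (((fun s => f (s *: v + x)) \o shift s) (h *: (1 : R))
            - (fun s => f (s *: v + x)) s)) =
    (fun h => h^-1 *: ((f \o shift (s *: v + x)) (h *: v) - f (s *: v + x))).
  by apply/funext => h /=; rewrite [h *: 1]mulr1 scalerDl addrA.
case=> df Df; split.
  by rewrite /derivable E.
by rewrite -Df /derive E.
Qed.

(** Every rule for directional derivatives is proved by passing through this
    equivalence to functions of one real variable. *)
Lemma lineE f x v (l : R) :
  is_derive x v f l <-> is_derive (0 : R) 1 (fun s => f (s *: v + x)) l.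
Proof.
split=> [h|]; first by apply: is_derive_line; rewrite scale0r add0r.
have E : (fun h : R => h^-1 *: (((fun s => f (s *: v + x)) \o shift 0) (h *: (1 : R))
            - (fun s => f (s *: v + x)) 0)) =
    (fun h => h^-1 *: ((f \o shift x) (h *: v) - f x)).
  by apply/funext => h /=; rewrite [h *: 1]mulr1 addr0 scale0r add0r.
case=> df Df; split.
  by move: df; rewrite /derivable E.
by rewrite -Df /derive E.
Qed.

End Lines.

Section LocalMax.
Context {R : realType}.
Implicit Types g : R -> R.

Lemma small_pos (a b : R) : 0 < a -> 0 < b -> exists h, [/\ 0 < h, h < a & h < b].
Proof.
move=> a0 b0; exists (Num.min a b / 2).
have m0 : 0 < Num.min a b by rewrite lt_min a0.
have m1 : Num.min a b / 2 < Num.min a b by rewrite ltr_pdivrMr// ltr_pMr// ltr1n.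
by split; rewrite ?divr_gt0//; apply: lt_le_trans m1 _; rewrite ge_min lexx ?orbT.
Qed.

Lemma is_derive_eps g (s0 c e : R) : is_derive s0 1 g c -> 0 < e ->
  exists2 h0 : R, 0 < h0 &
    forall h, `|h| < h0 -> `|g (s0 + h) - g s0 - c * h| <= e * `|h|.
Proof.
case=> dg Dg e0.
have /cvgrPdist_le /(_ e e0) : (fun h : R => h^-1 *: ((g \o shift s0) (h *: (1 : R)) - g s0))
    @ 0^' --> c by rewrite -Dg.
move=> /nbhs_ballP[h0 /= h00 H]; exists h0 => // h hh0.
have [->|hn0] := eqVneq h 0; first by rewrite !addr0 mulr0 normr0 mulr0 subrr subr0 normr0.
have /H /(_ hn0) : ball (0 : R) h0 h by rewrite /ball /= sub0r normrN.
rewrite [h *: 1]mulr1 /= (addrC h) => Hh.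
rewrite -ler_pdivrMr ?normr_gt0// -normfV -normrM.
suff -> : (g (s0 + h) - g s0 - c * h) / h = - (c - h^-1 *: (g (s0 + h) - g s0)) by rewrite normrN.
by rewrite mulrBl mulfK// opprB mulrC.
Qed.

(** One-sided on purpose: in time, a maximum over [0, L] may be attained at L. *)
Lemma left_max_derive_ge0 g (s0 c e : R) : 0 < e ->
  (forall h, 0 < h -> h < e -> g (s0 - h) <= g s0) -> is_derive s0 1 g c ->
  0 <= c.
Proof.
move=> e0 mx dg; rewrite leNgt; apply/negP => c0.
have ce : 0 < - c / 2 by lra.
have [h0 h00 H] := is_derive_eps dg ce.
have [h [hp hh0 he]] := small_pos h00 e0.
have := H (- h); rewrite normrN gtr0_norm// => /(_ hh0).
have := mx h hp he => m1 /ler_normlP[]; nra.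
Qed.

Lemma local_max_derive g (s0 c e : R) : 0 < e ->
  (forall h, `|h| < e -> g (s0 + h) <= g s0) -> is_derive s0 1 g c -> c = 0.
Proof.
move=> e0 mx dg; apply/eqP; rewrite eq_le; apply/andP; split; last first.
  apply: (left_max_derive_ge0 e0 _ dg) => h h0 he; apply: mx.
  by rewrite normrN gtr0_norm.
rewrite leNgt; apply/negP => c0.
have ce : 0 < c / 2 by lra.
have [h0 h00 H] := is_derive_eps dg ce.
have [h [hp hh0 he]] := small_pos h00 e0.
have := H h; have := mx h; rewrite gtr0_norm// => /(_ he) m1 /(_ hh0).
move=> /ler_normlP[]; nra.
Qed.

Lemma local_max_derive2 g (g' : R -> R) (c e : R) : 0 < e ->
  (forall h, `|h| < e -> g h <= g 0) ->
  (forall h : R, `|h| < e -> is_derive h 1 g (g' h)) -> is_derive (0 : R) 1 g' c ->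
  g' 0 = 0 /\ c <= 0.
Proof.
move=> e0 mx dg dg'.
have g'0 : g' 0 = 0.
  apply: (local_max_derive e0 _ (dg 0 _)); last by rewrite normr0.
  by move=> h he; rewrite add0r; exact: mx.
split=> //; rewrite leNgt; apply/negP => c0.
have ce : 0 < c / 2 by lra.
have [h0 h00 H] := is_derive_eps dg' ce.
have [h [hp hh0 he]] := small_pos h00 e0.
have dg1 x : x \in `]0, h[%R -> is_derive x 1 g (g' x).
  by rewrite in_itv /= => /andP[x0 xh]; apply: dg; rewrite gtr0_norm//; lra.
have [] := @MVT R g g' 0 h hp dg1.
  apply: derivable_within_continuous => x.
  rewrite in_itv /= => /andP[x0 xh].
  by have [] : is_derive x 1 g (g' x) by apply: dg; rewrite ger0_norm//; lra.
move=> x; rewrite in_itv /= => /andP[x0 xh] E.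
have := mx h; rewrite gtr0_norm// => /(_ he) m1.
have := H x; rewrite gtr0_norm// add0r g'0 subr0 => /(_ (lt_trans xh hh0)).
move=> /ler_normlP[H1 _].
have cx : 0 < c * x by rewrite mulr_gt0.
have g'x : 0 < g' x by lra.
have : 0 < g' x * h by rewrite mulr_gt0.
by move: E; rewrite subr0; lra.
Qed.

Lemma eps_is_derive g (s0 c : R) :
  (forall e, 0 < e -> exists2 h0 : R, 0 < h0 &
    forall h, `|h| < h0 -> `|g (s0 + h) - g s0 - c * h| <= e * `|h|) ->
  is_derive s0 1 g c.
Proof.
move=> H.
have L : (fun h : R => h^-1 *: ((g \o shift s0) (h *: (1 : R)) - g s0)) @ 0^' --> c.
  apply/cvgrPdist_le => e e0; have [h0 h00 Hh] := H e e0.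
  apply/nbhs_ballP; exists h0 => //= h.
  rewrite /ball /= sub0r normrN => hh0 hn0.
  rewrite [h *: 1]mulr1 (addrC h) -normrN.
  have -> : - (c - h^-1 *: (g (s0 + h) - g s0)) = (g (s0 + h) - g s0 - c * h) / h.
    by rewrite mulrBl mulfK// opprB mulrC.
  by rewrite normrM normfV ler_pdivrMr ?normr_gt0//; exact: Hh.
split; first by apply/cvg_ex; exists c.
exact: cvg_lim L.
Qed.

Lemma MVT_abs g (g' : R -> R) (b : R) :
  (forall s : R, is_derive s 1 g (g' s)) ->
  exists2 xi, `|xi| <= `|b| & g b - g 0 = g' xi * b.
Proof.
move=> dg.
have cg a c : {within `[a, c], continuous g}.
  by apply: derivable_within_continuous => x _; have [] := dg x.
have [b0|b0] := leP 0 b.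
  have [xi] := MVT_segment b0 (fun x _ => dg x) (@cg 0 b).
  rewrite in_itv /= subr0 => /andP[x0 xb] E; exists xi => //.
  by rewrite !ger0_norm.
have [xi] := MVT_segment (ltW b0) (fun x _ => dg x) (@cg b 0).
rewrite in_itv /= => /andP[x0 xb] E; exists xi; last by rewrite -opprB E sub0r mulrN opprK.
by rewrite ler0_norm// ltr0_norm// lerN2.
Qed.

End LocalMax.

(** * Partial derivatives of functions of several variables *)

Section Partials.
Context {R : realType} {n : nat}.
Local Notation E := 'rV[R]_n.
Implicit Types (f g : E -> R) (x y v : E) (i j k : 'I_n).
Local Notation "''e_' i" := (delta_mx 0 i : 'rV[R]_n) (at level 8, i at level 2).

(** The increment along v + a e_k is the increment along v followed by one along
    e_k; the mean value theorem evaluates the second at a moving point, and the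
    continuity of the partial derivative brings it back to x. *)
Lemma is_derive_add_coord f x v l k (a : R) :
  is_derive x v f l -> (forall y, derivable f y 'e_k) ->
  {for x, continuous (partial k f)} ->
  is_derive x (v + a *: 'e_k) f (l + a * partial k f x).
Proof.
move=> /lineE dv dk ck; apply/lineE/eps_is_derive => e e0.
have e1 : 0 < e / (2 * (1 + `|a|)) by rewrite divr_gt0// mulr_gt0// ltr_wpDr.
have e2 : 0 < e / 2 by rewrite divr_gt0.
have [h1 h10 H1] := is_derive_eps dv e2.
move/cvgrPdist_le : ck => /(_ _ e1) /nbhs_ballP[r /= r0 Hr].
pose q := `|v| + `|a| * `|'e_k| + 1.
have q0 : 0 < q by rewrite /q ltr_wpDl// addr_ge0// mulr_ge0.
exists (Num.min h1 (r / q)); first by rewrite lt_min h10 divr_gt0.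
move=> h; rewrite lt_min => /andP[hh1 hr]; rewrite !add0r.
rewrite scale0r add0r.
pose phi (s : R) := f (s *: 'e_k + (h *: v + x)).
have dphi (s : R) : is_derive s 1 phi (partial k f (s *: 'e_k + (h *: v + x))).
  by apply: is_derive_line; apply: derivableP.
have [xi xib Exi] := MVT_abs (h * a) dphi.
have -> : h *: (v + a *: 'e_k) + x = (h * a) *: 'e_k + (h *: v + x).
  by rewrite scalerDr scalerA addrAC addrC addrA.
have -> : f ((h * a) *: 'e_k + (h *: v + x)) - f x - (l + a * partial k f x) * h =
   (partial k f (xi *: 'e_k + (h *: v + x)) - partial k f x) * (h * a) +
   (f (h *: v + x) - f x - l * h).
  by move: Exi; rewrite /phi scale0r add0r => Exi; rewrite mulrBl -Exi; ring.
apply: le_trans (ler_normD _ _) _.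
have -> : e * `|h| = e / 2 * `|h| + e / 2 * `|h| by rewrite -mulrDl -splitr.
apply: lerD; last first.
  by have := H1 h hh1; rewrite !add0r scale0r add0r.
rewrite normrM normrM.
have P : `|partial k f (xi *: 'e_k + (h *: v + x)) - partial k f x| <= e / (2 * (1 + `|a|)).
  rewrite distrC; apply: Hr; rewrite -ball_normE /= distrC addrA addrK.
  apply: le_lt_trans (ler_normD _ _) _; rewrite !normrZ.
  apply: (@le_lt_trans _ _ (`|h| * q)); last by rewrite -ltr_pdivlMr.
  rewrite addrC /q mulrDr mulr1 mulrDr -addrA lerD2l.
  apply: (@le_trans _ _ (`|h| * (`|a| * `|'e_k|))); last by rewrite lerDl.
  by rewrite mulrA ler_wpM2r// -normrM.
apply: (@le_trans _ _ (e / (2 * (1 + `|a|)) * (`|h| * `|a|))).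
  by rewrite ler_wpM2r// mulr_ge0.
have a0 : 0 < 1 + `|a| by rewrite ltr_wpDr.
have -> : e / (2 * (1 + `|a|)) * (`|h| * `|a|) = e / 2 * `|h| * (`|a| / (1 + `|a|)).
  by field; rewrite gt_eqF.
apply: ler_piMr; first by rewrite mulr_ge0// ltW.
by rewrite ler_pdivrMr// mul1r lerDr.
Qed.

(** The linearity of the directional derivative in v for C^1 functions, obtained
    one coordinate at a time. *)
Lemma is_derive_dir f x v :
  (forall i y, derivable f y 'e_i) -> (forall i, continuous (partial i f)) ->
  is_derive x v f (\sum_i v 0 i * partial i f x).
Proof.
move=> df cf; rewrite [v in is_derive _ v](matrix_sum_delta v) big_ord1.
elim/big_rec2 : _ => [|i l w _ IH]; first exact: is_derive0.
by rewrite addrC [in X in is_derive _ _ _ X]addrC; apply: is_derive_add_coord => //; exact: cf.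
Qed.
End Partials.

(** * Functions of class C^k *)

Section DeriveRules.
Context {R : realType} {U : normedModType R}.
Implicit Types (f g : U -> R) (x v : U).

Lemma is_derive_mul f g x v l m : is_derive x v f l -> is_derive x v g m ->
  is_derive x v (fun y => f y * g y) (f x * m + g x * l).
Proof. exact: is_deriveM. Qed.

Lemma is_derive_add f g x v l m : is_derive x v f l -> is_derive x v g m ->
  is_derive x v (fun y => f y + g y) (l + m).
Proof. exact: is_deriveD. Qed.

Lemma is_derive_scale (c : R) f x v l : is_derive x v f l ->
  is_derive x v (fun y => c * f y) (c * l).
Proof. exact: is_deriveZ. Qed.

Lemma is_derive_compE (k : R -> R) f x v (k' l : R) :
  is_derive (f x) 1 k k' -> is_derive x v f l ->
  is_derive x v (fun y => k (f y)) (k' * l).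
Proof.
move=> dk /lineE df; apply/lineE.
by apply: (@is_derive1_comp _ k (fun s => f (s *: v + x))); rewrite scale0r add0r.
Qed.

Lemma is_derive_sumE (I : Type) (r : seq I) (h : I -> U -> R) x v (dh : I -> R) :
  (forall i, is_derive x v (h i) (dh i)) ->
  is_derive x v (fun y => \sum_(i <- r) h i y) (\sum_(i <- r) dh i).
Proof.
move=> H; elim: r => [|a r IH].
  rewrite big_nil (_ : (fun _ => _) = cst 0); first exact: is_derive_cst.
  by apply/funext => y; rewrite big_nil.
rewrite big_cons (_ : (fun _ => _) = fun y => h a y + \sum_(i <- r) h i y).
  exact: is_derive_add.
by apply/funext => y; rewrite big_cons.
Qed.

End DeriveRules.

Section ClassC.
Context {R : realType} {n : nat}.
Local Notation E := 'rV[R]_n.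
Implicit Types (f g : E -> R) (x y v : E) (k : nat).
Local Notation "''e_' i" := (delta_mx 0 i : 'rV[R]_n) (at level 8, i at level 2).

Lemma is_derive_coord x v (i : 'I_n) : is_derive x v (fun y : E => y 0 i) (v 0 i).
Proof.
apply/lineE; rewrite (_ : (fun s => _) = fun s => s * v 0 i + x 0 i); last first.
  by apply/funext => s; rewrite !mxE.
rewrite -[X in is_derive _ _ _ X]addr0; apply: is_deriveD.
rewrite -[X in is_derive _ _ _ X]mulr1.
rewrite (_ : (fun s => _) = fun s => v 0 i * s); last by apply/funext => s; rewrite mulrC.
exact: is_deriveZ.
Qed.

Lemma is_derive_partial f x (i : 'I_n) l : is_derive x 'e_i f l -> partial i f x = l.
Proof. by case. Qed.

Lemma derivable_partial f x (i : 'I_n) : derivable f x 'e_i ->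
  is_derive x 'e_i f (partial i f x).
Proof. exact: derivableP. Qed.

Lemma classC_cont k f : classC k f -> continuous f. Proof. by case: k => [|k] []. Qed.

Lemma classCS k f : classC k.+1 f -> classC k f.
Proof.
elim: k f => [|k IH] f; first by case.
by case=> cf H; split=> // i; have [df /IH] := H i.
Qed.

Lemma classC_le k m f : (k <= m)%N -> classC m f -> classC k f.
Proof.
by elim: m => [|m IH]; [rewrite leqn0 => /eqP->|rewrite leq_eqVlt => /predU1P[->//|/IH h /classCS]].
Qed.

Lemma classC_partial k f (i : 'I_n) : classC k.+1 f -> classC k (partial i f).
Proof. by case=> _ /(_ i)[]. Qed.

Lemma classC_derive k f x (i : 'I_n) : classC k.+1 f -> is_derive x 'e_i f (partial i f x).
Proof. by case=> _ /(_ i)[H _]; exact: derivable_partial. Qed.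

Lemma classC_dir k f x v : classC k.+1 f ->
  is_derive x v f (\sum_i v 0 i * partial i f x).
Proof.
move=> Cf; apply: is_derive_dir => i; first by move=> y; have [] := classC_derive y i Cf.
exact: (classC_cont (classC_partial i Cf)).
Qed.

Lemma classC_is_derive k f (f' : 'I_n -> E -> R) : continuous f ->
  (forall i x, is_derive x 'e_i f (f' i x)) -> (forall i, classC k (f' i)) ->
  classC k.+1 f.
Proof.
move=> cf H Cf'; split=> // i; split; first by move=> x; have [] := H i x.
suff -> : partial i f = f' i by [].
by apply/funext => x; exact: is_derive_partial.
Qed.

Lemma classC_cst k (c : R) : classC k (fun _ : E => c).
Proof.
elim: k c => [|k IH] c; first by split=> //; exact: cst_continuous.
apply: (@classC_is_derive _ _ (fun _ _ => 0)) => //.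
- exact: cst_continuous.
Qed.

Lemma classC_add k f g : classC k f -> classC k g -> classC k (fun x => f x + g x).
Proof.
elim: k f g => [|k IH] f g Cf Cg.
  by split=> // x; apply: continuousD; [exact: (classC_cont Cf)|exact: (classC_cont Cg)].
apply: (@classC_is_derive _ _ (fun i x => partial i f x + partial i g x)).
- by move=> x; apply: continuousD; [exact: (classC_cont Cf)|exact: (classC_cont Cg)].
- by move=> i x; apply: is_derive_add; [exact: classC_derive Cf|exact: classC_derive Cg].
- by move=> i; apply: IH; exact: classC_partial.
Qed.

Lemma classC_mul k f g : classC k f -> classC k g -> classC k (fun x => f x * g x).
Proof.
elim: k f g => [|k IH] f g Cf Cg.
  by split=> // x; apply: continuousM; [exact: (classC_cont Cf)|exact: (classC_cont Cg)].
apply: (@classC_is_derive _ _ (fun i x => f x * partial i g x + g x * partial i f x)).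
- by move=> x; apply: continuousM; [exact: (classC_cont Cf)|exact: (classC_cont Cg)].
- by move=> i x; apply: is_derive_mul; [exact: classC_derive Cf|exact: classC_derive Cg].
- by move=> i; apply: classC_add; apply: IH;
    by [exact: classCS|exact: classC_partial].
Qed.

Lemma classC_scale k (c : R) f : classC k f -> classC k (fun x => c * f x).
Proof. by move=> Cf; apply: classC_mul => //; exact: classC_cst. Qed.

Lemma classC_sum k (I : Type) (r : seq I) (h : I -> E -> R) :
  (forall i, classC k (h i)) -> classC k (fun x => \sum_(i <- r) h i x).
Proof.
move=> H; elim: r => [|a r IH].
  rewrite (_ : (fun _ => _) = fun=> 0); first exact: classC_cst.
  by apply/funext => y; rewrite big_nil.
rewrite (_ : (fun _ => _) = fun y => h a y + \sum_(i <- r) h i y).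
  exact: classC_add.
by apply/funext => y; rewrite big_cons.
Qed.

Lemma classC_coord k (i : 'I_n) : classC k (fun x : E => x 0 i).
Proof.
case: k => [|k]; first by split=> //; exact: coord_continuous.
apply: (@classC_is_derive _ _ (fun j _ => 'e_j 0 i)).
- exact: coord_continuous.
- by move=> j x; exact: is_derive_coord.
- by move=> j; exact: classC_cst.
Qed.

Lemma classC2_comp (k k1 k2 : R -> R) f : classC 2 f ->
  (forall x, is_derive (f x) 1 k (k1 (f x))) ->
  (forall x, is_derive (f x) 1 k1 (k2 (f x))) ->
  continuous (fun x => k2 (f x)) ->
  classC 2 (fun x => k (f x)).
Proof.
move=> Cf dk dk1 ck2.
have comp_cont (h h1 : R -> R) : (forall x, is_derive (f x) 1 h (h1 (f x))) ->
    continuous (fun x => h (f x)).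
  move=> dh x; apply: (@continuous_comp _ _ _ f h); first exact: (classC_cont Cf).
  by apply: differentiable_continuous; apply/derivable1_diffP; have [] := dh x.
have C1 : classC 1 (fun x => k1 (f x)).
  apply: (@classC_is_derive _ _ (fun i x => k2 (f x) * partial i f x)).
  - exact: comp_cont dk1.
  - by move=> i x; apply: is_derive_compE; exact: classC_derive Cf.
  - move=> i; apply: classC_mul; first by split.
    exact: (@classCS 0 _ (classC_partial i Cf)).
apply: (@classC_is_derive _ _ (fun i x => k1 (f x) * partial i f x)).
- exact: comp_cont dk.
- by move=> i x; apply: is_derive_compE; exact: classC_derive Cf.
- by move=> i; apply: classC_mul => //; exact: classC_partial.
Qed.

Lemma partial_add f g (i : 'I_n) x : classC 1 f -> classC 1 g ->
  partial i (fun x => f x + g x) x = partial i f x + partial i g x.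
Proof.
by move=> Cf Cg; apply: is_derive_partial; apply: is_derive_add;
  [exact: classC_derive Cf|exact: classC_derive Cg].
Qed.

Lemma partial_mul f g (i : 'I_n) x : classC 1 f -> classC 1 g ->
  partial i (fun x => f x * g x) x = f x * partial i g x + g x * partial i f x.
Proof.
by move=> Cf Cg; apply: is_derive_partial; apply: is_derive_mul;
  [exact: classC_derive Cf|exact: classC_derive Cg].
Qed.

Lemma partial_comp (k k1 : R -> R) f (i : 'I_n) x : classC 1 f ->
  is_derive (f x) 1 k (k1 (f x)) ->
  partial i (fun x => k (f x)) x = k1 (f x) * partial i f x.
Proof.
by move=> Cf dk; apply: is_derive_partial; apply: is_derive_compE => //;
  exact: classC_derive Cf.
Qed.

Lemma partial_cst (c : R) (i : 'I_n) : partial i (fun _ : E => c) = fun=> 0.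
Proof. by apply/funext => x; apply: is_derive_partial; exact: is_derive_cst. Qed.

End ClassC.

(** * Algebra of the operator *)

Ltac ring_atoms :=
  repeat match goal with
  | |- context [@partial ?T ?n ?i ?f ?x] => generalize (@partial T n i f x); intro
  | |- context [@fun_of_matrix ?T ?m ?n ?M ?i ?j] =>
      generalize (@fun_of_matrix T m n M i j); intro
  end; ring.

Section OpAlgebra.
Context {R : realType} {n q : nat}.
Local Notation E := 'rV[R]_n.
Variables (fb : 'I_q -> 'I_n) (Q : E -> 'M[R]_q) (B : 'M[R]_n) (F : E -> 'rV[R]_q).
Implicit Types (f g : E -> R) (x : E).

(** The operator for an abstract family fb of diffusive coordinates; for the
    indices of the first block it is opA by conversion. *)
Definition Aop f : E -> R := fun x =>
  \sum_i \sum_j Q x i j * partial (fb i) (partial (fb j) f) x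
  + \sum_i \sum_j B i j * x 0 j * partial i f x
  + \sum_j F x 0 j * partial (fb j) f x.
Local Notation A := Aop.

(** The square field operator: A (f g) = f A g + g A f + 2 Gam f g. *)
Definition Gam f g x : R :=
  \sum_i \sum_j Q x i j * (partial (fb i) f x * partial (fb j) g x).

Lemma Aop_add f g x : classC 2 f -> classC 2 g ->
  A (fun x => f x + g x) x = A f x + A g x.
Proof.
move=> Cf Cg; rewrite /Aop.
have P i : partial i (fun x => f x + g x) = fun x => partial i f x + partial i g x.
  by apply/funext => y; apply: partial_add; exact: classCS.
have PP i j y : partial i (partial j (fun x => f x + g x)) y =
    partial i (partial j f) y + partial i (partial j g) y.
  by rewrite P; exact: (partial_add i y (classC_partial j Cf) (classC_partial j Cg)).
rewrite addrACA [X in _ = X + _]addrACA; congr (_ + _ + _).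
- rewrite -big_split; apply: eq_bigr => i _ /=.
  rewrite -big_split; apply: eq_bigr => j _ /=.
  by rewrite PP mulrDr.
- rewrite -big_split; apply: eq_bigr => i _ /=.
  rewrite -big_split; apply: eq_bigr => j _ /=.
  by rewrite P mulrDr.
- by rewrite -big_split; apply: eq_bigr => i _ /=; rewrite P mulrDr.
Qed.

Lemma Aop_cst (c : R) x : A (fun _ => c) x = 0.
Proof.
rewrite /Aop; rewrite !big1 ?addr0// => i _.
- by rewrite partial_cst mulr0.
- by rewrite big1// => j _; rewrite partial_cst mulr0.
- by rewrite big1// => j _; rewrite !partial_cst mulr0.
Qed.

Lemma Aop_mul f g x : (forall y, (Q y)^T = Q y) -> classC 2 f -> classC 2 g ->
  A (fun x => f x * g x) x = f x * A g x + g x * A f x + 2 * Gam f g x.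
Proof.
move=> Qs Cf Cg; rewrite /Aop.
have [Cf1 Cg1] : classC 1 f /\ classC 1 g by split; exact: classCS.
have P i : partial i (fun x => f x * g x) =
    fun x => f x * partial i g x + g x * partial i f x.
  by apply/funext => y; apply: partial_mul.
have PP i j y : partial i (partial j (fun x => f x * g x)) y =
    f y * partial i (partial j g) y + g y * partial i (partial j f) y
    + (partial i f y * partial j g y + partial i g y * partial j f y).
  have [Cfj Cgj] : classC 1 (partial j f) /\ classC 1 (partial j g).
    by split; exact: classC_partial.
  rewrite P partial_add; [|exact: classC_mul|exact: classC_mul].
  rewrite (partial_mul i y Cf1 Cgj) (partial_mul i y Cg1 Cfj).
  by move: (f y) (g y) => ? ?; ring_atoms.
have GG : 2 * Gam f g x = \sum_i \sum_j Q x i j *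
    (partial (fb i) f x * partial (fb j) g x + partial (fb i) g x * partial (fb j) f x).
  rewrite /Gam mulr_natl mulr2n {2}exchange_big -big_split /=.
  apply: eq_bigr => i _; rewrite -big_split; apply: eq_bigr => j _ /=.
  by rewrite -[in Q x j i]Qs mxE; ring_atoms.
have E1 : \sum_i \sum_j Q x i j * partial (fb i) (partial (fb j) (fun x => f x * g x)) x =
   f x * (\sum_i \sum_j Q x i j * partial (fb i) (partial (fb j) g) x)
   + g x * (\sum_i \sum_j Q x i j * partial (fb i) (partial (fb j) f) x)
   + 2 * Gam f g x.
  rewrite GG !mulr_sumr -!big_split; apply: eq_bigr => i _ /=.
  rewrite !mulr_sumr -!big_split; apply: eq_bigr => j _ /=.
  by rewrite PP; ring_atoms.
have E2 : \sum_i \sum_j B i j * x 0 j * partial i (fun x => f x * g x) x =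
   f x * (\sum_i \sum_j B i j * x 0 j * partial i g x)
   + g x * (\sum_i \sum_j B i j * x 0 j * partial i f x).
  rewrite !mulr_sumr -!big_split; apply: eq_bigr => i _ /=.
  rewrite !mulr_sumr -!big_split; apply: eq_bigr => j _ /=.
  by rewrite P; ring_atoms.
have E3 : \sum_j F x 0 j * partial (fb j) (fun x => f x * g x) x =
   f x * (\sum_j F x 0 j * partial (fb j) g x)
   + g x * (\sum_j F x 0 j * partial (fb j) f x).
  rewrite !mulr_sumr -!big_split; apply: eq_bigr => i _ /=.
  by rewrite P; ring_atoms.
transitivity (f x * \sum_i \sum_j Q x i j * partial (fb i) (partial (fb j) g) x
   + g x * \sum_i \sum_j Q x i j * partial (fb i) (partial (fb j) f) x
   + 2 * Gam f g x
   + (f x * \sum_i \sum_j B i j * x 0 j * partial i g x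
      + g x * \sum_i \sum_j B i j * x 0 j * partial i f x)
   + (f x * \sum_j F x 0 j * partial (fb j) g x
      + g x * \sum_j F x 0 j * partial (fb j) f x)); first by congr (_ + _ + _).
have id9 (a b c d e h s t u : R) : s * a + t * b + u + (s * c + t * d) + (s * e + t * h)
  = s * (a + c + e) + t * (b + d + h) + u by ring.
exact: id9.
Qed.

Lemma Aop_scale (c : R) f x : classC 2 f -> A (fun x => c * f x) x = c * A f x.
Proof.
move=> Cf; rewrite /Aop.
have P i (h : E -> R) : classC 1 h ->
    partial i (fun x => c * h x) = fun x => c * partial i h x.
  move=> Ch; apply/funext => y; rewrite (partial_mul i y (classC_cst 1 c) Ch).
  by rewrite partial_cst mulr0 addr0.
rewrite !mulrDr; congr (_ + _ + _).
- rewrite mulr_sumr; apply: eq_bigr => i _; rewrite mulr_sumr; apply: eq_bigr => j _.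
  by rewrite !P; [rewrite mulrCA|exact: classC_partial|exact: classCS].
- rewrite mulr_sumr; apply: eq_bigr => i _; rewrite mulr_sumr; apply: eq_bigr => j _.
  by rewrite !P; [rewrite mulrCA|exact: classCS].
- rewrite mulr_sumr; apply: eq_bigr => i _.
  by rewrite !P; [rewrite mulrCA|exact: classCS].
Qed.

Lemma Aop_sum (I : Type) (s : seq I) (h : I -> E -> R) x : (forall i, classC 2 (h i)) ->
  A (fun x => \sum_(i <- s) h i x) x = \sum_(i <- s) A (h i) x.
Proof.
move=> H; elim: s => [|a s IH].
  rewrite big_nil (_ : (fun _ => _) = fun=> 0) ?Aop_cst//.
  by apply/funext => y; rewrite big_nil.
rewrite big_cons (_ : (fun _ => _) = fun y => h a y + \sum_(i <- s) h i y).
  by rewrite Aop_add// ?IH//; exact: classC_sum.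
by apply/funext => y; rewrite big_cons.
Qed.

Lemma Aop_comp (k k1 k2 : R -> R) f x : classC 2 f ->
  (forall x, is_derive (f x) 1 k (k1 (f x))) ->
  (forall x, is_derive (f x) 1 k1 (k2 (f x))) ->
  continuous (fun x => k2 (f x)) ->
  A (fun x => k (f x)) x = k1 (f x) * A f x + k2 (f x) * Gam f f x.
Proof.
move=> Cf dk dk1 ck2; rewrite /Aop.
have Cf1 : classC 1 f by exact: classCS.
have P i : partial i (fun x => k (f x)) = fun x => k1 (f x) * partial i f x.
  by apply/funext => y; exact: partial_comp.
have C1 : classC 1 (fun x => k1 (f x)).
  apply: (@classC_is_derive _ _ _ _ (fun i x => k2 (f x) * partial i f x)).
  - move=> y; apply: (@continuous_comp _ _ _ f k1); first exact: (classC_cont Cf).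
    by apply: differentiable_continuous; apply/derivable1_diffP; have [] := dk1 y.
  - by move=> i y; apply: is_derive_compE; exact: classC_derive Cf.
  - move=> i; apply: classC_mul; first by split.
    exact: (@classCS _ _ 0 _ (classC_partial i Cf)).
have PP i j y : partial i (partial j (fun x => k (f x))) y =
    k1 (f y) * partial i (partial j f) y + k2 (f y) * (partial i f y * partial j f y).
  rewrite P (partial_mul i y C1 (classC_partial j Cf)).
  by rewrite (partial_comp _ Cf1 (dk1 y)); move: (k1 (f y)) (k2 (f y)) => ? ?; ring_atoms.
have E1 : \sum_i \sum_j Q x i j * partial (fb i) (partial (fb j) (fun x => k (f x))) x =
    k1 (f x) * (\sum_i \sum_j Q x i j * partial (fb i) (partial (fb j) f) x)
    + k2 (f x) * Gam f f x.
  rewrite !mulr_sumr -big_split; apply: eq_bigr => i _ /=.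
  rewrite !mulr_sumr -big_split; apply: eq_bigr => j _ /=.
  by rewrite PP; ring_atoms.
have E2 : \sum_i \sum_j B i j * x 0 j * partial i (fun x => k (f x)) x =
    k1 (f x) * (\sum_i \sum_j B i j * x 0 j * partial i f x).
  rewrite !mulr_sumr; apply: eq_bigr => i _; rewrite mulr_sumr; apply: eq_bigr => j _.
  by rewrite P; ring_atoms.
have E3 : \sum_j F x 0 j * partial (fb j) (fun x => k (f x)) x =
    k1 (f x) * (\sum_j F x 0 j * partial (fb j) f x).
  by rewrite !mulr_sumr; apply: eq_bigr => i _; rewrite P; ring_atoms.
have id7 (a b c d s t : R) : s * a + t * d + s * b + s * c = s * (a + b + c) + t * d by ring.
etransitivity; last exact: id7.
by congr (_ + _ + _).
Qed.

End OpAlgebra.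

(** * Factorisation of pairs of positive matrices *)

Section LinearAlgebra.
Context {R : rcfType}.

Lemma cauchy_schwarz (I : finType) (a b : I -> R) :
  (\sum_i a i * b i) ^+ 2 <= (\sum_i a i ^+ 2) * (\sum_i b i ^+ 2).
Proof.
rewrite -subr_ge0.
suff -> : (\sum_i a i ^+ 2) * (\sum_i b i ^+ 2) - (\sum_i a i * b i) ^+ 2 =
    (\sum_i \sum_j (a i * b j - a j * b i) ^+ 2) / 2.
  by rewrite divr_ge0// sumr_ge0// => i _; rewrite sumr_ge0// => j _; exact: sqr_ge0.
have E1 : (\sum_i a i ^+ 2) * (\sum_i b i ^+ 2) = \sum_i \sum_j a i ^+ 2 * b j ^+ 2.
  by rewrite mulr_suml; apply: eq_bigr => i _; rewrite mulr_sumr.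
have E2 : (\sum_i a i ^+ 2) * (\sum_i b i ^+ 2) = \sum_i \sum_j a j ^+ 2 * b i ^+ 2.
  by rewrite E1 exchange_big.
have E3 : (\sum_i a i * b i) ^+ 2 = \sum_i \sum_j (a i * b i) * (a j * b j).
  by rewrite expr2 mulr_suml; apply: eq_bigr => i _; rewrite mulr_sumr.
have -> : \sum_i \sum_j (a i * b j - a j * b i) ^+ 2 =
   \sum_i \sum_j a i ^+ 2 * b j ^+ 2 + \sum_i \sum_j a j ^+ 2 * b i ^+ 2
   - 2 * \sum_i \sum_j (a i * b i) * (a j * b j).
  rewrite mulr_sumr -sumrN -!big_split; apply: eq_bigr => i _ /=.
  rewrite mulr_sumr -sumrN -!big_split; apply: eq_bigr => j _ /=.
  by ring.
by rewrite -E1 -E2 -E3; field.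
Qed.

Lemma mx11_tr (X : 'M[R]_1) : X 0 0 = X^T 0 0. Proof. by rewrite mxE. Qed.

Lemma addmx11 (X Y : 'M[R]_1) : (X + Y) 0 0 = X 0 0 + Y 0 0. Proof. by rewrite mxE. Qed.

(** The bilinear form of the matrix S. *)
Definition bf n (S : 'M[R]_n) (a b : 'rV_n) : R := (a *m S *m b^T) 0 0.

Section Bilinear.
Context {n : nat}.
Implicit Types (S L : 'M[R]_n) (a b v : 'rV[R]_n).

Lemma bfE S a b : bf S a b = \sum_i \sum_j S i j * a 0 i * b 0 j.
Proof.
rewrite /bf mxE exchange_big; apply: eq_bigr => j _.
by rewrite !mxE mulr_suml; apply: eq_bigr => i _; ring.
Qed.

Lemma bfDl S a b v : bf S (a + b) v = bf S a v + bf S b v.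
Proof. by rewrite /bf !mulmxDl mxE. Qed.
Lemma bfDr S a b v : bf S v (a + b) = bf S v a + bf S v b.
Proof. by rewrite /bf linearD /= mulmxDr mxE. Qed.
Lemma bfNl S a v : bf S (- a) v = - bf S a v.
Proof. by rewrite /bf !mulNmx mxE. Qed.
Lemma bfNr S a v : bf S v (- a) = - bf S v a.
Proof. by rewrite /bf linearN /= mulmxN mxE. Qed.
Lemma bfC S a b : S^T = S -> bf S a b = bf S b a.
Proof.
by move=> s; rewrite /bf [LHS]mx11_tr !trmx_mul trmxK s mulmxA.
Qed.
Lemma bfDm S L a b : bf (S + L) a b = bf S a b + bf L a b.
Proof. by rewrite /bf mulmxDr mulmxDl mxE. Qed.
Lemma bfNm S a b : bf (- S) a b = - bf S a b.
Proof. by rewrite /bf mulmxN mulNmx mxE. Qed.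
Lemma bfZm c S a b : bf (c *: S) a b = c * bf S a b.
Proof. by rewrite /bf -scalemxAr -scalemxAl mxE. Qed.

End Bilinear.

(** Cholesky factorization, by induction on the size through the Schur complement
    of the upper left entry a. When a = 0, the row of a vanishes as well, and the
    convention a^-1 = 0 makes the same formulas correct. *)
Lemma psd_factor n (S : 'M[R]_n) : S^T = S -> (forall v, 0 <= bf S v v) ->
  exists M : 'M[R]_n, S = M *m M^T.
Proof.
elim: n S => [|n IH] S sS pS; first by exists 0; rewrite [S]flatmx0 [RHS]flatmx0.
pose T : 'M[R]_(1 + n) := S.
pose a : R := ulsubmx T 0 0; pose b : 'rV_n := ursubmx T; pose D := drsubmx T.
have ET : T = block_mx a%:M b b^T D.
  rewrite -[T]submxK /a -mx11_scalar; congr block_mx.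
  by rewrite /b trmx_ursub sS.
have sD : D^T = D by rewrite /D trmx_drsub sS.
clearbody a b D.
have form (s : R) (w : 'rV_n) :
    0 <= s ^+ 2 * a + 2 * s * (b *m w^T) 0 0 + bf D w w.
  have pT : forall v : 'rV[R]_(1 + n), 0 <= bf T v v := pS.
  have := pT (row_mx s%:M w); rewrite /bf ET.
  rewrite (mul_row_block s%:M w) tr_row_mx (mul_row_col (s%:M *m a%:M + _)).
  rewrite mulmxDl mulmxDl -!scalar_mxM tr_scalar_mx.
  rewrite !mul_scalar_mx !mul_mx_scalar -scalemxAl /bf.
  have -> : w *m b^T = b *m w^T.
    by apply/matrixP => i j; rewrite !ord1 mx11_tr trmx_mul trmxK.
  set u := b *m w^T; set q := w *m D *m w^T => h; apply: le_trans h _.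
  by rewrite !mxE !eqxx !mulr1n le_eqVlt; apply/orP; left; apply/eqP; ring.
have a0 : 0 <= a by have := form 1 0; rewrite /bf trmx0 !mulmx0 !mxE; lra.
have b0 : a = 0 -> b = 0.
  move=> az; apply/rowP => j; rewrite [RHS]mxE; apply/eqP/negPn/negP => bj.
  pose q := bf D (delta_mx 0 j) (delta_mx 0 j).
  have := form (- (q + 1) / (2 * b 0 j)) (delta_mx 0 j).
  rewrite az mulr0 add0r -/q.
  have -> : (b *m (delta_mx 0 j : 'rV_n)^T) 0 0 = b 0 j.
    by rewrite trmx_delta -colE mxE.
  suff -> : 2 * (- (q + 1) / (2 * b 0 j)) * b 0 j + q = -1 by lra.
  by field; rewrite bj.
pose D' := D - a^-1 *: (b^T *m b).
have [M' EM'] : exists M' : 'M[R]_n, D' = M' *m M'^T.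
  apply: IH; first by rewrite /D' linearB linearZ /= trmx_mul trmxK sD.
  move=> w; have := form (- a^-1 * (b *m w^T) 0 0) w.
  rewrite /D' bfDm bfNm bfZm.
  have -> : bf (b^T *m b) w w = (b *m w^T) 0 0 ^+ 2.
    rewrite /bf mulmxA -mulmxA mxE big_ord1 expr2; congr (_ * _).
    by rewrite mx11_tr trmx_mul trmxK.
  have [->|an] := eqVneq a 0; first by rewrite invr0; lra.
  set t := (b *m w^T) 0 0; move=> h; apply: le_trans h _.
  by rewrite le_eqVlt; apply/orP; left; apply/eqP; field.
pose M : 'M[R]_(1 + n) := block_mx (Num.sqrt a)%:M 0 ((Num.sqrt a)^-1 *: b^T) M'.
suff EM : T = M *m M^T by exists M.
rewrite ET /M (tr_block_mx (Num.sqrt a)%:M) (mulmx_block (Num.sqrt a)%:M).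
rewrite !trmx0 !mulmx0 !mul0mx !addr0 tr_scalar_mx -scalar_mxM -expr2 sqr_sqrtr//.
have sa : a != 0 -> Num.sqrt a != 0 by move=> an; rewrite sqrtr_eq0 -ltNge lt_neqAle eq_sym an.
congr block_mx.
- rewrite linearZ /= trmxK mul_scalar_mx scalerA.
  have [/b0 ->|an] := eqVneq a 0; first by rewrite scaler0.
  by rewrite divff ?scale1r// sa.
- rewrite mul_mx_scalar scalerA.
  have [/b0 ->|an] := eqVneq a 0; first by rewrite trmx0 scaler0.
  by rewrite divff ?scale1r// sa.
- rewrite -EM' /D' linearZ /= trmxK -scalemxAl -scalemxAr scalerA -expr2 exprVn sqr_sqrtr//.
  by rewrite addrCA subrr addr0.
Qed.

(** Positive matrices at nearby points have factors that are close, although the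
    square root is not a Lipschitz function, because the increment P0 - P1 is
    controlled by P0 itself. With P = P0 + P1 and D = P0 - P1, the block matrix
    with diagonal blocks P0, P1 and off-diagonal block C = (P - D P^-1 D) / 2 is
    positive semidefinite: its form at (a, b) is a quarter of the sum of the form of
    P at (a + b) + (a - b) D P^-1 and of the nonnegative form of P - D P^-1 D at
    a + b. The two halves A, B of a factor of it satisfy
    (A - B) (A - B)^T = P - 2 C = D P^-1 D. *)
Lemma coupling n (P0 P1 : 'M[R]_n) (c : R) : P0^T = P0 -> P1^T = P1 ->
  (forall v, v != 0 -> 0 < bf P0 v v) -> (forall v, 0 <= bf P1 v v) -> 0 <= c ->
  (forall i j (v : 'rV_n), (P0 i j - P1 i j) ^+ 2 * (\sum_k v 0 k ^+ 2) <= c * bf P0 v v) ->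
  exists A B : 'M[R]_(n, n + n),
    [/\ P0 = A *m A^T, P1 = B *m B^T &
        \sum_k \sum_i (A i k - B i k) ^+ 2 <= n%:R ^+ 2 * c].
Proof.
move=> s0 s1 p0 p1 c0 hc.
have p0' v : 0 <= bf P0 v v.
  have [->|/p0/ltW//] := eqVneq v 0; by rewrite /bf !mul0mx mxE.
have [P EP] : exists P : 'M[R]_n, P = P0 + P1 by exists (P0 + P1).
have [De EDe] : exists De : 'M[R]_n, De = P0 - P1 by exists (P0 - P1).
have sP : P^T = P by rewrite EP linearD /= s0 s1.
have sDe : De^T = De by rewrite EDe linearB /= s0 s1.
have uP : P \in unitmx.
  rewrite -row_free_unit; apply: inj_row_free => v vP.
  apply/eqP; apply: contraT => /p0; suff : bf P0 v v <= 0 by rewrite leNgt => /negP.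
  by have := p1 v; have : bf P v v = 0 by [rewrite /bf vP mul0mx mxE]; rewrite EP bfDm; lra.
have [L EL] : exists L : 'M[R]_n, L = De *m invmx P by exists (De *m invmx P).
have PLt : P *m L^T = De by rewrite EL trmx_mul sDe trmx_inv sP mulmxA mulmxV// mul1mx.
have bfL a b : bf P a (b *m L) = bf De a b.
  by rewrite /bf trmx_mul mulmxA -(mulmxA a) PLt.
have bfLL a b : bf (L *m P *m L^T) a b = bf P (a *m L) (b *m L).
  by rewrite /bf trmx_mul !mulmxA.
have [C EC] : exists C : 'M[R]_n, C = 2^-1 *: (P - L *m P *m L^T) by eexists.
have sC : C^T = C.
  by rewrite EC linearZ /= linearB /= !trmx_mul trmxK sP mulmxA.
pose S : 'M[R]_(n + n) := block_mx P0 C C P1.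
have [M EM] : exists M : 'M[R]_(n + n), S = M *m M^T.
  apply: psd_factor; first by rewrite /S tr_block_mx s0 s1 sC.
  move=> v; rewrite -[v]hsubmxK; set a := lsubmx v; set b := rsubmx v.
  have -> : bf S (row_mx a b) (row_mx a b) = bf P0 a a + bf P1 b b + 2 * bf C a b.
    rewrite [LHS]/bf /S mul_row_block tr_row_mx mul_row_col !mulmxDl.
    have := bfC a b sC; rewrite /bf => E.
    by rewrite !addmx11 E; ring.
  have key (s : 'rV_n) : bf P (s *m L) (s *m L) <= bf P s s.
    have E : bf P (s *m L) (s *m L) = bf De s (s *m L) by rewrite bfL bfC.
    have := p0' (s - s *m L); have := p1 (s + s *m L).
    move: E; rewrite EP EDe !(bfDl, bfDr, bfNl, bfNr, bfDm, bfNm) (bfC _ s s0) (bfC _ s s1).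
    by rewrite (bfC s (s *m L) s0) (bfC s (s *m L) s1); lra.
  have := key (a + b).
  have : 0 <= bf P ((a + b) + (a - b) *m L) ((a + b) + (a - b) *m L).
    by rewrite EP bfDm addr_ge0.
  have -> : bf P ((a + b) + (a - b) *m L) ((a + b) + (a - b) *m L) =
      bf P (a + b) (a + b) + 2 * bf De (a + b) (a - b) + bf P ((a - b) *m L) ((a - b) *m L).
    by rewrite bfDl !(bfDr P (a + b)) (bfC (_ *m L) (a + b) sP) !bfL; ring.
  rewrite EC bfZm bfDm bfNm bfLL.
  rewrite !mulmxDl mulNmx !(bfDl, bfDr, bfNl, bfNr) (bfC (b *m L) (a *m L) sP).
  rewrite (bfC b a sDe) (bfC b a sP) EP EDe !(bfDm, bfNm).
  by lra.
pose A := usubmx M; pose B := dsubmx M.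
have EM2 : S = block_mx (A *m A^T) (A *m B^T) (B *m A^T) (B *m B^T).
  by rewrite EM -{1 2}[M]vsubmxK tr_col_mx mul_col_row.
have [EA EAB EBA EB] := eq_block_mx EM2.
exists A, B; split=> //.
have -> : \sum_k \sum_i (A i k - B i k) ^+ 2 = \sum_i ((A - B) *m (A - B)^T) i i.
  rewrite exchange_big; apply: eq_bigr => i _; rewrite mxE; apply: eq_bigr => k _.
  by rewrite !mxE expr2.
have -> : (A - B) *m (A - B)^T = L *m P *m L^T.
  have h2 : (2^-1 + 2^-1 : R) = 1.
    by rewrite -mulr2n -[_ *+ 2]mulr_natr mulVf// pnatr_eq0.
  have ECC : C + C = P - L *m P *m L^T by rewrite EC -scalerDl h2 scale1r.
  rewrite linearB /= mulmxBl !mulmxBr -EA -EB -EAB -EBA opprB addrACA -opprD ECC.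
  by rewrite -EP subKr.
have each i : (L *m P *m L^T) i i <= n%:R * c.
  have [v Ev] : exists v : 'rV[R]_n, v = delta_mx 0 i *m L by exists (delta_mx 0 i *m L).
  have -> : (L *m P *m L^T) i i = bf P v v.
    rewrite Ev -bfLL /bf -rowE trmx_delta -colE !mxE; apply: eq_bigr => j _.
    by rewrite !mxE.
  have E : bf P v v = \sum_j De i j * v 0 j.
    rewrite [X in bf _ _ X]Ev bfL (bfC _ _ sDe) /bf -rowE mxE; apply: eq_bigr => j _.
    by rewrite !mxE.
  have q0 : 0 <= bf P v v by rewrite EP bfDm addr_ge0.
  have : bf P v v ^+ 2 <= n%:R * c * bf P v v.
    rewrite {1}E; apply: le_trans (cauchy_schwarz _ _) _.
    rewrite mulr_suml; apply: (@le_trans _ _ (\sum_(j < n) c * bf P v v)).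
      apply: ler_sum => j _; rewrite EDe !mxE; apply: le_trans (hc i j v) _.
      by rewrite ler_wpM2l// EP bfDm lerDl.
    by rewrite sumr_const card_ord -[(_ * _) *+ n]mulr_natl mulrA.
  have [qn|qn] := boolP (bf P v v == 0); first by rewrite (eqP qn) mulr_ge0.
  by rewrite expr2 ler_pM2r// lt_neqAle q0 andbT eq_sym.
apply: (@le_trans _ _ (\sum_(i < n) n%:R * c)); first exact: ler_sum.
by rewrite sumr_const card_ord -[(_ * _) *+ n]mulr_natl mulrA expr2.
Qed.

End LinearAlgebra.

(** * Growth of the coefficients *)

Section Quadratic.
Context {R : realType} {n : nat}.
Local Notation E := 'rV[R]_n.
Implicit Types (x y v : E).

(** The squared Euclidean distance, and the weight V whose sublevels exhaust the
    space; the norm of row vectors, a maximum, is not differentiable. *)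
Definition sqd x y : R := \sum_i (x 0 i - y 0 i) ^+ 2.
Definition V x : R := 1 + \sum_i x 0 i ^+ 2.

Lemma sqd_ge0 x y : 0 <= sqd x y.
Proof. by apply: sumr_ge0 => i _; exact: sqr_ge0. Qed.

Lemma sqdC x y : sqd x y = sqd y x.
Proof. by apply: eq_bigr => i _; ring. Qed.

Lemma sqdxx x : sqd x x = 0.
Proof. by rewrite /sqd big1// => i _; rewrite subrr expr0n. Qed.

Lemma sqd0 x : V x = 1 + sqd x 0.
Proof. by congr (_ + _); apply: eq_bigr => i _; rewrite mxE subr0. Qed.

Lemma V_ge1 x : 1 <= V x.
Proof. by rewrite sqd0 lerDl sqd_ge0. Qed.

Lemma V_gt0 x : 0 < V x.
Proof. exact: lt_le_trans (V_ge1 x). Qed.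

Lemma coord_sq_le_sqd x y i : (x 0 i - y 0 i) ^+ 2 <= sqd x y.
Proof.
by rewrite /sqd (bigD1 i)//= lerDl sumr_ge0// => j _; exact: sqr_ge0.
Qed.

Lemma coord_sq_le_V x i : x 0 i ^+ 2 <= V x.
Proof.
by rewrite sqd0; have := coord_sq_le_sqd x 0 i; rewrite mxE subr0; lra.
Qed.

Lemma sqd_triangle x y z : sqd x z <= 2 * sqd x y + 2 * sqd y z.
Proof.
rewrite /sqd !mulr_sumr -big_split; apply: ler_sum => i _ /=.
rewrite -subr_ge0 (_ : _ - _ = (x 0 i - y 0 i - (y 0 i - z 0 i)) ^+ 2) ?sqr_ge0//; ring.
Qed.

Lemma V_le_sqd x y : V x <= 2 * V y + 2 * sqd x y.
Proof. by rewrite !sqd0; have := sqd_triangle x y 0; lra. Qed.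

Lemma classC_sqd k y : classC k (sqd^~ y).
Proof.
apply: classC_sum => i.
rewrite (_ : (fun _ => _) = fun x : E => (x 0 i + (- y 0 i)) * (x 0 i + (- y 0 i))).
  by apply: classC_mul; apply: classC_add; [exact: classC_coord|exact: classC_cst|exact: classC_coord|exact: classC_cst].
by apply/funext => x; rewrite expr2.
Qed.

Lemma is_derive_sqd x y v :
  is_derive x v (sqd^~ y) (\sum_i 2 * (x 0 i - y 0 i) * v 0 i).
Proof.
apply: is_derive_sumE => i.
rewrite (_ : (fun _ => _) = fun x : E => (x 0 i + (- y 0 i)) * (x 0 i + (- y 0 i))); last first.
  by apply/funext => z; rewrite expr2.
have H : is_derive x v (fun x : E => x 0 i + (- y 0 i)) (v 0 i).
  rewrite -[X in is_derive _ _ _ X]addr0.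
  by apply: is_derive_add; exact: is_derive_coord.
apply: is_derive_eq (is_derive_mul H H) _; ring.
Qed.

Lemma partial_sqd i x y : partial i (sqd^~ y) x = 2 * (x 0 i - y 0 i).
Proof.
apply: is_derive_partial; apply: is_derive_eq (is_derive_sqd _ _ _) _.
rewrite (bigD1 i)//= !mxE !eqxx mulr1 big1 ?addr0// => j ji.
by rewrite !mxE eqxx (negbTE ji) mulr0.
Qed.

Lemma partial2_sqd i j x y : partial i (partial j (sqd^~ y)) x = 2 * (i == j)%:R.
Proof.
rewrite (_ : partial j _ = fun x : E => 2 * (x 0 j + - y 0 j)); last first.
  by apply/funext => z; rewrite partial_sqd.
apply: is_derive_partial; apply: is_derive_scale.
rewrite -[X in is_derive _ _ _ X]addr0; apply: is_derive_add.
by apply: is_derive_eq (is_derive_coord _ _ _) _; rewrite mxE eqxx eq_sym.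
Qed.

Lemma VE : V = fun x => 1 + sqd x 0.
Proof. by apply/funext => x; exact: sqd0. Qed.

Lemma classC_V k : classC k V.
Proof. by rewrite VE; apply: classC_add; [exact: classC_cst|exact: classC_sqd]. Qed.

Lemma partial_V i x : partial i V x = 2 * x 0 i.
Proof.
rewrite VE partial_add; [|exact: classC_cst|exact: classC_sqd].
by rewrite partial_cst add0r partial_sqd mxE subr0.
Qed.

Lemma enorm_sq x : enorm x ^+ 2 = \sum_i x 0 i ^+ 2.
Proof. by rewrite sqr_sqrtr// sumr_ge0// => i _; exact: sqr_ge0. Qed.

Lemma enorm_ge0 x : 0 <= enorm x. Proof. exact: sqrtr_ge0. Qed.

Lemma coord_le_enorm x i : `|x 0 i| <= enorm x.
Proof.
rewrite -sqrtr_sqr ler_wsqrtr// (bigD1 i)//= lerDl sumr_ge0// => j _.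
exact: sqr_ge0.
Qed.

End Quadratic.

Section Mpartial.
Context {R : realType} {n : nat}.
Implicit Types (f : 'rV[R]_n -> R) (s : seq 'I_n).

Lemma mpartial0 f : mpartial (fun=> 0%N) f = f.
Proof. by rewrite /mpartial; elim: (enum _) => //= a s ->. Qed.

Lemma mpartial1 f k : mpartial (fun i => (i == k) : nat) f = partial k f.
Proof.
rewrite /mpartial.
have H s : k \notin s -> foldr (fun (i : 'I_n) (g : _ -> R) =>
    iter (i == k) (partial i) g) f s = f.
  elim: s => //= a s IH; rewrite inE negb_or => /andP[ka /IH ->].
  by rewrite eq_sym (negbTE ka).
have : k \in enum 'I_n by rewrite mem_enum.
have := enum_uniq 'I_n; elim: (enum _) => //= a s IH /andP[as_ us].
rewrite inE => /predU1P[E|ks]; first by rewrite -E eqxx /= H// E.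
rewrite IH//; case: eqP => // E; by move: as_; rewrite E ks.
Qed.

Lemma mlength1 (k : 'I_n) : mlength (fun i => (i == k) : nat) = 1%N.
Proof.
rewrite /mlength (bigD1 k)//= eqxx big1 ?addn0// => i.
by move/negbTE => ->.
Qed.

Lemma mlength0 : mlength (fun _ : 'I_n => 0%N) = 0%N.
Proof. by rewrite /mlength big1. Qed.

End Mpartial.

(** The consequences of the standing hypotheses from which everything follows.
    The function nu no longer appears: it is bounded by a multiple of V, and the
    increments of the coefficients over distances at most 1 are compared with the
    quadratic form of Q at one of the two points. *)
Record regular_coefficients {R : realType} {n q : nat}
    (Q : 'rV[R]_n -> 'M[R]_q) (F : 'rV[R]_n -> 'rV[R]_q) : Prop := {
  coef_sym : forall x, (Q x)^T = Q x;
  coef_pos : forall x (v : 'rV[R]_q), v != 0 -> 0 < bf (Q x) v v;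
  coef_classC : (forall i j, classC 2 (fun x => Q x i j)) /\
    (forall j, classC 2 (fun x => F x 0 j));
  coef_growth : exists2 C, 0 <= C & forall x,
    (forall i j, `|Q x i j| <= C * V x) /\ (forall j, F x 0 j ^+ 2 <= C * V x);
  coef_local : exists2 C, 0 <= C & forall x y (xi : 'rV[R]_q), sqd x y <= 1 ->
    (forall i j, (Q x i j - Q y i j) ^+ 2 * (\sum_k xi 0 k ^+ 2)
       <= C * sqd x y * bf (Q x) xi xi) /\
    (forall j, (F x 0 j - F y 0 j) ^+ 2 * (\sum_k xi 0 k ^+ 2)
       <= C * sqd x y * bf (Q x) xi xi) }.

Section Growth.
Context {R : realType} {n q kappa : nat}.
Local Notation E := 'rV[R]_n.
Variables (Q : E -> 'M[R]_q) (F : E -> 'rV[R]_q) (nu : E -> R).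
Hypotheses (q_gt0 : (0 < q)%N) (kappa3 : (3 <= kappa)%N)
  (Qsym : forall x, (Q x)^T = Q x)
  (QC : forall i j, classC kappa (fun x => Q x i j))
  (FC : forall j, classC kappa (fun x => F x 0 j))
  (nu0 : forall x, 0 < nu x) (nu_inf : 0 < inf (range nu))
  (Qell : forall (x : E) (xi : 'rV[R]_q),
    \sum_i \sum_j Q x i j * xi 0 i * xi 0 j >= nu x * enorm xi ^+ 2)
  (Qgrowth : exists C : nat -> R,
    forall (x : E) (i j : 'I_q) (alpha : 'I_n -> nat),
    (mlength alpha <= kappa)%N ->
    `|mpartial alpha (fun y => Q y i j) x| <=
      C (mlength alpha) * (1 + enorm x) ^+ (1 - mlength alpha)%N
      * Num.sqrt (nu x))
  (Fgrowth : exists C : R, forall (x : E) (alpha : 'I_n -> nat),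
    (mlength alpha <= kappa)%N ->
    enorm (\row_j mpartial alpha (fun y => F y 0 j) x) <=
      C * Num.sqrt (nu x)).

Lemma nu_lower : exists2 c, 0 < c & forall x, c <= nu x.
Proof.
exists (inf (range nu)); first exact: nu_inf.
move=> x; apply: ge_inf; last by exists x.
by exists 0 => _ [y _ <-]; apply/ltW.
Qed.

Lemma Q_ge (xi : 'rV[R]_q) x : nu x * (\sum_i xi 0 i ^+ 2) <= bf (Q x) xi xi.
Proof. by rewrite -enorm_sq bfE; exact: Qell. Qed.

(** Ellipticity bounds nu by the diagonal entries of Q, which are at most
    C (1 + |x|) sqrt(nu); hence sqrt(nu) grows at most linearly. *)
Lemma coefficient_growth : exists2 C, 0 <= C & forall x,
  [/\ forall i j, `|Q x i j| <= C * V x,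
      forall j, F x 0 j ^+ 2 <= C * V x,
      forall i j k, partial k (fun y => Q y i j) x ^+ 2 <= C * nu x &
      forall j k, partial k (fun y => F y 0 j) x ^+ 2 <= C * nu x].
Proof.
have [C0 HQ] := Qgrowth.
have [C1 HF] := Fgrowth.
have snu x : 0 < Num.sqrt (nu x) by rewrite sqrtr_gt0.
have snu2 x : Num.sqrt (nu x) ^+ 2 = nu x by rewrite sqr_sqrtr// ltW.
have e1 (x : E) : 0 < 1 + enorm x by have := enorm_ge0 x; lra.
have eV (x : E) : (1 + enorm x) ^+ 2 <= 2 * V x.
  have -> : V x = 1 + enorm x ^+ 2 by rewrite enorm_sq.
  by rewrite -subr_ge0 (_ : _ - _ = (1 - enorm x) ^+ 2) ?sqr_ge0//; ring.
have Q0 x i j : `|Q x i j| <= C0 0%N * (1 + enorm x) * Num.sqrt (nu x).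
  by have := HQ x i j (fun=> 0%N); rewrite mlength0 mpartial0; apply.
have Q1 x i j k : `|partial k (fun y => Q y i j) x| <= C0 1%N * Num.sqrt (nu x).
  have := HQ x i j (fun i => (i == k) : nat).
  rewrite mlength1 mpartial1 expr0 mulr1; apply; exact: leq_trans kappa3.
have F0 x j : `|F x 0 j| <= C1 * Num.sqrt (nu x).
  have := HF x (fun=> 0%N); rewrite mlength0 => /(_ isT); apply: le_trans.
  have := coord_le_enorm (\row_j mpartial (fun=> 0%N) (fun y => F y 0 j) x) j.
  by rewrite mxE mpartial0.
have F1 x j k : `|partial k (fun y => F y 0 j) x| <= C1 * Num.sqrt (nu x).
  have := HF x (fun i => (i == k) : nat); rewrite mlength1.
  move=> /(_ (leq_trans (isT : (1 <= 3)%N) kappa3)); apply: le_trans.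
  have := coord_le_enorm (\row_j mpartial (fun i => (i == k) : nat) (fun y => F y 0 j) x) j.
  by rewrite mxE mpartial1.
(* Ellipticity in the direction of one coordinate. *)
have snuC x : Num.sqrt (nu x) <= C0 0%N * (1 + enorm x).
  have i0 : 'I_q := Ordinal q_gt0.
  have := Q_ge (delta_mx 0 i0) x.
  rewrite (bigD1 i0)//= big1 => [|i ni]; last by rewrite mxE eqxx (negbTE ni) expr0n.
  rewrite mxE !eqxx expr1n addr0 mulr1 bfE (bigD1 i0)//= [X in _ + X]big1 ?addr0; last first.
    by move=> i ni; apply: big1 => j _; rewrite mxE eqxx (negbTE ni) mulr0 mul0r.
  rewrite (bigD1 i0)//= big1 ?addr0; last first.
    by move=> j nj; rewrite !mxE eqxx (negbTE nj) mulr0.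
  rewrite !mxE !eqxx !mulr1 => h.
  have := le_trans h (le_trans (ler_norm _) (Q0 x i0 i0)).
  by rewrite -[X in X <= _]snu2 expr2 ler_pM2r.
have C00 : 0 <= C0 0%N.
  have := le_trans (ltW (snu 0)) (snuC 0); by rewrite pmulr_lge0.
have eCV (x : E) : (C0 0%N * (1 + enorm x)) ^+ 2 <= 2 * C0 0%N ^+ 2 * V x.
  rewrite exprMn (_ : 2 * _ * _ = C0 0%N ^+ 2 * (2 * V x)); last by ring.
  by rewrite ler_wpM2l ?sqr_ge0// eV.
have nuV x : nu x <= 2 * C0 0%N ^+ 2 * V x.
  rewrite -snu2; apply: le_trans (eCV x).
  by rewrite ler_pXn2r ?nnegrE ?(ltW (snu x))// mulr_ge0// ltW.
have sq_le (a b c : R) : `|a| <= b -> b ^+ 2 <= c -> a ^+ 2 <= c.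
  move=> ab; apply: le_trans; rewrite -real_normK ?num_real//.
  by rewrite ler_pXn2r ?nnegrE// (le_trans _ ab).
pose C := 2 * C0 0%N ^+ 2 + C1 ^+ 2 * (2 * C0 0%N ^+ 2) + C0 1%N ^+ 2 + C1 ^+ 2.
have c2 a : 0 <= a ^+ 2 := @sqr_ge0 R a.
have ccp : 0 <= C1 ^+ 2 * (2 * C0 0%N ^+ 2) by rewrite mulr_ge0// mulr_ge0.
exists C; first by have := c2 (C0 0%N); have := c2 C1; have := c2 (C0 1%N); rewrite /C; lra.
have V0 (x : E) := V_gt0 x.
move=> x; split.
- move=> i j; apply: le_trans (Q0 x i j) _.
  apply: (@le_trans _ _ (2 * C0 0%N ^+ 2 * V x)); last first.
    rewrite ler_wpM2r ?(ltW (V0 x)) ?(ltW (nu0 x))//; by have := c2 C1; have := c2 (C0 0%N); have := c2 (C0 1%N); rewrite /C; lra.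
  apply: (@le_trans _ _ ((C0 0%N * (1 + enorm x)) ^+ 2)).
    by rewrite expr2 ler_wpM2l// mulr_ge0// ltW.
  exact: eCV.
- move=> j; apply: sq_le (F0 x j) _; rewrite exprMn snu2.
  apply: (@le_trans _ _ (C1 ^+ 2 * (2 * C0 0%N ^+ 2) * V x)).
    by rewrite -mulrA ler_wpM2l// nuV.
  rewrite ler_wpM2r ?(ltW (V0 x)) ?(ltW (nu0 x))//; by have := c2 C1; have := c2 (C0 0%N); have := c2 (C0 1%N); rewrite /C; lra.
- move=> i j k; apply: sq_le (Q1 x i j k) _; rewrite exprMn snu2.
  rewrite ler_wpM2r ?(ltW (V0 x)) ?(ltW (nu0 x))//; by have := c2 C1; have := c2 (C0 0%N); have := c2 (C0 1%N); rewrite /C; lra.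
- move=> j k; apply: sq_le (F1 x j k) _; rewrite exprMn snu2.
  rewrite ler_wpM2r ?(ltW (V0 x)) ?(ltW (nu0 x))//; by have := c2 C1; have := c2 (C0 0%N); have := c2 (C0 1%N); rewrite /C; lra.
Qed.


(** Along a segment of length at most 1, the derivative of <Q xi, xi> is at most a
    multiple of sqrt(nu) |xi|^2, hence of <Q xi, xi> itself because nu is bounded
    below; by Gronwall's inequality this form varies by a bounded factor, and it
    bounds nu |xi|^2 at every point of the segment. *)
Lemma Q_segment : exists2 M, 0 <= M & forall (x v : E) (s : R) (xi : 'rV[R]_q),
  \sum_k v 0 k ^+ 2 <= 1 -> 0 <= s <= 1 ->
  nu (s *: v + x) * (\sum_i xi 0 i ^+ 2) <= M * bf (Q x) xi xi.
Proof.
have [C C0 HC] := coefficient_growth.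
have [c c0 cnu] := nu_lower.
pose K := \sum_(i < q) \sum_(j < q) \sum_(k < n) (C / c + 1).
have Cc0 : 0 <= C / c by rewrite divr_ge0// ltW.
have K0 : 0 <= K by do 3 (apply: sumr_ge0 => ? _); rewrite addr_ge0.
exists (expR K); first exact: expR_ge0.
move=> x v s xi v1 /andP[s0 s1].
set X := \sum_i xi 0 i ^+ 2.
have X0 : 0 <= X by apply: sumr_ge0 => i _; exact: sqr_ge0.
pose phi t := bf (Q (t *: v + x)) xi xi.
pose dphi t := \sum_i \sum_j
  (\sum_k v 0 k * partial k (fun y => Q y i j) (t *: v + x)) * (xi 0 i * xi 0 j).
have Dphi (t : R) : is_derive t 1 phi (dphi t).
  rewrite /phi (_ : (fun _ => _) = fun t => \sum_i \sum_j (xi 0 i * xi 0 j) * Q (t *: v + x) i j); last first.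
    apply/funext => u; rewrite bfE; apply: eq_bigr => i _; apply: eq_bigr => j _.
    by rewrite -mulrA mulrC.
  rewrite (_ : dphi t = \sum_i \sum_j (xi 0 i * xi 0 j) * \sum_k v 0 k * partial k (fun y => Q y i j) (t *: v + x)); last first.
    by apply: eq_bigr => i _; apply: eq_bigr => j _; rewrite mulrC.
  apply: is_derive_sumE => i; apply: is_derive_sumE => j; apply: is_derive_scale.
  apply: (is_derive_line (f := fun y => Q y i j)).
  exact: classC_dir (classC_le (k := 1) (leq_trans _ kappa3) (QC i j)).
have phiX t : nu (t *: v + x) * X <= phi t by exact: Q_ge.
have dphi_le t : dphi t <= K * phi t.
  rewrite /dphi /K !mulr_suml; apply: ler_sum => i _.
  apply: ler_sum => j _.
  rewrite mulr_suml; apply: ler_sum => k _.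
  set z := t *: v + x; set D := partial k _ z.
  have [_ _ /(_ i j k) HD _] := HC z; rewrite -/D in HD.
  have vk : v 0 k ^+ 2 <= 1.
    apply: le_trans v1; rewrite (bigD1 k)//= lerDl sumr_ge0// => l _.
    exact: sqr_ge0.
  have xx : `|xi 0 i * xi 0 j| <= X.
    have h (m : 'I_q) : xi 0 m ^+ 2 <= X.
      by rewrite /X (bigD1 m)//= lerDl sumr_ge0// => l _; exact: sqr_ge0.
    have := h i; have := h j; set a := xi 0 i; set b := xi 0 j => h1 h2.
    rewrite ler_norml; apply/andP; split.
      by have := sqr_ge0 (a + b); rewrite sqrrD mulr2n; lra.
    by have := sqr_ge0 (a - b); rewrite sqrrB mulr2n; lra.
  have nz := cnu z.
  have vD : `|v 0 k * D| <= (C / c + 1) * nu z.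
    have h : (v 0 k * D) ^+ 2 <= C * nu z.
      rewrite exprMn; apply: le_trans HD; rewrite ler_piMl ?sqr_ge0//.
    have h1 : 1 <= nu z / c by rewrite ler_pdivlMr// mul1r.
    have h2 : (v 0 k * D) ^+ 2 <= C / c * nu z ^+ 2.
      apply: le_trans h _.
      have -> : C / c * nu z ^+ 2 = C * nu z * (nu z / c) by ring.
      by apply: ler_peMr => //; rewrite mulr_ge0// ltW.
    rewrite -[X in _ <= X]ger0_norm; last by rewrite mulr_ge0// ?addr_ge0// ltW.
    rewrite -ler_sqr ?nnegrE// !real_normK ?num_real// [X in _ <= X]exprMn.
    apply: le_trans h2 _; rewrite ler_wpM2r ?sqr_ge0//.
    by rewrite sqrrD expr1n mulr1 mulr2n; have := sqr_ge0 (C / c); lra.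
  apply: le_trans (ler_norm _) _; rewrite normrM.
  apply: (@le_trans _ _ (((C / c + 1) * nu z) * X)).
    by apply: ler_pM.
  by rewrite -mulrA ler_wpM2l ?addr_ge0//; exact: phiX.
pose g t := phi t * expR (- K * t).
have Dg (t : R) : is_derive t 1 g (phi t * (- K * expR (- K * t)) + expR (- K * t) * dphi t).
  apply: is_deriveM; rewrite [X in is_derive _ _ _ X]mulrC.
  have H : is_derive t 1 (fun u : R => - K * u) (- K).
    by rewrite -[X in is_derive _ _ _ X]mulr1; exact: is_deriveZ.
  exact: (is_derive1_comp (f := expR)).
have [xi0 _ Eg] := MVT_segment s0 (fun t _ => Dg t)
  (derivable_within_continuous (fun t _ => let: DeriveDef h _ := Dg t in h)).
have : g s <= g 0.
  rewrite -subr_le0 Eg subr0 mulr_le0_ge0//.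
  set e := expR _; have e0 : 0 <= e := expR_ge0 _.
  have -> : phi xi0 * (- K * e) + e * dphi xi0 = (dphi xi0 - K * phi xi0) * e by ring.
  apply: mulr_le0_ge0 => //.
  by have := dphi_le xi0; lra.
rewrite /g mulr0 expR0 mulr1 => gs.
apply: le_trans (phiX s) _.
have -> : phi s = phi s * expR (- K * s) * expR (K * s).
  by rewrite -mulrA -expRD mulNr addNr expR0 mulr1.
have phi0 : 0 <= phi 0 by apply: le_trans (phiX 0); rewrite mulr_ge0// ltW.
rewrite [X in _ <= X]mulrC; apply: ler_pM.
- by apply: mulr_ge0; [apply: le_trans (phiX s); rewrite mulr_ge0// ltW|exact: expR_ge0].
- exact: expR_ge0.
- by apply: le_trans gs _; rewrite /phi scale0r add0r.
- by rewrite ler_expR ler_piMr.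
Qed.

Lemma coefficients_regular : regular_coefficients Q F.
Proof.
have [C C0 HC] := coefficient_growth.
have [c c0 cnu] := nu_lower.
have [M M0 HM] := Q_segment.
split=> //.
- move=> x v v0; apply: lt_le_trans (Q_ge v x); rewrite mulr_gt0//.
  rewrite lt_neqAle sumr_ge0 ?andbT => [|i _]; last exact: sqr_ge0.
  rewrite eq_sym; apply: contra v0 => /eqP/psumr_eq0P h.
  apply/eqP/rowP => i; rewrite mxE; apply/eqP; rewrite -sqrf_eq0; apply/eqP.
  by apply: h => // j _; exact: sqr_ge0.
- by split=> [i j|j]; [apply: classC_le (QC i j)|apply: classC_le (FC j)];
    exact: leq_trans kappa3.
- by exists C => // x; have [] := HC x.
have key (h : E -> R) : classC 1 h ->
  (forall z k, partial k h z ^+ 2 <= C * nu z) ->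
  forall x y (xi : 'rV[R]_q), sqd x y <= 1 ->
  (h x - h y) ^+ 2 * (\sum_k xi 0 k ^+ 2) <= n%:R * C * M * sqd x y * bf (Q x) xi xi.
  move=> Ch hb x y xi xy.
  pose v := y - x.
  have Ev : \sum_k v 0 k ^+ 2 = sqd x y.
    by rewrite sqdC; apply: eq_bigr => k _; rewrite !mxE.
  have D (t : R) : is_derive t 1 (fun t => h (t *: v + x)) (\sum_k v 0 k * partial k h (t *: v + x)).
    by apply: is_derive_line; exact: (@classC_dir _ _ 0 h _ _ Ch).
  have [s s01 E1] := MVT_segment (@ler01 R) (fun t _ => D t)
    (derivable_within_continuous (fun t _ => let: DeriveDef h _ := D t in h)).
  rewrite scale1r scale0r add0r subrK subr0 mulr1 in E1.
  rewrite -sqrrN opprB E1.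
  have X0 : 0 <= \sum_k xi 0 k ^+ 2 by apply: sumr_ge0 => i _; exact: sqr_ge0.
  apply: (@le_trans _ _ (sqd x y * (n%:R * C * nu (s *: v + x)) * \sum_k xi 0 k ^+ 2)).
    rewrite ler_wpM2r//; apply: le_trans (cauchy_schwarz _ _) _.
    rewrite Ev ler_wpM2l ?sqd_ge0//.
    apply: (@le_trans _ _ (\sum_(k < n) C * nu (s *: v + x))); first exact: ler_sum.
    by rewrite sumr_const card_ord -[(_ * _) *+ n]mulr_natl mulrA.
  have -> : sqd x y * (n%:R * C * nu (s *: v + x)) * (\sum_k xi 0 k ^+ 2) =
    n%:R * C * sqd x y * (nu (s *: v + x) * (\sum_k xi 0 k ^+ 2)) by ring.
  have -> : n%:R * C * M * sqd x y * bf (Q x) xi xi =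
    n%:R * C * sqd x y * (M * bf (Q x) xi xi) by ring.
  rewrite ler_wpM2l ?mulr_ge0 ?sqd_ge0//.
  by apply: HM => //; rewrite Ev.
exists (n%:R * C * M); first by rewrite !mulr_ge0.
move=> x y xi xy; split=> [i j|j].
  apply: (key (fun x => Q x i j)) => //; first by apply: classC_le (QC i j); exact: leq_trans kappa3.
  by move=> z k; have [] := HC z.
apply: (key (fun x => F x 0 j)) => //; first by apply: classC_le (FC j); exact: leq_trans kappa3.
by move=> z k; have [] := HC z.
Qed.

End Growth.

(** * The Lyapunov functions *)

Section Lyapunov.
Context {R : realType} {n q : nat}.
Local Notation E := 'rV[R]_n.
Variables (fb : 'I_q -> 'I_n) (Q : E -> 'M[R]_q) (B : 'M[R]_n) (F : E -> 'rV[R]_q).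
Hypothesis reg : regular_coefficients Q F.
Local Notation A := (Aop fb Q B F).
Local Notation Gam := (Gam fb Q).
Implicit Types (f g : E -> R) (x : E).

Definition gradq f x : 'rV[R]_q := \row_i partial (fb i) f x.

Lemma GamE f g x : Gam f g x = bf (Q x) (gradq f x) (gradq g x).
Proof.
rewrite bfE; apply: eq_bigr => i _; apply: eq_bigr => j _.
by rewrite !mxE mulrA.
Qed.

Lemma bf_ge0 x (v : 'rV[R]_q) : 0 <= bf (Q x) v v.
Proof.
have [->|v0] := eqVneq v 0; first by rewrite /bf !mul0mx mxE.
exact/ltW/(coef_pos reg).
Qed.

Lemma Gam_ge0 f x : 0 <= Gam f f x.
Proof. by rewrite GamE bf_ge0. Qed.

Lemma Gam_comp (k k1 : R -> R) f g x : classC 1 f ->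
  is_derive (f x) 1 k (k1 (f x)) ->
  Gam (fun x => k (f x)) g x = k1 (f x) * Gam f g x.
Proof.
move=> Cf dk; rewrite /Gam mulr_sumr; apply: eq_bigr => i _.
rewrite mulr_sumr; apply: eq_bigr => j _.
by rewrite (partial_comp _ Cf dk) -!mulrA mulrCA.
Qed.

Lemma Gam_sym f g x : Gam f g x = Gam g f x.
Proof. by rewrite !GamE (bfC _ _ (coef_sym reg x)). Qed.

Lemma two_mul_le (a b : R) : `|2 * (a * b)| <= a ^+ 2 + b ^+ 2.
Proof.
rewrite ler_norml; apply/andP; split.
  by have := sqr_ge0 (a + b); rewrite sqrrD mulr2n; lra.
by have := sqr_ge0 (a - b); rewrite sqrrB mulr2n; lra.
Qed.

Lemma Aop_sqd_bound : exists2 C, 0 <= C & forall x0 x,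
  `|A (sqd^~ x0) x| <= C * (V x + sqd x x0).
Proof.
have [C C0 HC] := coef_growth reg.
pose K := \sum_(i < q) \sum_(j < q) (2 * C) + \sum_(i < n) \sum_(j < n) `|B i j|
  + \sum_(j < q) (C + 1).
exists K.
  apply: addr_ge0; first apply: addr_ge0; apply: sumr_ge0 => i _ //.
  - by apply: sumr_ge0 => j _; rewrite mulr_ge0.
  - by apply: sumr_ge0.
  - by rewrite addr_ge0.
move=> x0 x; have [HQ HF] := HC x.
have V0 := V_gt0 x; have W0 := sqd_ge0 x x0.
have sum_le (I : finType) (a b : I -> R) : (forall i, `|a i| <= b i * (V x + sqd x x0)) ->
    `|\sum_i a i| <= (\sum_i b i) * (V x + sqd x x0).
  move=> H; apply: le_trans (ler_norm_sum _ _ _) _; rewrite mulr_suml.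
  exact: ler_sum.
rewrite /Aop /K 2!mulrDl; apply: le_trans (ler_normD _ _) _; apply: lerD.
  apply: le_trans (ler_normD _ _) _; apply: lerD.
    apply: (sum_le _) => i; apply: (sum_le _) => j; rewrite partial2_sqd normrM.
    have h : `|2 * (fb i == fb j)%:R| <= 2 :> R.
      by case: (_ == _); rewrite ?mulr0 ?mulr1 ?normr0 ?gtr0_norm.
    apply: (@le_trans _ _ (C * V x * 2)); first exact: ler_pM.
    by have := mulr_ge0 C0 W0; lra.
  apply: (sum_le _) => i; apply: (sum_le _) => j; rewrite partial_sqd -mulrA normrM.
  rewrite ler_wpM2l// mulrCA; apply: le_trans (two_mul_le _ _) _.
  by apply: lerD; [exact: coord_sq_le_V|exact: coord_sq_le_sqd].
apply: (sum_le _) => j; rewrite partial_sqd mulrCA.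
apply: le_trans (two_mul_le _ _) _.
have := HF j; have := coord_sq_le_sqd x x0 (fb j); have := mulr_ge0 C0 W0; lra.
Qed.

Definition Vinv x := (V x)^-1.
Definition Vinv2 x := Vinv x * Vinv x.

Lemma is_derive_inv (s : R) : s != 0 ->
  is_derive s 1 (fun s => s^-1) (- (s^-1 * s^-1)).
Proof.
move=> s0; have d : derivable (fun s : R => s^-1) s 1.
  exact: (@derivableV _ _ id).
split=> //; rewrite (@deriveV _ _ id s 1 s0); last exact: derivable_id.
by rewrite derive_id [LHS]mulr1 -exprVn expr2.
Qed.

Lemma Vinv_gt0 x : 0 < Vinv x. Proof. by rewrite invr_gt0 V_gt0. Qed.
Lemma Vinv2_gt0 x : 0 < Vinv2 x. Proof. by rewrite mulr_gt0// Vinv_gt0. Qed.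
Lemma Vinv_le1 x : Vinv x <= 1.
Proof. by rewrite invf_le1 ?V_ge1// V_gt0. Qed.
Let V_neq0 x : V x != 0. Proof. by rewrite gt_eqF// V_gt0. Qed.

Let d1 x : is_derive (V x) 1 (fun s : R => s^-1) (- ((V x)^-1 * (V x)^-1)).
Proof. exact: is_derive_inv. Qed.

Let d2 x : is_derive (V x) 1 (fun s : R => - (s^-1 * s^-1))
  (2 * ((V x)^-1 * (V x)^-1 * (V x)^-1)).
Proof.
have h := is_derive_mul (d1 x) (d1 x).
apply: is_derive_eq (is_deriveN h) _; ring.
Qed.

Let cd2 : continuous (fun x => 2 * ((V x)^-1 * (V x)^-1 * (V x)^-1)).
Proof.
have cV : continuous (fun x : E => (V x)^-1).
  have cV0 : continuous (V : E -> R) by exact: classC_cont (classC_V 0).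
  by move=> x; apply: (@continuousV _ _ V x (V_neq0 x)); exact: cV0.
have C0 : classC 0 (fun x : E => (V x)^-1) by split.
exact: classC_cont (classC_scale 2 (classC_mul (classC_mul C0 C0) C0)).
Qed.

Lemma classC_Vinv : classC 2 Vinv.
Proof. exact: (@classC2_comp _ _ (fun s => s^-1) (fun s => - (s^-1 * s^-1))
  (fun s => 2 * (s^-1 * s^-1 * s^-1)) V (classC_V 2) d1 d2 cd2). Qed.

Lemma classC_Vinv2 : classC 2 Vinv2.
Proof. by apply: classC_mul; exact: classC_Vinv. Qed.

Lemma partial_Vinv2 i x : partial i Vinv2 x = 2 * (Vinv x * partial i Vinv x).
Proof.
by rewrite (partial_mul i x (classCS classC_Vinv) (classCS classC_Vinv)); ring.
Qed.

(** The growth of the coefficients allows |A V| <= C V and Gam V V <= C V^2; for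
    the powers of V the chain rule only combines these two bounds. V controls the
    behaviour of solutions at infinity, while its inverse powers are the rates of
    decay that the semigroup preserves. *)
Lemma Lyapunov : exists2 C, 0 <= C & forall x,
  [/\ `|A V x| <= C * V x, Gam V V x <= C * V x ^+ 2,
      `|A Vinv x| <= C * Vinv x, `|A Vinv2 x| <= C * Vinv2 x &
      Gam Vinv2 Vinv2 x <= C * Vinv2 x ^+ 2].
Proof.
have [C C0 HC] := Aop_sqd_bound.
have [K K0 HK] := coef_growth reg.
pose K1 := \sum_(i < q) \sum_(j < q) (4 * K).
have K10 : 0 <= K1 by do 2 (apply: sumr_ge0 => ? _); rewrite mulr_ge0.
have AV x : `|A V x| <= 2 * C * V x.
  rewrite VE Aop_add; [|exact: classC_cst|exact: classC_sqd].
  rewrite Aop_cst add0r -sqd0; apply: le_trans (HC 0 x) _.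
  rewrite [2 * C]mulrC -mulrA ler_wpM2l//; have := sqd_ge0 x 0; rewrite (sqd0 x); lra.
have GV x : Gam V V x <= K1 * V x ^+ 2.
  rewrite /Gam /K1 !mulr_suml; apply: ler_sum => i _.
  apply: ler_sum => j _; rewrite !partial_V.
  have [HQ _] := HK x; have V0 := V_gt0 x.
  apply: le_trans (ler_norm _) _.
  have -> : 4 * K * V x ^+ 2 = K * V x * (4 * V x) by ring.
  rewrite normrM; apply: ler_pM => //.
  rewrite mulrACA normrM ger0_norm//.
  rewrite (_ : 2 * 2 = 4) -?natrM// ler_wpM2l//.
  have := two_mul_le (x 0 (fb i)) (x 0 (fb j)).
  rewrite normrM gtr0_norm//; have := coord_sq_le_V x (fb i).
  have := coord_sq_le_V x (fb j); lra.
pose C1 := 2 * C + K1; have C10 : 0 <= C1 by rewrite addr_ge0// mulr_ge0.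
have AV1 x : `|A V x| <= C1 * V x.
  by apply: le_trans (AV x) _; rewrite ler_wpM2r ?(ltW (V_gt0 x))// lerDl.
have GV1 x : Gam V V x <= C1 * V x ^+ 2.
  by apply: le_trans (GV x) _; rewrite ler_wpM2r ?sqr_ge0// lerDr mulr_ge0.
have VI x : V x * Vinv x = 1 by rewrite divff.
have GI x : Gam Vinv Vinv x <= C1 * Vinv2 x.
  have Gc g : Gam Vinv g x = - (Vinv x * Vinv x) * Gam V g x.
    exact: (@Gam_comp (fun s => s^-1) (fun s => - (s^-1 * s^-1)) V g x (classC_V 1) (d1 x)).
  rewrite Gc Gam_sym Gc.
  have -> : - (Vinv x * Vinv x) * (- (Vinv x * Vinv x) * Gam V V x) = Vinv2 x ^+ 2 * Gam V V x.
    by rewrite /Vinv2; ring.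
  apply: (@le_trans _ _ (Vinv2 x ^+ 2 * (C1 * V x ^+ 2))).
    by rewrite ler_wpM2l ?sqr_ge0.
  rewrite le_eqVlt; apply/orP; left; apply/eqP.
  have -> : Vinv2 x ^+ 2 * (C1 * V x ^+ 2) = C1 * Vinv2 x * (V x * Vinv x) ^+ 2.
    by rewrite /Vinv2; ring.
  by rewrite VI expr1n mulr1.
have I0 := Vinv_gt0; have m0 := Vinv2_gt0.
have AI x : `|A Vinv x| <= 3 * C1 * Vinv x.
  have -> : A Vinv x = - Vinv2 x * A V x + 2 * (Vinv2 x * Vinv x) * Gam V V x.
    exact: (@Aop_comp _ _ _ fb Q B F (fun s => s^-1) (fun s => - (s^-1 * s^-1))
      (fun s => 2 * (s^-1 * s^-1 * s^-1)) V x (classC_V 2) d1 d2 cd2).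
  apply: le_trans (ler_normD _ _) _.
  rewrite mulNr normrN normrM (gtr0_norm (m0 x)).
  rewrite normrM (ger0_norm (Gam_ge0 _ _)).
  have -> : `|2 * (Vinv2 x * Vinv x)| = 2 * (Vinv2 x * Vinv x).
    by apply: gtr0_norm; rewrite !mulr_gt0.
  have h1 : Vinv2 x * `|A V x| <= Vinv2 x * (C1 * V x).
    by rewrite ler_wpM2l// ltW.
  have h2 : 2 * (Vinv2 x * Vinv x) * Gam V V x <= 2 * (Vinv2 x * Vinv x) * (C1 * V x ^+ 2).
    by rewrite ler_wpM2l// !mulr_ge0// ltW.
  have e1 : Vinv2 x * (C1 * V x) = C1 * Vinv x * (V x * Vinv x) by rewrite /Vinv2; ring.
  have e2 : 2 * (Vinv2 x * Vinv x) * (C1 * V x ^+ 2) =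
    2 * C1 * Vinv x * (V x * Vinv x) ^+ 2 by rewrite /Vinv2; ring.
  rewrite e1 VI in h1; rewrite e2 VI in h2; move: h1 h2. lra.
have Am x : `|A Vinv2 x| <= 8 * C1 * Vinv2 x.
  rewrite (Aop_mul _ _ _ _ (coef_sym reg) classC_Vinv classC_Vinv).
  have -> : Vinv x * A Vinv x + Vinv x * A Vinv x + 2 * Gam Vinv Vinv x =
    2 * (Vinv x * A Vinv x + Gam Vinv Vinv x) by ring.
  rewrite normrM gtr0_norm//.
  have h1 : `|Vinv x * A Vinv x| <= 3 * C1 * Vinv2 x.
    rewrite normrM (gtr0_norm (I0 x)) /Vinv2 (mulrA (3 * C1)) [X in _ <= X]mulrC.
    by rewrite ler_wpM2l// ltW.
  have h2 : `|Gam Vinv Vinv x| <= C1 * Vinv2 x by rewrite ger0_norm// Gam_ge0.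
  have := ler_normD (Vinv x * A Vinv x) (Gam Vinv Vinv x).
  by move: h1 h2; lra.
have Gm x : Gam Vinv2 Vinv2 x <= 4 * C1 * Vinv2 x ^+ 2.
  have -> : Gam Vinv2 Vinv2 x = 4 * Vinv2 x * Gam Vinv Vinv x.
    rewrite /Gam mulr_sumr; apply: eq_bigr => i _.
    rewrite mulr_sumr; apply: eq_bigr => j _; rewrite !partial_Vinv2 /Vinv2.
    by ring_atoms.
  have := ler_wpM2l (ltW (m0 x)) (GI x); lra.
have c8 x c (w : R) : 0 <= w -> c <= 8 -> c * C1 * w <= 8 * C1 * w.
  by move=> w0 c8; rewrite ler_wpM2r// ler_wpM2r.
exists (8 * C1); first by rewrite mulr_ge0.
move=> x; split=> //.
- by apply: le_trans (AV1 x) _; rewrite -[X in X * V x]mul1r c8// ?(ltW (V_gt0 x))//; lra.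
- by apply: le_trans (GV1 x) _; rewrite -[X in X * V x ^+ 2]mul1r c8// ?sqr_ge0//; lra.
- by apply: le_trans (AI x) _; rewrite c8// ?(ltW (I0 x))//; lra.
- by apply: le_trans (Gm x) _; rewrite c8// ?sqr_ge0//; lra.
Qed.

End Lyapunov.

(** * Classical solutions and the maximum principle *)

Section Sublevels.
Context {R : realType} {n : nat}.
Local Notation E := 'rV[R]_n.

Lemma rV_norm_le (x : E) (c : R) : 0 <= c -> (forall i, `|x 0 i| <= c) -> `|x| <= c.
Proof.
move=> c0 H; rewrite /Num.norm/= mx_normrE; apply: bigmax_le => // -[i j] _ /=.
by rewrite (ord1 i).
Qed.

Lemma coord_le_rV_norm (x : E) i : `|x 0 i| <= `|x|.
Proof.
rewrite [leRHS]/Num.norm/= mx_normrE; apply: le_trans (le_bigmax _ _ (0, i)) => //.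
Qed.

Lemma compact_sublevel (M : R) : compact [set x : E | V x <= M].
Proof.
apply: bounded_closed_compact.
  exists M; split; first exact: num_real.
  move=> c Mc x /= xM; have M1 := le_trans (V_ge1 x) xM.
  apply: rV_norm_le => [|i]; first by lra.
  apply: le_trans (ltW Mc); apply: le_trans xM; rewrite /V.
  have h : `|x 0 i| ^+ 2 <= \sum_i x 0 i ^+ 2.
    by rewrite real_normK ?num_real// (bigD1 i)//= lerDl sumr_ge0// => j _; exact: sqr_ge0.
  by have := sqr_ge0 (`|x 0 i| - 1); rewrite sqrrB expr1n mulr1 mulr2n; have := normr_ge0 (x 0 i); lra.
have cV : continuous (V : E -> R) by exact: classC_cont (classC_V 0).
by apply: (@closed_comp _ _ (V : E -> R) [set y | y <= M]) => //; exact: closed_le.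
Qed.

Lemma compact_V_bounded (K : set E) : compact K -> exists2 M, 1 <= M & forall x, K x -> V x <= M.
Proof.
move=> cK; have [->|/set0P K0] := eqVneq K set0; first by exists 1.
have cV : continuous (V : E -> R) by exact: classC_cont (classC_V 0).
have [c Kc cm] := compact_EVT_max K0 cK (continuous_subspaceT cV).
exists (V c); first exact: V_ge1.
by move=> x Kx; apply: cm; exact/mem_set.
Qed.

End Sublevels.

Section SecondOrder.
Context {R : realType} {n q : nat}.
Local Notation E := 'rV[R]_n.
Variables (fb : 'I_q -> 'I_n).
Implicit Types (f : E -> R) (x : E).

Definition emb (a : 'rV[R]_q) : E := \sum_j a 0 j *: delta_mx 0 (fb j).

Lemma emb_coord a i : emb a 0 i = \sum_j a 0 j * (i == fb j)%:R.
Proof.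
by rewrite /emb summxE; apply: eq_bigr => j _; rewrite !mxE eqxx.
Qed.

Lemma sum_emb a (c : 'I_n -> R) : \sum_i emb a 0 i * c i = \sum_j a 0 j * c (fb j).
Proof.
under eq_bigr do rewrite emb_coord mulr_suml.
rewrite exchange_big; apply: eq_bigr => j _.
rewrite (bigD1 (fb j))//= eqxx mulr1 big1 ?addr0// => i /negbTE ->.
by rewrite mulr0 mul0r.
Qed.

Lemma is_derive_emb k f x a : classC k.+1 f ->
  is_derive x (emb a) f (\sum_j a 0 j * partial (fb j) f x).
Proof. by move=> Cf; rewrite -(sum_emb a (fun i => partial i f x)); exact: classC_dir Cf. Qed.

Lemma is_derive_emb2 f x a : classC 2 f ->
  is_derive x (emb a) (fun y => \sum_j a 0 j * partial (fb j) f y)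
    (\sum_i \sum_j a 0 i * a 0 j * partial (fb i) (partial (fb j) f) x).
Proof.
move=> Cf; rewrite exchange_big /=.
apply: is_derive_sumE => j.
rewrite (_ : \sum_i _ = a 0 j * \sum_i a 0 i * partial (fb i) (partial (fb j) f) x); last first.
  by rewrite mulr_sumr; apply: eq_bigr => i _; ring_atoms.
by apply: is_derive_scale; apply: is_derive_emb (classC_partial _ Cf).
Qed.

(** A factor M of S turns the second order operator with coefficients S into a sum
    of pure second derivatives, one along each column of M. *)
Lemma sum_col_second f x m (S : 'M[R]_q) (M : 'M[R]_(q, m)) : S = M *m M^T ->
  \sum_k \sum_i \sum_j M i k * M j k * partial (fb i) (partial (fb j) f) x
  = \sum_i \sum_j S i j * partial (fb i) (partial (fb j) f) x.
Proof.
move=> ->; rewrite exchange_big; apply: eq_bigr => i _.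
rewrite exchange_big; apply: eq_bigr => j _.
by rewrite mxE mulr_suml; apply: eq_bigr => k _; rewrite mxE.
Qed.

Lemma global_max_partial f x i : classC 1 f -> (forall y, f y <= f x) ->
  partial i f x = 0.
Proof.
move=> Cf fm; have /lineE := classC_derive x i Cf.
apply: (local_max_derive ltr01) => h _.
by rewrite !(scale0r, add0r); exact: fm.
Qed.

Lemma global_max_second f x (S : 'M[R]_q) : classC 2 f -> S^T = S ->
  (forall v, 0 <= bf S v v) -> (forall y, f y <= f x) ->
  \sum_i \sum_j S i j * partial (fb i) (partial (fb j) f) x <= 0.
Proof.
move=> Cf sS pS fm; have [M EM] := psd_factor sS pS.
rewrite -(sum_col_second f x EM); apply: sumr_le0 => k _.
pose a : 'rV[R]_q := \row_i M i k.
have D1 (h : R) : is_derive h 1 (fun h => f (h *: emb a + x))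
    (\sum_j a 0 j * partial (fb j) f (h *: emb a + x)).
  by apply: is_derive_line; exact: is_derive_emb Cf.
have D2 := is_derive_emb2 x a Cf; move/lineE in D2.
have [] := local_max_derive2 ltr01 _ (fun h _ => D1 h) D2.
  by move=> h _; rewrite !(scale0r, add0r); exact: fm.
move=> _; apply: le_trans; rewrite le_eqVlt; apply/orP; left; apply/eqP.
by apply: eq_bigr => i _; apply: eq_bigr => j _; rewrite !mxE.
Qed.

End SecondOrder.

Section Solutions.
Context {R : realType} {n q : nat}.
Local Notation E := 'rV[R]_n.
Variables (fb : 'I_q -> 'I_n) (Q : E -> 'M[R]_q) (B : 'M[R]_n) (F : E -> 'rV[R]_q).
Local Notation A := (Aop fb Q B F).
Implicit Types (f g : E -> R) (x : E) (t : R) (u v : R -> E -> R).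

(** The classical solutions of the Cauchy problem, for the abstract operator. *)
Record solves f u : Prop := {
  so_t_derivable : forall t x, 0 < t -> derivable (u^~ x) t 1;
  so_t_continuous : {in [set z : R * E | 0 < z.1],
    continuous (fun z : R * E => 'D_1 (u^~ z.2) z.1)};
  so_x_derivable : forall t x i, 0 < t -> derivable (u t) x (delta_mx 0 i);
  so_x_continuous : forall i, {in [set z : R * E | 0 < z.1],
    continuous (fun z : R * E => partial i (u z.1) z.2)};
  so_xx_derivable : forall t x i j, 0 < t ->
    derivable (partial j (u t)) x (delta_mx 0 i);
  so_xx_continuous : forall i j, {in [set z : R * E | 0 < z.1],
    continuous (fun z : R * E => partial i (partial j (u z.1)) z.2)};
  so_continuous : {within [set z : R * E | 0 <= z.1],
    continuous (fun z : R * E => u z.1 z.2)};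
  so_bounded : forall T0 : R, 0 < T0 ->
    exists M : R, forall t x, 0 <= t <= T0 -> `|u t x| <= M;
  so_eq : forall t x, 0 < t -> 'D_1 (u^~ x) t = A (u t) x;
  so_init : forall x, u 0 x = f x }.

Arguments so_t_derivable {f u}.
Arguments so_t_continuous {f u}.
Arguments so_x_derivable {f u}.
Arguments so_x_continuous {f u}.
Arguments so_xx_derivable {f u}.
Arguments so_xx_continuous {f u}.
Arguments so_continuous {f u}.
Arguments so_bounded {f u}.
Arguments so_eq {f u}.
Arguments so_init {f u}.

Lemma open_pos : open [set z : R * E | 0 < z.1].
Proof.
apply: (@open_comp _ _ (fst : R * E -> R) [set y | y > 0]); last exact: open_gt.
by move=> z _; exact: cvg_fst.
Qed.

Lemma so_continuous_pos f u : solves f u ->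
  {in [set z : R * E | 0 < z.1], continuous (fun z : R * E => u z.1 z.2)}.
Proof.
move=> su; rewrite -(continuous_open_subspace _ open_pos).
by apply: continuous_subspaceW (so_continuous su) => z /= /ltW.
Qed.

Lemma pair_continuous t : continuous (fun x : E => (t, x)).
Proof.
move=> x S [[d1 d2] [/= h1 h2] hS]; apply: filterS h2 => y yd2.
by apply: hS; split=> //=; exact: nbhs_singleton.
Qed.

Lemma slice_continuous (g : R * E -> R) t : 0 < t ->
  {in [set z : R * E | 0 < z.1], continuous g} -> continuous (fun x : E => g (t, x)).
Proof.
move=> t0 cg x; apply: (@continuous_comp _ _ _ (fun y : E => (t, y)) g); first exact: pair_continuous.
by apply: (cg (t, x)); rewrite inE.
Qed.

Lemma solves_classC2 f u t : solves f u -> 0 < t -> classC 2 (u t).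
Proof.
move=> su t0; split.
  exact: (@slice_continuous (fun z => u z.1 z.2) t t0 (so_continuous_pos su)).
move=> i; split; first by move=> x; exact: so_x_derivable su _ _ _ t0.
split; first exact: (@slice_continuous (fun z => partial i (u z.1) z.2) t t0 (so_x_continuous su i)).
move=> j; split; first by move=> x; exact: so_xx_derivable su _ _ _ _ t0.
split=> //; exact: (@slice_continuous (fun z => partial j (partial i (u z.1)) z.2) t t0 (so_xx_continuous su j i)).
Qed.

Lemma solves_dt f u t x : solves f u -> 0 < t -> is_derive t 1 (u^~ x) (A (u t) x).
Proof.
move=> su t0; rewrite -(so_eq su)//; apply: derivableP; exact: so_t_derivable su _ _ t0.
Qed.

Lemma is_derive_lin (U : normedModType R) (c : R) (h k : U -> R) (y w : U) (l m : R) :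
  is_derive y w h l -> is_derive y w k m ->
  is_derive y w (fun z => c * h z + k z) (c * l + m).
Proof. by move=> dh dk; apply: is_derive_add dk; exact: is_derive_scale. Qed.

Lemma solves_lin (c : R) f g u v : solves f u -> solves g v ->
  solves (fun x => c * f x + g x) (fun t x => c * u t x + v t x).
Proof.
move=> su sv.
have P t i : 0 < t -> partial i (fun x => c * u t x + v t x) =
    fun x => c * partial i (u t) x + partial i (v t) x.
  move=> t0; apply/funext => x; apply: is_derive_partial.
  exact: is_derive_lin (derivable_partial (so_x_derivable su t x i t0))
    (derivable_partial (so_x_derivable sv t x i t0)).
have PP t i j : 0 < t -> partial i (partial j (fun x => c * u t x + v t x)) =
    fun x => c * partial i (partial j (u t)) x + partial i (partial j (v t)) x.
  move=> t0; rewrite P//; apply/funext => x; apply: is_derive_partial.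
  exact: is_derive_lin (derivable_partial (so_xx_derivable su t x i j t0))
    (derivable_partial (so_xx_derivable sv t x i j t0)).
have lin_cont (g1 g2 g3 : R * E -> R) :
    (forall z, 0 < z.1 -> g3 z = c * g1 z + g2 z) ->
    {in [set z : R * E | 0 < z.1], continuous g1} ->
    {in [set z : R * E | 0 < z.1], continuous g2} ->
    {in [set z : R * E | 0 < z.1], continuous g3}.
  move=> E3 c1 c2; rewrite -(continuous_open_subspace _ open_pos).
  apply: (@subspace_eq_continuous _ _ _ (fun z => c * g1 z + g2 z)).
    by move=> z; rewrite inE => z0; apply/esym/E3.
  rewrite (continuous_open_subspace _ open_pos) => z zp.
  exact: (cvgD (cvgM (cvg_cst c) (c1 z zp)) (c2 z zp)).
have D t x : 0 < t -> is_derive t 1 (fun t => c * u t x + v t x)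
    (c * 'D_1 (u^~ x) t + 'D_1 (v^~ x) t).
  move=> t0; exact: is_derive_lin (derivableP (so_t_derivable su t x t0))
    (derivableP (so_t_derivable sv t x t0)).
split.
- by move=> t x t0; have [] := D t x t0.
- apply: lin_cont (so_t_continuous su) (so_t_continuous sv) => z z0.
  by have [] := D _ z.2 z0.
- move=> t x i t0; have : is_derive x (delta_mx 0 i) (fun x => c * u t x + v t x)
      (c * partial i (u t) x + partial i (v t) x).
    exact: is_derive_lin (derivable_partial (so_x_derivable su t x i t0))
    (derivable_partial (so_x_derivable sv t x i t0)).
  by case.
- move=> i; apply: lin_cont (so_x_continuous su i) (so_x_continuous sv i) => z z0.
  by rewrite P.
- move=> t x i j t0; rewrite P//.
  have : is_derive x (delta_mx 0 i) (fun x => c * partial j (u t) x + partial j (v t) x)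
      (c * partial i (partial j (u t)) x + partial i (partial j (v t)) x).
    exact: is_derive_lin (derivable_partial (so_xx_derivable su t x i j t0))
    (derivable_partial (so_xx_derivable sv t x i j t0)).
  by case.
- move=> i j; apply: lin_cont (so_xx_continuous su i j) (so_xx_continuous sv i j) => z z0.
  by rewrite PP.
- by move=> z; exact: (cvgD (cvgM (cvg_cst c) (so_continuous su z)) (so_continuous sv z)).
- move=> T0 T00; have [M HM] := so_bounded su _ T00; have [K HK] := so_bounded sv _ T00.
  exists (`|c| * M + K) => t x tT; apply: le_trans (ler_normD _ _) _.
  by rewrite normrM lerD ?HK// ler_wpM2l// HM.
- move=> t x t0; have [_ ->] := D t x t0.
  have Cu := solves_classC2 su t0; have Cv := solves_classC2 sv t0.
  rewrite (Aop_add _ _ _ _ _ (classC_scale c Cu) Cv) (Aop_scale _ _ _ _ _ _ Cu).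
  by rewrite -(so_eq su)// -(so_eq sv).
- by move=> x; rewrite (so_init su) (so_init sv).
Qed.

End Solutions.

Arguments so_t_derivable {R n q fb Q B F f u}.
Arguments so_t_continuous {R n q fb Q B F f u}.
Arguments so_x_derivable {R n q fb Q B F f u}.
Arguments so_x_continuous {R n q fb Q B F f u}.
Arguments so_xx_derivable {R n q fb Q B F f u}.
Arguments so_xx_continuous {R n q fb Q B F f u}.
Arguments so_continuous {R n q fb Q B F f u}.
Arguments so_bounded {R n q fb Q B F f u}.
Arguments so_eq {R n q fb Q B F f u}.
Arguments so_init {R n q fb Q B F f u}.

Section MaximumPrinciple.
Context {R : realType} {n q : nat}.
Local Notation E := 'rV[R]_n.
Variables (fb : 'I_q -> 'I_n) (Q : E -> 'M[R]_q) (B : 'M[R]_n) (F : E -> 'rV[R]_q).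
Hypothesis reg : regular_coefficients Q F.
Local Notation A := (Aop fb Q B F).
Local Notation solves := (solves fb Q B F).
Implicit Types (f g : E -> R) (x : E) (t : R) (u v : R -> E -> R).

Lemma Aop_global_max f x : classC 2 f -> (forall y, f y <= f x) -> A f x <= 0.
Proof.
move=> Cf fm; have P i : partial i f x = 0 by apply: global_max_partial fm; exact: classCS.
rewrite /Aop [X in _ + X + _]big1 ?addr0; last first.
  by move=> i _; apply: big1 => j _; rewrite P mulr0.
rewrite [X in _ + X]big1 ?addr0 => [|j _]; last by rewrite P mulr0.
exact: global_max_second Cf (coef_sym reg x) (bf_ge0 reg x) fm.
Qed.

Lemma is_derive_exp_lin (c t : R) :
  is_derive t 1 (fun s => expR (c * s)) (c * expR (c * t)).
Proof.
rewrite [X in is_derive _ _ _ X]mulrC.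
have H : is_derive t 1 (fun u : R => c * u) c.
  by rewrite -[X in is_derive _ _ _ X]mulr1; exact: is_deriveZ.
exact: (is_derive1_comp (f := expR)).
Qed.

Lemma exp_lin_continuous (c : R) : continuous (fun s : R => expR (c * s)).
Proof.
move=> s; apply: differentiable_continuous; apply/derivable1_diffP.
by have [] := is_derive_exp_lin c s.
Qed.

Lemma joint_mul_continuous (h : R -> R) f : continuous h -> continuous f ->
  continuous (fun z : R * E => h z.1 * f z.2).
Proof.
move=> ch cf z; apply: (@cvgM _ _ _ _ (fun z : R * E => h z.1) (fun z => f z.2)).
  by apply: (@continuous_comp _ _ _ (fst : R * E -> R) h); [exact: cvg_fst|exact: ch].
by apply: (@continuous_comp _ _ _ (snd : R * E -> E) f); [exact: cvg_snd|exact: cf].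
Qed.

(** At a positive maximum of exp(-(C + 1) t) z, which exists because z is
    nonpositive outside a compact set, A z <= 0 while the time derivative is
    nonnegative: then z_t >= (C + 1) z contradicts z_t <= A z + C z. *)
Lemma max_principle (z zt : R -> E -> R) (L C M : R) : 0 < L ->
  {within [set w : R * E | 0 <= w.1], continuous (fun w => z w.1 w.2)} ->
  (forall x, z 0 x <= 0) ->
  (forall t x, 0 <= t <= L -> M < V x -> z t x <= 0) ->
  (forall t, 0 < t -> classC 2 (z t)) ->
  (forall t x, 0 < t -> is_derive t 1 (z^~ x) (zt t x)) ->
  (forall t x, 0 < t <= L -> 0 < z t x -> zt t x <= A (z t) x + C * z t x) ->
  forall t x, 0 <= t <= L -> z t x <= 0.
Proof.
move=> L0 cz z0 zinf Cz dz zeq t1 x1 t1L; rewrite leNgt; apply/negP => zpos.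
pose K := `[0, L]%classic `*` [set x : E | V x <= M].
have inK t x : 0 <= t <= L -> 0 < z t x -> K (t, x).
  move=> tL zp; split; first by rewrite /= in_itv.
  by rewrite /= leNgt; apply/negP => /(zinf _ _ tL); rewrite leNgt zp.
have cK : compact K by apply: compact_setX; [exact: segment_compact|exact: compact_sublevel].
pose G (w : R * E) := expR (- (C + 1) * w.1) * z w.1 w.2.
have cG : {within K, continuous G}.
  have KS : K `<=` [set w : R * E | 0 <= w.1].
    by move=> [t x] [/=]; rewrite in_itv /= => /andP[].
  have cz' := continuous_subspaceW KS cz.
  have ce : {within K, continuous (fun w : R * E => expR (- (C + 1) * w.1) * 1)}.
    have c1 : continuous (fun _ : E => 1 : R) by exact: classC_cont (classC_cst 0 1).
    exact: continuous_subspaceT (joint_mul_continuous (@exp_lin_continuous (- (C + 1))) c1).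
  rewrite (_ : G = fun w => (expR (- (C + 1) * w.1) * 1) * z w.1 w.2).
    by move=> w; exact: (cvgM (ce w) (cz' w)).
  by apply/funext => w; rewrite mulr1.
have [[t0 x0] k0 Gmax] := compact_EVT_max (ex_intro _ _ (inK _ _ t1L zpos)) cK cG.
have G1 : 0 < G (t1, x1) by rewrite mulr_gt0// expR_gt0.
have G0 : 0 < G (t0, x0).
  by apply: lt_le_trans G1 (Gmax _ _); apply/mem_set; exact: inK.
have zp0 : 0 < z t0 x0 by move: G0; rewrite /G /= pmulr_rgt0// expR_gt0.
move: k0; rewrite inE => -[/=]; rewrite in_itv /= => /andP[t0ge t0L] _.
have t0p : 0 < t0.
  rewrite lt_neqAle t0ge andbT eq_sym; apply/eqP => t00.
  by move: zp0; rewrite t00 ltNge z0.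
have Gle t x : 0 <= t <= L -> G (t, x) <= G (t0, x0).
  move=> tL; have [zp|zn] := ltP 0 (z t x).
    by apply: Gmax; apply/mem_set; exact: inK.
  by apply: le_trans (ltW G0); rewrite /G /= mulr_ge0_le0// expR_ge0.
have Az : A (z t0) x0 <= 0.
  apply: Aop_global_max; first exact: Cz.
  move=> y; have := Gle t0 y; rewrite t0ge t0L => /(_ isT).
  by rewrite /G /= ler_pM2l// expR_gt0.
have DG : is_derive t0 1 (fun t => G (t, x0))
   (expR (- (C + 1) * t0) * zt t0 x0 + z t0 x0 * (- (C + 1) * expR (- (C + 1) * t0))).
  exact: is_derive_mul (is_derive_exp_lin _ _) (dz _ _ t0p).
have := left_max_derive_ge0 t0p _ DG.
set e := expR _; have e0 : 0 < e := expR_gt0 _.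
have -> : e * zt t0 x0 + z t0 x0 * (- (C + 1) * e) =
   e * (zt t0 x0 - (C + 1) * z t0 x0) by ring.
rewrite pmulr_rge0// => H.
have : 0 <= zt t0 x0 - (C + 1) * z t0 x0.
  by apply: H => h h0 ht; apply: Gle; lra.
have := zeq t0 x0; rewrite t0p t0L => /(_ isT zp0); lra.
Qed.

Lemma le_add_eps (a b c : R) : 0 <= c -> (forall e, 0 < e -> a <= b + e * c) -> a <= b.
Proof.
move=> c0 H; rewrite leNgt; apply/negP => ab.
have c1 : 0 < 2 * (c + 1) by lra.
have := H ((a - b) / (2 * (c + 1))).
rewrite divr_gt0// ?subr_gt0// => /(_ isT).
have -> : (a - b) / (2 * (c + 1)) * c = (a - b) / 2 * (c / (c + 1)).
  by field; rewrite gt_eqF//; lra.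
have h : c / (c + 1) <= 1 by rewrite ler_pdivrMr; lra.
have : (a - b) / 2 * (c / (c + 1)) <= (a - b) / 2 * 1 by rewrite ler_wpM2l//; lra.
lra.
Qed.

(** Comparison of a bounded solution with a supersolution b. The excess u - b may be
    positive at infinity; subtracting e exp(c t) V, which is itself a supersolution
    and unbounded, confines it to a compact set for every e > 0. *)
Lemma solution_le_barrier f u (b bt : R -> E -> R) (L K : R) : solves f u -> 0 < L ->
  {within [set w : R * E | 0 <= w.1], continuous (fun w => b w.1 w.2)} ->
  (forall t, 0 < t -> classC 2 (b t)) ->
  (forall t x, 0 < t -> is_derive t 1 (b^~ x) (bt t x)) ->
  (forall t x, 0 < t <= L -> A (b t) x <= bt t x) ->
  (forall x, f x <= b 0 x) -> (forall t x, 0 <= t <= L -> - K <= b t x) ->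
  forall t x, 0 <= t <= L -> u t x <= b t x.
Proof.
move=> su L0 cb Cb db hb fb0 bK t x tL.
have [c c0 Hc] := Lyapunov fb B reg.
have [M HM] := so_bounded su _ L0.
have E0 : 0 <= expR (c * t) * V x by rewrite mulr_ge0 ?expR_ge0// ltW// V_gt0.
apply: (le_add_eps E0) => e e0.
pose w t x := b t x + e * (expR (c * t) * V x).
pose z t x := -1 * w t x + u t x.
suff : z t x <= 0 by rewrite /z /w; lra.
have Cw s : 0 < s -> classC 2 (fun x => e * (expR (c * s) * V x)).
  by move=> s0; apply: classC_scale; apply: classC_scale; exact: classC_V.
have dw (s : R) (y : E) : is_derive s 1 (fun s => e * (expR (c * s) * V y))
    (e * (V y * (c * expR (c * s)))).
  apply: is_derive_scale.
  rewrite (_ : (fun s => _) = fun s => V y * expR (c * s)); last first.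
    by apply/funext => ?; rewrite mulrC.
  by apply: is_derive_scale; exact: is_derive_exp_lin.
have cV : continuous (V : E -> R) by exact: classC_cont (classC_V 0).
pose zt s y := -1 * (bt s y + e * (V y * (c * expR (c * s)))) + A (u s) y.
(* Outside this sublevel, e V exceeds u - b <= M + K. *)
apply: (@max_principle z zt L 0 ((M + K) / e) L0) tL.
- have cE := continuous_subspaceT
    (joint_mul_continuous (@exp_lin_continuous c) cV) (A := [set w : R * E | 0 <= w.1]).
  have cw : {within [set w : R * E | 0 <= w.1], continuous
      (fun p => b p.1 p.2 + e * (expR (c * p.1) * V p.2))}.
    by move=> y; exact: (cvgD (cb y) (cvgM (cvg_cst e) (cE y))).
  have cu := so_continuous su.
  have cz : {within [set w : R * E | 0 <= w.1], continuous
      (fun p => -1 * (b p.1 p.2 + e * (expR (c * p.1) * V p.2)) + u p.1 p.2)}.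
    by move=> y; exact: (cvgD (cvgM (cvg_cst (-1 : R)) (cw y)) (cu y)).
  exact: cz.
- move=> y; rewrite /z /w (so_init su) mulr0 expR0 mul1r.
  have := fb0 y; have := mulr_gt0 e0 (V_gt0 y); lra.
- move=> s y sL; rewrite ltr_pdivrMr// => h.
  have := HM _ y sL; rewrite ler_norml => /andP[_ h1].
  have h2 := bK _ y sL; rewrite /z /w.
  have : V y <= expR (c * s) * V y.
    rewrite ler_peMl ?(ltW (V_gt0 y))// -expR0 ler_expR mulr_ge0//.
    by case/andP: sL.
  have e1 : e * V y <= e * (expR (c * s) * V y) -> -1 * (b s y + e * (expR (c * s) * V y)) + u s y <= 0.
    by lra.
  by move=> h3; apply: e1; rewrite ler_wpM2l// ltW.
- move=> s s0; apply: classC_add; last exact: solves_classC2 su s0.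
  by apply: classC_scale; apply: classC_add; [exact: Cb|exact: Cw].
- move=> s y s0; apply: is_derive_lin; last exact: solves_dt su s0.
  by apply: is_derive_add; exact: db.
- move=> s y /andP[s0 sL] _; rewrite mul0r addr0 /zt.
  have Cu := solves_classC2 su s0.
  have Cbw := classC_add (Cb _ s0) (Cw _ s0).
  rewrite /z (Aop_add _ _ _ _ _ (classC_scale (-1) Cbw) Cu) (Aop_scale _ _ _ _ _ _ Cbw).
  rewrite (Aop_add _ _ _ _ _ (Cb _ s0) (Cw _ s0)).
  rewrite (Aop_scale _ _ _ _ _ _ (classC_scale (expR (c * s)) (classC_V 2))).
  rewrite (Aop_scale _ _ _ _ _ _ (classC_V 2)).
  have [/ler_normlP[_ h] _ _ _ _] := Hc y.
  have := hb s y; rewrite s0 sL => /(_ isT).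
  have : e * (expR (c * s) * A V y) <= e * (expR (c * s) * (c * V y)).
    by rewrite ler_wpM2l ?(ltW e0)// ler_wpM2l ?expR_ge0.
  have -> : e * (V y * (c * expR (c * s))) = e * (expR (c * s) * (c * V y)) by ring.
  lra.
Qed.

(** Of a weight w with A w <= c w, initial bounds by a + b w propagate at the rate
    exp(c t): for w = V this is growth, for w = V^-1 decay at infinity. *)
Lemma solution_le_weight f u w (c a b : R) : solves f u -> classC 2 w -> 0 <= c ->
  (forall x, 0 <= w x) -> (forall x, A w x <= c * w x) -> 0 <= b ->
  (forall x, f x <= a + b * w x) ->
  forall t x, 0 <= t -> u t x <= a + b * (expR (c * t) * w x).
Proof.
move=> su Cw c0 w0 Aw b0 fw t x t0.
have L0 : 0 < t + 1 by lra.
apply: (@solution_le_barrier f u (fun t x => a + b * (expR (c * t) * w x))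
  (fun s y => 0 + b * (w y * (c * expR (c * s)))) (t + 1) (- a) su L0); last by lra.
- apply: continuous_subspaceT => y.
  have cj := joint_mul_continuous (@exp_lin_continuous c) (classC_cont Cw).
  exact: (cvgD (cvg_cst a) (cvgM (cvg_cst b) (cj y))).
- move=> s s0; apply: classC_add; first exact: classC_cst.
  by apply: classC_scale; exact: classC_scale.
- move=> s y s0; apply: is_derive_add; apply: is_derive_scale.
  rewrite (_ : (fun s => _) = fun s => w y * expR (c * s)); last first.
    by apply/funext => ?; rewrite mulrC.
  by apply: is_derive_scale; exact: is_derive_exp_lin.
- move=> s y _; rewrite (Aop_add _ _ _ _ _ (classC_cst 2 a)
    (classC_scale b (classC_scale (expR (c * s)) Cw))) Aop_cst.
  rewrite (Aop_scale _ _ _ _ _ _ (classC_scale (expR (c * s)) Cw)) (Aop_scale _ _ _ _ _ _ Cw).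
  rewrite !add0r; apply: ler_wpM2l => //.
  rewrite (_ : w y * (c * _) = expR (c * s) * (c * w y)); last by ring.
  by rewrite ler_wpM2l ?expR_ge0.
- by move=> y; rewrite mulr0 expR0 mul1r.
- by move=> s y _; rewrite opprK lerDl mulr_ge0// mulr_ge0// expR_ge0.
Qed.

Lemma solves_opp f u : solves f u -> solves (fun x => - f x) (fun t x => - u t x).
Proof.
move=> su; have s0 : solves (fun x => -1 * f x + f x) (fun t x => -1 * u t x + u t x).
  exact: solves_lin.
have := solves_lin (-2) su (solves_lin 0 su su).
have -> : (fun x => -2 * f x + (0 * f x + f x)) = fun x => - f x.
  by apply/funext => x; ring.
have -> // : (fun t x => -2 * u t x + (0 * u t x + u t x)) = fun t x => - u t x.
by apply/funext => t; apply/funext => x; ring.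
Qed.

Lemma solution_abs_le_weight f u w (c a b : R) : solves f u -> classC 2 w -> 0 <= c ->
  (forall x, 0 <= w x) -> (forall x, A w x <= c * w x) -> 0 <= b ->
  (forall x, `|f x| <= a + b * w x) ->
  forall t x, 0 <= t -> `|u t x| <= a + b * (expR (c * t) * w x).
Proof.
move=> su Cw c0 w0 Aw b0 fw t x t0; rewrite ler_norml lerNl.
apply/andP; split.
  apply: (solution_le_weight (solves_opp su) Cw c0 w0 Aw b0 _ _ t0) => y.
  by have := fw y; rewrite ler_norml => /andP[]; rewrite lerNl.
apply: (solution_le_weight su Cw c0 w0 Aw b0 _ _ t0) => y.
by have := fw y; rewrite ler_norml => /andP[].
Qed.

Lemma solution_bound f u (M : R) : solves f u -> (forall x, `|f x| <= M) ->
  forall t x, 0 <= t -> `|u t x| <= M.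
Proof.
move=> su fM t x t0.
have h : `|u t x| <= M + 0 * (expR (0 * t) * 0).
  apply: (@solution_abs_le_weight f u (fun=> 0) 0 M 0 su (classC_cst 2 0)) => // y.
    by rewrite Aop_cst mulr0.
  by rewrite mul0r addr0.
by rewrite mul0r addr0 in h.
Qed.

End MaximumPrinciple.

(** * Propagation of a weighted Lipschitz bound *)

Lemma continuous_within_map {R : realType} (X Y : topologicalType) (S : set X)
    (S' : set Y) (g : Y -> X) (U : X -> R) : continuous g ->
  (forall p, S' p -> S (g p)) -> {within S, continuous U} ->
  {within S', continuous (fun p => U (g p))}.
Proof.
move=> cg gS /subspace_continuousP cU; apply/subspace_continuousP => p S'p.
apply: cvg_trans (cU (g p) (gS p S'p)) => A hA.
have h1 : nbhs p (fun y => S (g y) -> A (U (g y))) by exact: (cg p _ hA).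
have h2 : nbhs p (fun y => S' y -> A (U (g y))).
  by apply: filterS h1 => y h Sy; apply: h; exact: gS.
exact: h2.
Qed.

Section OneVariable.
Context {R : realType}.
Implicit Types (U W m D : R -> R) (e K : R).

(** The doubled function of the weighted Lipschitz estimate, restricted to a pair of
    lines starting at x and y: U and W are the values of the solution on the two
    lines, m is the weight on the first one and D the squared distance. *)
Definition doubled e K U W m D : R -> R := fun h =>
  e * ((U h - W h) * (U h - W h) + D h * (U h * U h)) - K * (D h * m h).

Definition doubled1 e K (U W m D U1 W1 m1 D1 : R) : R :=
  e * (2 * (U - W) * (U1 - W1) + (D1 * (U * U) + 2 * D * U * U1))
  - K * (D1 * m + D * m1).

Lemma is_derive_doubled e K U W m D (h U1 W1 m1 D1 : R) :
  is_derive h 1 U U1 -> is_derive h 1 W W1 -> is_derive h 1 m m1 ->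
  is_derive h 1 D D1 ->
  is_derive h 1 (doubled e K U W m D)
    (doubled1 e K (U h) (W h) (m h) (D h) U1 W1 m1 D1).
Proof.
move=> dU dW dm dD.
have dd := is_derive_add dU (is_derive_scale (-1) dW).
have dUU := is_derive_mul dU dU.
have d1 := is_derive_add (is_derive_mul dd dd) (is_derive_mul dD dUU).
have d2 := is_derive_add (is_derive_scale e d1)
  (is_derive_scale (-1) (is_derive_scale K (is_derive_mul dD dm))).
rewrite (_ : doubled _ _ _ _ _ _ = fun y => e * ((U y + -1 * W y) * (U y + -1 * W y) + D y * (U y * U y)) +
          -1 * (K * (D y * m y))); last first.
  by apply/funext => y; rewrite /doubled; ring.
by apply: is_derive_eq d2 _; rewrite /doubled1; ring.
Qed.

Lemma doubled_second e K U W m D U1 W1 m1 D1 (U2 W2 m2 D2 eps : R) : 0 < eps ->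
  (forall h : R, is_derive h 1 U (U1 h)) -> (forall h : R, is_derive h 1 W (W1 h)) ->
  (forall h : R, is_derive h 1 m (m1 h)) -> (forall h : R, is_derive h 1 D (D1 h)) ->
  is_derive (0 : R) 1 U1 U2 -> is_derive (0 : R) 1 W1 W2 ->
  is_derive (0 : R) 1 m1 m2 -> is_derive (0 : R) 1 D1 D2 ->
  (forall h, `|h| < eps -> doubled e K U W m D h <= doubled e K U W m D 0) ->
  e * (2 * (U1 0 - W1 0) * (U1 0 - W1 0) + 2 * (U 0 - W 0) * (U2 - W2)
    + D2 * (U 0 * U 0) + 4 * D1 0 * U 0 * U1 0 + 2 * D 0 * (U1 0 * U1 0)
    + 2 * D 0 * U 0 * U2) - K * (D2 * m 0 + 2 * D1 0 * m1 0 + D 0 * m2) <= 0.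
Proof.
move=> eps0 dU dW dm dD dU1 dW1 dm1 dD1 mx.
have d0 h := is_derive_doubled e K (dU h) (dW h) (dm h) (dD h).
suff H : is_derive (0 : R) 1
    (fun h => doubled1 e K (U h) (W h) (m h) (D h) (U1 h) (W1 h) (m1 h) (D1 h))
    (e * (2 * (U1 0 - W1 0) * (U1 0 - W1 0) + 2 * (U 0 - W 0) * (U2 - W2)
    + D2 * (U 0 * U 0) + 4 * D1 0 * U 0 * U1 0 + 2 * D 0 * (U1 0 * U1 0)
    + 2 * D 0 * U 0 * U2) - K * (D2 * m 0 + 2 * D1 0 * m1 0 + D 0 * m2)).
  by have [] := local_max_derive2 eps0 mx (fun h _ => d0 h) H.
have dd := is_derive_add (dU 0) (is_derive_scale (-1) (dW 0)).
have dd1 := is_derive_add dU1 (is_derive_scale (-1) dW1).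
have t1 := is_derive_scale 2 (is_derive_mul dd dd1).
have t2 := is_derive_mul dD1 (is_derive_mul (dU 0) (dU 0)).
have t3 := is_derive_scale 2 (is_derive_mul (dD 0) (is_derive_mul (dU 0) dU1)).
have t4 := is_derive_add (is_derive_mul dD1 (dm 0)) (is_derive_mul (dD 0) dm1).
have t5 := is_derive_add (is_derive_scale e (is_derive_add t1 (is_derive_add t2 t3)))
  (is_derive_scale (-1) (is_derive_scale K t4)).
rewrite (_ : (fun h => _) = fun y => e * (2 * ((U y + -1 * W y) * (U1 y + -1 * W1 y)) +
   (D1 y * (U y * U y) + 2 * (D y * (U y * U1 y)))) + -1 * (K * (D1 y * m y + D y * m1 y))); last first.
  by apply/funext => y; rewrite /doubled1; ring.
by apply: is_derive_eq t5 _; ring.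
Qed.

Lemma amgm_le (X a b : R) : 0 <= a -> 0 <= b -> X ^+ 2 <= 4 * a * b -> `|X| <= a + b.
Proof.
move=> a0 b0 h; rewrite -ler_sqr ?nnegrE ?addr_ge0// real_normK ?num_real//.
apply: le_trans h _; have := sqr_ge0 (a - b); rewrite sqrrB sqrrD !mulr2n; lra.
Qed.

Lemma sq_le_lin (X c s : R) : 0 <= c -> 0 <= s -> X ^+ 2 <= c * s ^+ 2 -> `|X| <= (c + 1) * s.
Proof.
move=> c0 s0 h; rewrite -ler_sqr ?nnegrE ?mulr_ge0 ?addr_ge0// real_normK ?num_real//.
apply: le_trans h _; rewrite exprMn ler_wpM2r ?sqr_ge0//.
by rewrite sqrrD expr1n mulr1 mulr2n; have := sqr_ge0 c; lra.
Qed.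

(** The scalar inequality that ends the doubling argument. Here u = u(x),
    de = u(x) - u(y), d is the squared distance, m the weight, and
    G = K m - e u^2; the sum Z measures the distance of the diffusions at x and y,
    S1 and X, X' that of the drifts, and g = <Q Du, Du>. The term 2 e d g, which
    comes from adding d u(x)^2 to the square of the increment, absorbs all the
    terms containing the gradient of u. *)
Lemma doubling_algebra (C1 C2 C3 c e K d u de m Z S1 SP SM Am G X X' g : R) :
  0 < e -> 0 <= K -> 0 <= d <= 1 -> 0 <= m -> 0 <= g ->
  0 <= C1 -> 0 <= C2 -> 0 <= C3 ->
  G = K * m - e * (u * u) -> 0 <= G ->
  Z <= C1 * d -> `|S1| <= C1 * d ->
  `|8 * u * SP| <= d * g + 16 * (u * u) * Z ->
  `|SM| <= C2 * d * m -> Am <= C2 * m ->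
  X ^+ 2 <= C3 * d * g -> `|X'| <= C2 * m ->
  c * e * (de * de + d * (u * u)) + 2 * e * d * g <=
    G * (2 * Z) + G * (2 * S1) + (2 * e * (de + d * u) * X - K * d * X')
    - 8 * e * u * SP + 4 * K * SM + K * d * Am ->
  K * d * m < e * (de * de + d * (u * u)) ->
  c <= 4 * C1 + 6 * C2 + 2 * (C3 + 1) + 16 * C1.
Proof.
move=> e0 K0 /andP[d0 d1] m0 g0 C10 C20 C30 EG G0 hZ hS1 hSP hSM hAm hX hX' main Y0.
set H := de * de + d * (u * u) in main Y0 *.
have uu : 0 <= u * u by rewrite -expr2 sqr_ge0.
have dede : 0 <= de * de by rewrite -expr2 sqr_ge0.
have H0 : 0 <= H by apply: addr_ge0 => //; exact: mulr_ge0.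
have GK : G <= K * m by rewrite EG lerBlDr lerDl mulr_ge0// ltW.
have Cd : 0 <= C1 * d by rewrite mulr_ge0.
have b1 : G * Z <= K * m * (C1 * d).
  apply: (@le_trans _ _ (G * (C1 * d))); first by rewrite ler_wpM2l.
  by rewrite ler_wpM2r.
have b2 : G * S1 <= K * m * (C1 * d).
  apply: (@le_trans _ _ (G * (C1 * d))); last by rewrite ler_wpM2r.
  by rewrite ler_wpM2l// (le_trans (ler_norm _)).
have b3 : - (8 * u * SP) <= d * g + 16 * (u * u) * (C1 * d).
  apply: le_trans (ler_norm _) _; rewrite normrN; apply: le_trans hSP _.
  by rewrite lerD2l ler_wpM2l// mulr_ge0.
have b3' : - (8 * e * u * SP) <= e * (d * g) + 16 * C1 * (e * (d * (u * u))).
  have := ler_wpM2l (ltW e0) b3; lra.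
have b4 : K * SM <= K * (C2 * d * m).
  by rewrite ler_wpM2l// (le_trans (ler_norm _)).
have b5 : K * d * Am <= K * d * (C2 * m) by rewrite ler_wpM2l// mulr_ge0.
have b6 : - (K * d * X') <= K * d * (C2 * m).
  rewrite -mulrN ler_wpM2l ?mulr_ge0//; apply: le_trans (ler_norm _) _.
  by rewrite normrN.
have b7 : 2 * (de + d * u) * X <= (C3 + 1) * (de + d * u) ^+ 2 + d * g.
  apply: le_trans (ler_norm _) _; apply: amgm_le.
  - by rewrite mulr_ge0 ?sqr_ge0// addr_ge0.
  - exact: mulr_ge0.
  have -> : (2 * (de + d * u) * X) ^+ 2 = 4 * (de + d * u) ^+ 2 * X ^+ 2 by ring.
  have -> : 4 * ((C3 + 1) * (de + d * u) ^+ 2) * (d * g) =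
    4 * (de + d * u) ^+ 2 * ((C3 + 1) * (d * g)) by ring.
  apply: ler_wpM2l; first by rewrite mulr_ge0 ?sqr_ge0.
  have := mulr_ge0 d0 g0; lra.
have b8 : (de + d * u) ^+ 2 <= 2 * H.
  have h1 : d * (d * (u * u)) <= d * (u * u) by rewrite ler_piMl// mulr_ge0.
  have := sqr_ge0 (de - d * u); rewrite sqrrB sqrrD !mulr2n /H; lra.
have b9 : 2 * e * (de + d * u) * X <= e * ((C3 + 1) * (2 * H)) + e * (d * g).
  have h2 : (C3 + 1) * (de + d * u) ^+ 2 <= (C3 + 1) * (2 * H) by rewrite ler_wpM2l//; lra.
  have := ler_wpM2l (ltW e0) b7; have := ler_wpM2l (ltW e0) h2; lra.
have b10 : e * (d * (u * u)) <= e * H.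
  by rewrite ler_wpM2l ?(ltW e0)// lerDr.
have eH : 0 < e * H by apply: le_lt_trans Y0; rewrite !mulr_ge0.
have b11 : C1 * (e * (d * (u * u))) <= C1 * (e * H) by rewrite ler_wpM2l.
have b12 : C1 * (K * d * m) <= C1 * (e * H) by rewrite ler_wpM2l// ltW.
have b13 : C2 * (K * d * m) <= C2 * (e * H) by rewrite ler_wpM2l// ltW.
have fin : c * (e * H) <= (4 * C1 + 6 * C2 + 2 * (C3 + 1) + 16 * C1) * (e * H) by lra.
by rewrite ler_pM2r in fin.
Qed.

End OneVariable.

Section Doubling.
Context {R : realType} {n q : nat}.
Local Notation E := 'rV[R]_n.
Variables (fb : 'I_q -> 'I_n) (Q : E -> 'M[R]_q) (B : 'M[R]_n) (F : E -> 'rV[R]_q).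
Hypothesis reg : regular_coefficients Q F.
Local Notation A := (Aop fb Q B F).
Local Notation Gam := (Gam fb Q).
Local Notation solves := (solves fb Q B F).
Local Notation m := (@Vinv2 R n).
Implicit Types (f : E -> R) (x y z a b : E) (t : R) (u : R -> E -> R).

(** The first order part of A as a vector field. *)
Definition drift x : E := (\row_i \sum_j B i j * x 0 j) + emb fb (F x).

Lemma Aop_drift f x : A f x =
  \sum_i \sum_j Q x i j * partial (fb i) (partial (fb j) f) x
  + \sum_i drift x 0 i * partial i f x.
Proof.
rewrite /Aop -addrA; congr (_ + _).
rewrite -(sum_emb fb (F x) (fun i => partial i f x)) -big_split.
by apply: eq_bigr => i _ /=; rewrite !mxE mulrDl mulr_suml.
Qed.

Lemma drift_diff x y : exists2 S1,
  S1 = \sum_i \sum_j B i j * (x 0 j - y 0 j) * (x 0 i - y 0 i) &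
  \sum_i (x 0 i - y 0 i) * (drift x 0 i - drift y 0 i) =
  S1 + \sum_j (x 0 (fb j) - y 0 (fb j)) * (F x 0 j - F y 0 j).
Proof.
eexists; first reflexivity.
have -> : \sum_j (x 0 (fb j) - y 0 (fb j)) * (F x 0 j - F y 0 j) =
    \sum_i emb fb (F x - F y) 0 i * (x 0 i - y 0 i).
  rewrite (sum_emb fb (F x - F y) (fun i => x 0 i - y 0 i)).
  by apply: eq_bigr => j _; rewrite !mxE mulrC.
rewrite -big_split; apply: eq_bigr => i _ /=.
have -> : emb fb (F x - F y) 0 i = emb fb (F x) 0 i - emb fb (F y) 0 i.
  rewrite !emb_coord -sumrN -big_split; apply: eq_bigr => j _ /=.
  by rewrite !mxE mulrBl.
rewrite /drift !mxE -mulr_suml.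
have -> : \sum_j B i j * (x 0 j - y 0 j) = \sum_j B i j * x 0 j - \sum_j B i j * y 0 j.
  by rewrite -sumrN -big_split; apply: eq_bigr => j _ /=; rewrite mulrBr.
move: (\sum_j _) (\sum_j _) (emb _ _ _ _) (emb _ _ _ _) (x 0 i) (y 0 i) => a1 a2 a3 a4 a5 a6.
by ring.
Qed.

Lemma sqd_line x y a b (h : R) :
  is_derive h 1 (fun h => sqd (h *: a + x) (h *: b + y))
    (\sum_i 2 * (h * (a 0 i - b 0 i) + (x 0 i - y 0 i)) * (a 0 i - b 0 i)).
Proof.
rewrite (_ : (fun h => _) = fun h => \sum_i (h * (a 0 i - b 0 i) + (x 0 i - y 0 i)) ^+ 2); last first.
  by apply/funext => k; apply: eq_bigr => i _; rewrite !mxE; ring.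
apply: is_derive_sumE => i.
have d1 : is_derive h 1 (fun h : R => h * (a 0 i - b 0 i) + (x 0 i - y 0 i)) (a 0 i - b 0 i).
  rewrite -[X in is_derive _ _ _ X]addr0; apply: is_derive_add.
  rewrite (_ : (fun h => _) = fun h => (a 0 i - b 0 i) * h); last first.
    by apply/funext => k; rewrite mulrC.
  by rewrite -[X in is_derive _ _ _ X]mulr1; apply: is_derive_scale; exact: is_derive_id.
rewrite (_ : (fun h => _) = fun h => (h * (a 0 i - b 0 i) + (x 0 i - y 0 i)) * (h * (a 0 i - b 0 i) + (x 0 i - y 0 i))); last first.
  by apply/funext => k; rewrite expr2.
by apply: is_derive_eq (is_derive_mul d1 d1) _; ring.
Qed.

Lemma sqd_line2 x y a b :
  is_derive (0 : R) 1 (fun h => \sum_i 2 * (h * (a 0 i - b 0 i) + (x 0 i - y 0 i)) * (a 0 i - b 0 i))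
    (\sum_i 2 * (a 0 i - b 0 i) ^+ 2).
Proof.
apply: is_derive_sumE => i.
rewrite (_ : (fun h => _) = fun h => (2 * (a 0 i - b 0 i) ^+ 2) * h + 2 * (x 0 i - y 0 i) * (a 0 i - b 0 i)); last first.
  by apply/funext => k; ring.
rewrite -[X in is_derive _ _ _ X]addr0; apply: is_derive_add.
by rewrite -[X in is_derive _ _ _ X]mulr1; apply: is_derive_scale; exact: is_derive_id.
Qed.

Lemma sqd_line_small x y a b : sqd x y < 1 -> exists2 eps : R, 0 < eps &
  forall h, `|h| < eps -> sqd (h *: a + x) (h *: b + y) <= 1.
Proof.
move=> d1.
have [h0 h00 H] := is_derive_eps (sqd_line x y a b 0) (ltr01).
set D1 := \sum_i _ in H.
have c0 : 0 < `|D1| + 1 by rewrite ltr_wpDl.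
exists (Num.min h0 ((1 - sqd x y) / (`|D1| + 1))).
  by rewrite lt_min h00 divr_gt0// subr_gt0.
move=> h; rewrite lt_min => /andP[hh0]; rewrite ltr_pdivlMr// => h1.
have := H h hh0; rewrite add0r !scale0r !add0r mul1r => /ler_normlP[_ h2].
have h3 : D1 * h <= `|D1| * `|h| by rewrite -normrM ler_norm.
have : `|h| * (`|D1| + 1) = `|D1| * `|h| + `|h| by ring.
move: h1 h2 h3; lra.
Qed.

Lemma sum_sq_emb (al : 'rV[R]_q) :
  \sum_i emb fb al 0 i ^+ 2 <= (n * q)%:R * \sum_j al 0 j ^+ 2.
Proof.
rewrite natrM -mulrA.
apply: (@le_trans _ _ (\sum_(i < n) (q%:R * \sum_j al 0 j ^+ 2))); last first.
  by rewrite sumr_const card_ord -[(_ * _) *+ n]mulr_natl.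
apply: ler_sum => i _; rewrite emb_coord.
apply: le_trans (cauchy_schwarz _ _) _; rewrite mulrC ler_wpM2r//.
  by apply: sumr_ge0 => j _; exact: sqr_ge0.
apply: (@le_trans _ _ (\sum_(j < q) 1)); last by rewrite sumr_const card_ord.
by apply: ler_sum => j _; case: (i == fb j); rewrite ?expr1n ?expr0n//= ler01.
Qed.

End Doubling.

Section Doubling2.
Context {R : realType} {n q : nat}.
Local Notation E := 'rV[R]_n.
Variables (fb : 'I_q -> 'I_n) (Q : E -> 'M[R]_q) (B : 'M[R]_n) (F : E -> 'rV[R]_q).
Hypothesis reg : regular_coefficients Q F.
Local Notation A := (Aop fb Q B F).
Local Notation Gam := (Gam fb Q).
Local Notation solves := (solves fb Q B F).
Local Notation drift := (drift fb B F).
Local Notation m := (@Vinv2 R n).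
Implicit Types (f : E -> R) (x y z a b : E) (t : R) (u : R -> E -> R).

Lemma sum_sq_factor k (S : 'M[R]_q) (M : 'M[R]_(q, k)) (v : 'rV[R]_q) : S = M *m M^T ->
  \sum_l (\sum_j M j l * v 0 j) ^+ 2 = bf S v v.
Proof.
move=> ->; rewrite /bf mulmxA -mulmxA -[X in _ *m X]trmxK !trmx_mul !trmxK mxE.
apply: eq_bigr => l _; rewrite !mxE expr2; congr (_ * _);
  by apply: eq_bigr => j _; rewrite ?mxE mulrC.
Qed.

(** When this function is nonpositive, (u(x) - u(y))^2 <= K exp(c t) d m(x).
    The extra term d u(x)^2 provides, through A (u^2), the good term
    2 d <Q Du, Du>, as in Bernstein's method. *)
Definition doubling (c K : R) u t x y : R :=
  expR (- c * t) * ((u t x - u t y) * (u t x - u t y) + sqd x y * (u t x * u t x))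
  - K * (sqd x y * m x).

Lemma doubling_first_order c K f u t x y a b : solves f u -> 0 < t -> sqd x y < 1 ->
  (forall x' y', sqd x' y' <= 1 -> doubling c K u t x' y' <= doubling c K u t x y) ->
  doubled1 (expR (- c * t)) K (u t x) (u t y) (m x) (sqd x y)
    (\sum_i a 0 i * partial i (u t) x) (\sum_i b 0 i * partial i (u t) y)
    (\sum_i a 0 i * partial i m x) (\sum_i 2 * (x 0 i - y 0 i) * (a 0 i - b 0 i)) = 0.
Proof.
move=> su t0 d1 mx; have Cu := solves_classC2 su t0.
have [eps eps0 He] := sqd_line_small a b d1.
have dU := proj1 (lineE _ _ _ _) (classC_dir x a Cu).
have dW := proj1 (lineE _ _ _ _) (classC_dir y b Cu).
have dm := proj1 (lineE _ _ _ _) (classC_dir x a classC_Vinv2).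
have dD := sqd_line x y a b 0.
have := is_derive_doubled (expR (- c * t)) K dU dW dm dD.
rewrite !scale0r !add0r => H.
rewrite (_ : \sum_i 2 * (x 0 i - y 0 i) * (a 0 i - b 0 i) =
  \sum_i 2 * (0 * (a 0 i - b 0 i) + (x 0 i - y 0 i)) * (a 0 i - b 0 i)); last first.
  by apply: eq_bigr => i _; rewrite mul0r add0r.
apply: (local_max_derive eps0 _ H) => h hh; rewrite add0r /doubled.
rewrite !scale0r !add0r; exact: mx (He h hh).
Qed.

Lemma doubling_second_order c K f u t x y (al be : 'rV[R]_q) : solves f u -> 0 < t -> sqd x y < 1 ->
  (forall x' y', sqd x' y' <= 1 -> doubling c K u t x' y' <= doubling c K u t x y) ->
  let e := expR (- c * t) in
  let p := \sum_j al 0 j * partial (fb j) (u t) x in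
  let r := \sum_j be 0 j * partial (fb j) (u t) y in
  let mu := \sum_j al 0 j * partial (fb j) m x in
  let s := \sum_i (x 0 i - y 0 i) * (emb fb al 0 i - emb fb be 0 i) in
  let Z := \sum_i (emb fb al 0 i - emb fb be 0 i) ^+ 2 in
  is_true (e * (2 * (p - r) ^+ 2 + 2 * (u t x - u t y) *
     (\sum_i \sum_j al 0 i * al 0 j * partial (fb i) (partial (fb j) (u t)) x -
      \sum_i \sum_j be 0 i * be 0 j * partial (fb i) (partial (fb j) (u t)) y)
   + 2 * Z * (u t x * u t x) + 8 * u t x * (s * p) + 2 * sqd x y * p ^+ 2
   + 2 * sqd x y * u t x *
     \sum_i \sum_j al 0 i * al 0 j * partial (fb i) (partial (fb j) (u t)) x)
  - K * (2 * Z * m x + 4 * (s * mu) + sqd x y *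
     \sum_i \sum_j al 0 i * al 0 j * partial (fb i) (partial (fb j) m) x) <= 0).
Proof.
move=> su t0 d1 mx e p r mu s Z; have Cu := solves_classC2 su t0.
pose a := emb fb al; pose b := emb fb be.
have [eps eps0 He] := sqd_line_small a b d1.
have dU (h : R) := is_derive_line (is_derive_emb fb (h *: a + x) al Cu).
have dW (h : R) := is_derive_line (is_derive_emb fb (h *: b + y) be Cu).
have dm (h : R) := is_derive_line (is_derive_emb fb (h *: a + x) al (@classC_Vinv2 R n)).
have dD := sqd_line x y a b.
have dU2 := proj1 (lineE _ _ _ _) (is_derive_emb2 fb x al Cu).
have dW2 := proj1 (lineE _ _ _ _) (is_derive_emb2 fb y be Cu).
have dm2 := proj1 (lineE _ _ _ _) (is_derive_emb2 fb x al (@classC_Vinv2 R n)).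
have dD2 := sqd_line2 x y a b.
have := @doubled_second R e K _ _ _ _ _ _ _ _ _ _ _ _ eps eps0 dU dW dm dD dU2 dW2 dm2 dD2.
rewrite !scale0r !add0r.
have -> : \sum_i 2 * (0 * (a 0 i - b 0 i) + (x 0 i - y 0 i)) * (a 0 i - b 0 i) = 2 * s.
  by rewrite mulr_sumr; apply: eq_bigr => i _; rewrite mul0r add0r mulrA.
have -> : \sum_i 2 * (a 0 i - b 0 i) ^+ 2 = 2 * Z by rewrite mulr_sumr.
move=> H; apply: le_trans (H _).
  rewrite le_eqVlt; apply/orP; left; apply/eqP.
  have id14 (e0 K0 p0 r0 de U2 W2 Z0 uu s0 d0 m0 mu0 m2 : R) :
    e0 * (2 * (p0 - r0) ^+ 2 + 2 * de * (U2 - W2) + 2 * Z0 * (uu * uu)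
      + 8 * uu * (s0 * p0) + 2 * d0 * p0 ^+ 2 + 2 * d0 * uu * U2)
      - K0 * (2 * Z0 * m0 + 4 * (s0 * mu0) + d0 * m2) =
    e0 * (2 * (p0 - r0) * (p0 - r0) + 2 * de * (U2 - W2) + 2 * Z0 * (uu * uu)
      + 4 * (2 * s0) * uu * p0 + 2 * d0 * (p0 * p0) + 2 * d0 * uu * U2)
      - K0 * (2 * Z0 * m0 + 2 * (2 * s0) * mu0 + d0 * m2) by ring.
  exact: id14.
move=> h hh; rewrite /doubled !scale0r !add0r; exact: mx (He h hh).
Qed.

Lemma doubling_time c K f u t x y : solves f u -> 0 < t ->
  (forall s, 0 <= s <= t -> doubling c K u s x y <= doubling c K u t x y) ->
  c * expR (- c * t) * ((u t x - u t y) * (u t x - u t y) + sqd x y * (u t x * u t x))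
  <= expR (- c * t) * (2 * (u t x - u t y) * (A (u t) x - A (u t) y)
       + 2 * sqd x y * u t x * A (u t) x).
Proof.
move=> su t0 mx.
have dx := solves_dt x su t0; have dy := solves_dt y su t0.
have dd := is_derive_add dx (is_derive_scale (-1) dy).
have H := is_derive_add (is_derive_mul dd dd) (is_derive_scale (sqd x y) (is_derive_mul dx dx)).
have H2 := is_derive_mul (is_derive_exp_lin (- c) t) H.
have := left_max_derive_ge0 t0 _ H2.
set e := expR _ => H3.
have {}H3 := H3 _.
have : 0 <= e * ((u t x + -1 * u t y) * (A (u t) x + -1 * A (u t) y)
    + (u t x + -1 * u t y) * (A (u t) x + -1 * A (u t) y)
    + sqd x y * (u t x * A (u t) x + u t x * A (u t) x))
  + ((u t x + -1 * u t y) * (u t x + -1 * u t y) + sqd x y * (u t x * u t x)) * (- c * e).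
  apply: H3 => h h0 ht; have := mx (t - h); rewrite /doubling -/e.
  have -> : 0 <= t - h <= t by apply/andP; split; lra.
  move=> /(_ isT); lra.
lra.
Qed.


Lemma sum_second_order (I : finType) (e K de ux d mm : R)
    (pr U2 W2 Z sp p2 sm m2 : I -> R) : 0 <= e -> (forall k, 0 <= pr k) ->
  (forall k, e * (2 * pr k + 2 * de * (U2 k - W2 k) + 2 * Z k * (ux * ux)
      + 8 * ux * sp k + 2 * d * p2 k + 2 * d * ux * U2 k)
    - K * (2 * Z k * mm + 4 * sm k + d * m2 k) <= 0) ->
  e * (2 * de * (\sum_k U2 k - \sum_k W2 k) + 2 * (\sum_k Z k) * (ux * ux)
     + 8 * ux * (\sum_k sp k) + 2 * d * (\sum_k p2 k) + 2 * d * ux * (\sum_k U2 k))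
    - K * (2 * (\sum_k Z k) * mm + 4 * (\sum_k sm k) + d * (\sum_k m2 k)) <= 0.
Proof.
move=> e0 pr0 H.
have h : \sum_k (2 * e * pr k + ((2 * e * de + 2 * e * d * ux) * U2 k
   + ((- (2 * e * de)) * W2 k + ((2 * e * (ux * ux) - 2 * K * mm) * Z k
   + ((8 * e * ux) * sp k + ((2 * e * d) * p2 k + ((- (4 * K)) * sm k
   + (- (K * d)) * m2 k))))))) <= 0.
  apply: sumr_le0 => k _; apply: le_trans (H k).
  by rewrite le_eqVlt; apply/orP; left; apply/eqP; ring.
rewrite !big_split /= -!mulr_sumr in h.
have h2 : 0 <= 2 * e * \sum_k pr k by rewrite mulr_ge0 ?sumr_ge0// mulr_ge0.
move: h h2; move: (\sum_k pr k) (\sum_k U2 k) (\sum_k W2 k) (\sum_k Z k)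
  (\sum_k sp k) (\sum_k p2 k) (\sum_k sm k) (\sum_k m2 k) => a1 a2 a3 a4 a5 a6 a7 a8.
lra.
Qed.

(** At a positive interior maximum of the doubled function, the first derivatives
    vanish and the second derivatives are nonpositive along every pair of
    directions. The pairs of columns of the coupled factors of Q(x) and Q(y) are
    used for the second order terms, the pair of drifts for the first order terms,
    and the coordinate directions at x to express G (x - y) by the gradient of u;
    in this way the term coming from F, whose increments are controlled by Q only,
    is absorbed by <Q Du, Du>. What remains bounds c. *)
Lemma doubling_max : exists2 S : R, 0 <= S & forall c K f u t x y, solves f u ->
  0 < t -> sqd x y < 1 -> 0 <= K ->
  expR (- c * t) * (u t x * u t x) <= K * m x ->
  0 < doubling c K u t x y ->
  (forall s x' y', 0 <= s <= t -> sqd x' y' <= 1 ->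
     doubling c K u s x' y' <= doubling c K u t x y) -> c <= S.
Proof.
have [CL CL0 HCL] := coef_local reg.
have [Cy Cy0 HCy] := Lyapunov fb B reg.
(* C1 is for the diffusions and B, C3 for F, and C2 for what involves the weight. *)
pose C1 := (n * q)%:R * (q%:R ^+ 2 * CL) + \sum_i \sum_j `|B i j|.
have sB : 0 <= \sum_i \sum_j `|B i j| by apply: sumr_ge0 => i _; apply: sumr_ge0.
have qC : 0 <= (n * q)%:R * (q%:R ^+ 2 * CL) :> R by rewrite !mulr_ge0 ?exprn_ge0.
have C10 : 0 <= C1 by exact: addr_ge0.
pose C3 := q%:R * CL.
have C30 : 0 <= C3 by rewrite mulr_ge0.
pose C2 := (C1 * Cy + 1) + (C3 * Cy + 1) + Cy.
have c1y : 0 <= C1 * Cy by exact: mulr_ge0.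
have c3y : 0 <= C3 * Cy by exact: mulr_ge0.
have [C2a C2b C2c] : [/\ C1 * Cy + 1 <= C2, C3 * Cy + 1 <= C2 & Cy <= C2].
  by rewrite /C2; split; lra.
have C20 : 0 <= C2 by lra.
exists (4 * C1 + 6 * C2 + 2 * (C3 + 1) + 16 * C1); first lra.
move=> c K f u t x y su t0 d1 K0 uK Y0 mx.
set e := expR (- c * t) in uK *.
have e0 : 0 < e := expR_gt0 _.
pose d := sqd x y; have d0 : 0 <= d := sqd_ge0 x y.
have m0 : 0 < m x := Vinv2_gt0 x.
have mxt x' y' : sqd x' y' <= 1 -> doubling c K u t x' y' <= doubling c K u t x y.
  by apply: mx; rewrite (ltW t0) lexx.
have [M1 [M2 [EM1 EM2 HM]]] := @coupling R q (Q x) (Q y) (CL * d)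
  (coef_sym reg x) (coef_sym reg y) (coef_pos reg x) (bf_ge0 reg y)
  (mulr_ge0 CL0 d0) (fun i j v => (HCL x y v (ltW d1)).1 i j).
pose al k : 'rV[R]_q := \row_i M1 i k; pose be k : 'rV[R]_q := \row_i M2 i k.
pose ux := u t x; pose de := u t x - u t y.
pose gu : 'rV[R]_q := gradq fb (u t) x; pose gm : 'rV[R]_q := gradq fb m x.
pose p k := \sum_j al k 0 j * partial (fb j) (u t) x.
pose r k := \sum_j be k 0 j * partial (fb j) (u t) y.
pose mu k := \sum_j al k 0 j * partial (fb j) m x.
pose s k := \sum_i (x 0 i - y 0 i) * (emb fb (al k) 0 i - emb fb (be k) 0 i).
pose Z k := \sum_i (emb fb (al k) 0 i - emb fb (be k) 0 i) ^+ 2.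
pose U2 k := \sum_i \sum_j al k 0 i * al k 0 j * partial (fb i) (partial (fb j) (u t)) x.
pose W2 k := \sum_i \sum_j be k 0 i * be k 0 j * partial (fb i) (partial (fb j) (u t)) y.
pose m2 k := \sum_i \sum_j al k 0 i * al k 0 j * partial (fb i) (partial (fb j) m) x.
have second k : e * (2 * (p k - r k) ^+ 2 + 2 * de * (U2 k - W2 k) + 2 * Z k * (ux * ux)
   + 8 * ux * (s k * p k) + 2 * d * p k ^+ 2 + 2 * d * ux * U2 k)
  - K * (2 * Z k * m x + 4 * (s k * mu k) + d * m2 k) <= 0.
  exact: (@doubling_second_order c K f u t x y (al k) (be k) su t0 d1 mxt).
pose g := \sum_k p k ^+ 2; pose gmu := \sum_k mu k ^+ 2.
pose SP := \sum_k s k * p k; pose SM := \sum_k s k * mu k; pose ZZ := \sum_k Z k.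
pose SU := \sum_k U2 k; pose SW := \sum_k W2 k; pose Sm := \sum_k m2 k.
have Second : e * (2 * de * (SU - SW) + 2 * ZZ * (ux * ux)
   + 8 * ux * SP + 2 * d * g + 2 * d * ux * SU)
  - K * (2 * ZZ * m x + 4 * SM + d * Sm) <= 0.
  exact: (@sum_second_order _ e K de ux d (m x) (fun k => (p k - r k) ^+ 2) U2 W2 Z
    (fun k => s k * p k) (fun k => p k ^+ 2) (fun k => s k * mu k) m2 (ltW e0)
    (fun k => sqr_ge0 _) second).
have sumU (h : E -> R) : \sum_k \sum_i \sum_j al k 0 i * al k 0 j * partial (fb i) (partial (fb j) h) x =
    \sum_i \sum_j Q x i j * partial (fb i) (partial (fb j) h) x.
  rewrite -(sum_col_second fb h x EM1); apply: eq_bigr => k _.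
  by apply: eq_bigr => i _; apply: eq_bigr => j _; rewrite !mxE.
have sumW (h : E -> R) : \sum_k \sum_i \sum_j be k 0 i * be k 0 j * partial (fb i) (partial (fb j) h) y =
    \sum_i \sum_j Q y i j * partial (fb i) (partial (fb j) h) y.
  rewrite -(sum_col_second fb h y EM2); apply: eq_bigr => k _.
  by apply: eq_bigr => i _; apply: eq_bigr => j _; rewrite !mxE.
pose P := \sum_i drift x 0 i * partial i (u t) x.
pose Ry := \sum_i drift y 0 i * partial i (u t) y.
pose mud := \sum_i drift x 0 i * partial i m x.
have EAx : A (u t) x = SU + P by rewrite Aop_drift -sumU.
have EAy : A (u t) y = SW + Ry by rewrite Aop_drift -sumW.
have EAm : A m x = Sm + mud by rewrite Aop_drift -sumU.
have [S1 ES1 ES] := drift_diff fb B F x y.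
pose ZF := \sum_j (x 0 (fb j) - y 0 (fb j)) * (F x 0 j - F y 0 j).
have First : e * (2 * de * (P - Ry) + 2 * (S1 + ZF) * (ux * ux) + 2 * d * ux * P)
   - K * (2 * (S1 + ZF) * m x + d * mud) = 0.
  have := doubling_first_order (drift x) (drift y) su t0 d1 mxt.
  rewrite /doubled1 -/e -/ux -/de -/P -/Ry -/mud -/d.
  have -> : \sum_i 2 * (x 0 i - y 0 i) * (drift x 0 i - drift y 0 i) = 2 * (S1 + ZF).
    by rewrite -ES mulr_sumr; apply: eq_bigr => i _; rewrite mulrA.
  move=> <-; ring.
have Time : c * e * (de * de + d * (ux * ux)) <= e * (2 * de * (A (u t) x - A (u t) y)
       + 2 * d * ux * A (u t) x).
  by apply: (doubling_time su t0) => v hv; apply: mx => //; exact: ltW.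
pose G := K * m x - e * (ux * ux).
have G0 : 0 <= G by rewrite subr_ge0.
have crit j : 2 * G * (x 0 (fb j) - y 0 (fb j)) =
    2 * e * (de + d * ux) * gu 0 j - K * d * gm 0 j.
  have := doubling_first_order (delta_mx 0 (fb j)) 0 su t0 d1 mxt.
  have dl (c' : 'I_n -> R) : \sum_i (delta_mx 0 (fb j) : E) 0 i * c' i = c' (fb j).
    rewrite (bigD1 (fb j))//= !mxE !eqxx mul1r big1 ?addr0// => i /negbTE ni.
    by rewrite mxE ni andbF mul0r.
  rewrite /doubled1 (dl (fun i => partial i (u t) x)) (dl (fun i => partial i m x)).
  rewrite [\sum_i (0 : E) 0 i * _]big1; last by move=> i _; rewrite mxE mul0r.
  have -> : \sum_i 2 * (x 0 i - y 0 i) * ((delta_mx 0 (fb j) : E) 0 i - (0 : E) 0 i) =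
      2 * (x 0 (fb j) - y 0 (fb j)).
    rewrite -(dl (fun i => 2 * (x 0 i - y 0 i))); apply: eq_bigr => i _.
    by rewrite [(0 : E) 0 i]mxE subr0 mulrC.
  rewrite -/e -/ux -/de -/d /G /gu /gm !mxE.
  clearbody e d ux de; clear.
  move: (partial _ _ _) (partial _ _ _) (x 0 _ - y 0 _) (m x) => a1 a2 a3 a4 h; lra.
pose X := \sum_j (F x 0 j - F y 0 j) * gu 0 j.
pose X' := \sum_j (F x 0 j - F y 0 j) * gm 0 j.
have EZF : 2 * G * ZF = 2 * e * (de + d * ux) * X - K * d * X'.
  have gen (c1 c2 c3 : R) (zz ff g1 g2 : 'I_q -> R) :
      (forall j, c1 * zz j = c2 * g1 j - c3 * g2 j) ->
      c1 * (\sum_j zz j * ff j) = c2 * (\sum_j ff j * g1 j) - c3 * \sum_j ff j * g2 j.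
    move=> H; rewrite !mulr_sumr -sumrN -big_split; apply: eq_bigr => j _ /=.
    by rewrite mulrA H; ring.
  exact: gen crit.
have dle : d <= 1 := ltW d1.
have Eg : g = bf (Q x) gu gu.
  rewrite -(sum_sq_factor gu EM1); apply: eq_bigr => k _; congr (_ ^+ 2).
  by apply: eq_bigr => j _; rewrite !mxE.
have Egmu : gmu = Gam m m x.
  rewrite GamE -(sum_sq_factor gm EM1); apply: eq_bigr => k _; congr (_ ^+ 2).
  by apply: eq_bigr => j _; rewrite !mxE.
have [_ _ _ HAm HGm] := HCy x.
have g0 : 0 <= g by apply: sumr_ge0 => k _; exact: sqr_ge0.
have FX (v : 'rV[R]_q) : (\sum_j (F x 0 j - F y 0 j) * v 0 j) ^+ 2 <= C3 * d * bf (Q x) v v.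
  apply: le_trans (cauchy_schwarz _ _) _; rewrite mulr_suml.
  apply: (@le_trans _ _ (\sum_(j < q) CL * d * bf (Q x) v v)).
    by apply: ler_sum => j _; have [_] := HCL x y v dle; apply.
  by rewrite sumr_const card_ord -[(_ * _) *+ q]mulr_natl /C3 !mulrA.
have Z0 k : 0 <= Z k by apply: sumr_ge0 => i _; exact: sqr_ge0.
have sZ k : s k ^+ 2 <= d * Z k by exact: cauchy_schwarz.
have ZZ0 : 0 <= ZZ by apply: sumr_ge0.
have hZ' : ZZ <= (n * q)%:R * (q%:R ^+ 2 * CL) * d.
  apply: (@le_trans _ _ (\sum_k (n * q)%:R * \sum_j (M1 j k - M2 j k) ^+ 2)).
    apply: ler_sum => k _; have := sum_sq_emb fb (al k - be k).
    have -> : \sum_j (al k - be k) 0 j ^+ 2 = \sum_j (M1 j k - M2 j k) ^+ 2.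
      by apply: eq_bigr => j _; rewrite !mxE.
    apply: le_trans; rewrite le_eqVlt; apply/orP; left; apply/eqP.
    apply: eq_bigr => i _; congr (_ ^+ 2); rewrite !emb_coord -sumrN -big_split.
    by apply: eq_bigr => j _ /=; rewrite !mxE mulrBl.
  rewrite -mulr_sumr -[X in _ <= X]mulrA; apply: ler_wpM2l => //.
  by rewrite -[X in _ <= X]mulrA.
have hZ : ZZ <= C1 * d by apply: le_trans hZ' _; rewrite ler_wpM2r// lerDl.
have hS1 : `|S1| <= C1 * d.
  apply: (@le_trans _ _ ((\sum_i \sum_j `|B i j|) * d)); last first.
    by rewrite ler_wpM2r// lerDr.
  rewrite ES1; apply: le_trans (ler_norm_sum _ _ _) _; rewrite mulr_suml.
  apply: ler_sum => i _; apply: le_trans (ler_norm_sum _ _ _) _; rewrite mulr_suml.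
  apply: ler_sum => j _; rewrite -mulrA normrM ler_wpM2l//.
  have := two_mul_le (x 0 j - y 0 j) (x 0 i - y 0 i); rewrite normrM gtr0_norm//.
  have := coord_sq_le_sqd x y i; have := coord_sq_le_sqd x y j; rewrite -/d.
  clear; move: `|_ * _| (_ ^+ 2) (_ ^+ 2) => w a1 a2; clearbody d; lra.
have hSP : `|8 * ux * SP| <= d * g + 16 * (ux * ux) * ZZ.
  rewrite /SP /g /ZZ !mulr_sumr -big_split; apply: le_trans (ler_norm_sum _ _ _) _.
  apply: ler_sum => k _; apply: amgm_le; first by rewrite mulr_ge0// sqr_ge0.
    by rewrite mulr_ge0// mulr_ge0// -expr2 sqr_ge0.
  have -> : (8 * ux * (s k * p k)) ^+ 2 = 64 * (ux * ux) * p k ^+ 2 * s k ^+ 2 by ring.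
  have -> : 4 * (d * p k ^+ 2) * (16 * (ux * ux) * Z k) =
    64 * (ux * ux) * p k ^+ 2 * (d * Z k) by ring.
  apply: ler_wpM2l => //; apply: mulr_ge0; last exact: sqr_ge0.
  by apply: mulr_ge0 => //; rewrite -expr2 sqr_ge0.
have hSM : `|SM| <= C2 * d * m x.
  have h : SM ^+ 2 <= C1 * Cy * (d * m x) ^+ 2.
    apply: le_trans (cauchy_schwarz _ _) _.
    have h1 : \sum_k s k ^+ 2 <= d * ZZ by rewrite /ZZ mulr_sumr; exact: ler_sum.
    have h2 : d * ZZ <= d * (C1 * d) by rewrite ler_wpM2l.
    have -> : C1 * Cy * (d * m x) ^+ 2 = d * (C1 * d) * (Cy * m x ^+ 2) by ring.
    apply: ler_pM; rewrite ?(le_trans h1 h2)//.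
    + by apply: sumr_ge0 => k _; exact: sqr_ge0.
    + by apply: sumr_ge0 => k _; exact: sqr_ge0.
    + by rewrite -/gmu Egmu.
  have := sq_le_lin c1y (mulr_ge0 d0 (ltW m0)) h; rewrite -mulrA.
  move=> h1; apply: le_trans h1 _; exact: ler_wpM2r (mulr_ge0 d0 (ltW m0)) _ _ C2a.
have hX' : `|X'| <= C2 * m x.
  have h : X' ^+ 2 <= C3 * Cy * m x ^+ 2.
    apply: le_trans (FX gm) _; rewrite -GamE -mulrA -[C3 * Cy * _]mulrA ler_wpM2l//.
    by apply: le_trans HGm; rewrite ler_piMl//; exact: (Gam_ge0 fb reg).
  have h1 := sq_le_lin c3y (ltW m0) h.
  by apply: le_trans h1 _; exact: ler_wpM2r (ltW m0) _ _ C2b.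
have hAm' : A m x <= C2 * m x.
  apply: le_trans (ler_norm _) _; apply: le_trans HAm _.
  exact: ler_wpM2r (ltW m0) _ _ C2c.
apply: (@doubling_algebra R C1 C2 C3 c e K d ux de (m x) ZZ S1 SP SM (A m x) G X X' g) => //.
- by rewrite d0 dle.
- exact: ltW.
- by rewrite Eg; exact: FX.
- rewrite -EZF; move: Second First Time; rewrite EAx EAy EAm.
  clearbody e d ux de g SP SM ZZ SU SW Sm P Ry mud ZF.
  by rewrite /G => h1 h2 h3; lra.
- by move: Y0; rewrite /doubling subr_gt0 -mulrA.
Qed.

End Doubling2.

Lemma pairing_continuous {X Y Z : topologicalType} (f : X -> Y) (g : X -> Z) :
  continuous f -> continuous g -> continuous (fun p => (f p, g p)).
Proof.
move=> cf cg p S [[A1 A2] [/= h1 h2] hS].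
have k1 : nbhs p (fun y => A1 (f y)) by exact: (cf p _ h1).
have k2 : nbhs p (fun y => A2 (g y)) by exact: (cg p _ h2).
have k : nbhs p (fun y => S (f y, g y)).
  by apply: filterS (filterI k1 k2) => y [y1 y2]; exact: (hS (f y, g y)).
exact: k.
Qed.

Section Lipschitz.
Context {R : realType} {n q : nat}.
Local Notation E := 'rV[R]_n.
Variables (fb : 'I_q -> 'I_n) (Q : E -> 'M[R]_q) (B : 'M[R]_n) (F : E -> 'rV[R]_q).
Hypothesis reg : regular_coefficients Q F.
Local Notation solves := (solves fb Q B F).
Local Notation m := (@Vinv2 R n).
Implicit Types (f : E -> R) (x y z a b : E) (t : R) (u : R -> E -> R).

Lemma sqd_shift x v : sqd x (v + x) = V v - 1.
Proof.
rewrite /V [RHS]addrAC subrr add0r; apply: eq_bigr => i _; rewrite !mxE; ring.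
Qed.

Lemma Vinv_near x y : sqd x y <= 1 -> Vinv y <= 4 * Vinv x.
Proof.
move=> d1; rewrite /Vinv -[4 * _]invf_div lef_pV2 ?posrE ?divr_gt0 ?V_gt0//.
have := V_le_sqd x y; have := V_ge1 y; lra.
Qed.

Lemma doubling_continuous c K f u (S : set (R * (E * E))) : solves f u ->
  (forall p, S p -> 0 <= p.1) ->
  {within S, continuous (fun p => doubling c K u p.1 p.2.1 (p.2.2 + p.2.1))}.
Proof.
move=> su S0.
have c1 : continuous (fst : R * (E * E) -> R) by move=> p; exact: cvg_fst.
have c2 : continuous (snd : R * (E * E) -> E * E) by move=> p; exact: cvg_snd.
have cx : continuous (fun p : R * (E * E) => p.2.1).
  by move=> p; apply: (@continuous_comp _ _ _ snd fst); [exact: c2|exact: cvg_fst].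
have cv : continuous (fun p : R * (E * E) => p.2.2).
  by move=> p; apply: (@continuous_comp _ _ _ snd snd); [exact: c2|exact: cvg_snd].
have cy : continuous (fun p : R * (E * E) => p.2.2 + p.2.1).
  by move=> p; exact: (cvgD (cv p) (cx p)).
have ux : {within S, continuous (fun p : R * (E * E) => u p.1 p.2.1)}.
  have cp : continuous (fun p : R * (E * E) => (p.1, p.2.1)) by exact: pairing_continuous.
  exact: (@continuous_within_map R (R * E)%type (R * (E * E))%type [set z : R * E | 0 <= z.1] S
    (fun p : R * (E * E) => (p.1, p.2.1)) (fun z : R * E => u z.1 z.2) cp S0 (so_continuous su)).
have uy : {within S, continuous (fun p : R * (E * E) => u p.1 (p.2.2 + p.2.1))}.
  have cp : continuous (fun p : R * (E * E) => (p.1, p.2.2 + p.2.1)) by exact: pairing_continuous.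
  exact: (@continuous_within_map R (R * E)%type (R * (E * E))%type [set z : R * E | 0 <= z.1] S
    (fun p : R * (E * E) => (p.1, p.2.2 + p.2.1)) (fun z : R * E => u z.1 z.2) cp S0 (so_continuous su)).
have cV : continuous (V : E -> R) by exact: classC_cont (classC_V 0).
have cm : continuous m by exact: classC_cont (@classC_Vinv2 R n).
have cVv : {within S, continuous (fun p : R * (E * E) => V p.2.2)}.
  apply: continuous_subspaceT => p.
  by apply: (@continuous_comp _ _ _ (fun p : R * (E * E) => p.2.2) V); [exact: cv|exact: cV].
have cmx : {within S, continuous (fun p : R * (E * E) => m p.2.1)}.
  apply: continuous_subspaceT => p.
  by apply: (@continuous_comp _ _ _ (fun p : R * (E * E) => p.2.1) m); [exact: cx|exact: cm].
have ce : {within S, continuous (fun p : R * (E * E) => expR (- c * p.1))}.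
  apply: continuous_subspaceT => p.
  by apply: (@continuous_comp _ _ _ fst (fun s => expR (- c * s))); [exact: c1|exact: exp_lin_continuous].
have d_cont : {within S, continuous (fun p : R * (E * E) => V p.2.2 - 1)}.
  by move=> p; exact: (cvgB (cVv p) (cvg_cst (1 : R))).
have de_cont : {within S, continuous (fun p : R * (E * E) => u p.1 p.2.1 - u p.1 (p.2.2 + p.2.1))}.
  by move=> p; exact: (cvgB (ux p) (uy p)).
rewrite (_ : (fun p => _) = fun p : R * (E * E) =>
  expR (- c * p.1) * ((u p.1 p.2.1 - u p.1 (p.2.2 + p.2.1)) * (u p.1 p.2.1 - u p.1 (p.2.2 + p.2.1))
     + (V p.2.2 - 1) * (u p.1 p.2.1 * u p.1 p.2.1)) - K * ((V p.2.2 - 1) * m p.2.1)); last first.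
  by apply/funext => p; rewrite /doubling sqd_shift.
move=> p; exact: (cvgB (cvgM (ce p) (cvgD (cvgM (de_cont p) (de_cont p))
  (cvgM (d_cont p) (cvgM (ux p) (ux p))))) (cvgM (cvg_cst K) (cvgM (d_cont p) (cmx p)))).
Qed.

(** If the estimate failed, the doubled function with c larger than the bound given
    by its interior maxima would have a positive maximum over the pairs at distance
    at most 1: at infinity the weights make it small. Since K is large, it is not
    positive at t = 0 nor at distance 1, so the maximum is interior. *)
Lemma weighted_lipschitz f u (k Lam L : R) : solves f u -> 0 < L -> 0 <= k -> 0 <= Lam ->
  (forall t x, 0 <= t <= L -> `|u t x| <= k * Vinv x) ->
  (forall x y, sqd x y <= 1 -> (f x - f y) ^+ 2 <= Lam * sqd x y * m x) ->
  exists2 K, 0 <= K & forall t x y, 0 <= t <= L -> sqd x y <= 1 ->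
    (u t x - u t y) ^+ 2 <= K * sqd x y * m x.
Proof.
move=> su L0 k0 Lam0 uk fLam.
have [S S0 HS] := doubling_max fb B reg.
(* As |u| <= k / V and V(x) <= 4 V(y), the increment is at most 5 k / V(x): this
   gives 25 k^2, and d u(x)^2 the last k^2. *)
pose c := S + 1; pose K := Lam + 26 * k ^+ 2.
have k2 : 0 <= k ^+ 2 := sqr_ge0 k.
have K0 : 0 <= K by rewrite /K; lra.
have ux2 t x : 0 <= t <= L -> u t x * u t x <= k ^+ 2 * m x.
  move=> tL; rewrite -expr2 /Vinv2 -expr2 -exprMn -real_normK ?num_real//.
  by rewrite ler_pXn2r ?nnegrE ?mulr_ge0 ?(ltW (Vinv_gt0 _))// uk.
have de2 t x y : 0 <= t <= L -> sqd x y <= 1 ->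
    (u t x - u t y) * (u t x - u t y) <= 25 * k ^+ 2 * m x.
  move=> tL d1; have Vy := Vinv_near d1.
  have h : `|u t x - u t y| <= 5 * k * Vinv x.
    apply: le_trans (ler_normB _ _) _.
    have := uk t x tL; have := uk t y tL; have := ler_wpM2l k0 Vy; lra.
  rewrite -expr2 -real_normK ?num_real//.
  have -> : 25 * k ^+ 2 * m x = (5 * k * Vinv x) ^+ 2 by rewrite /Vinv2; ring.
  by rewrite ler_pXn2r ?nnegrE ?mulr_ge0 ?(ltW (Vinv_gt0 _)).
have e1 t : 0 <= t -> expR (- c * t) <= 1.
  move=> t0; rewrite -[X in _ <= X]expR0 ler_expR mulNr oppr_le0 mulr_ge0//.
  by rewrite /c; lra.
have num t x y : 0 <= t <= L -> sqd x y <= 1 ->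
    expR (- c * t) * ((u t x - u t y) * (u t x - u t y) + sqd x y * (u t x * u t x))
    <= 26 * k ^+ 2 * m x.
  move=> tL d1; have h1 := de2 t x y tL d1; have h2 := ux2 t x tL.
  have d0 := sqd_ge0 x y; have m0 := Vinv2_gt0 x.
  have uu : 0 <= u t x * u t x by rewrite -expr2 sqr_ge0.
  have h3 : sqd x y * (u t x * u t x) <= u t x * u t x by rewrite ler_piMl.
  apply: (@le_trans _ _ ((u t x - u t y) * (u t x - u t y) + sqd x y * (u t x * u t x))).
    rewrite ler_piMl ?e1//; last by case/andP: tL.
    by apply: addr_ge0; [rewrite -expr2 sqr_ge0|exact: mulr_ge0].
  lra.
have main t x y : 0 <= t <= L -> sqd x y <= 1 -> doubling c K u t x y <= 0.
  move=> t1L d1; rewrite leNgt; apply/negP => Y1.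
  set Y := doubling c K u t x y in Y1.
  pose M := V x + 26 * k ^+ 2 / Y.
  have kY : 0 <= 26 * k ^+ 2 / Y by rewrite divr_ge0// ?(ltW Y1)//; lra.
  pose KK := `[0, L]%classic `*` ([set x : E | V x <= M] `*` [set v : E | V v <= 2]).
  have cKK : compact KK.
    by apply: compact_setX; [exact: segment_compact|apply: compact_setX; exact: compact_sublevel].
  have KK0 p : KK p -> 0 <= p.1.
    by case: p => s [a b] [/=]; rewrite in_itv /= => /andP[].
  have cG := doubling_continuous (c := c) (K := K) su KK0.
  have inKK : KK (t, (x, y - x)).
    split=> /=; first by rewrite in_itv.
    split=> /=; first by rewrite lerDl.
    by have := sqd_shift x (y - x); rewrite subrK => h; move: d1; rewrite h; lra.
  have [[t0 [x0 v0]] pKK Gmax] := compact_EVT_max (ex_intro _ _ inKK) cKK cG.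
  move: pKK; rewrite inE => -[/=]; rewrite in_itv /= => t0L [x0M v02].
  pose y0 := v0 + x0.
  have Ymax s x' y' : 0 <= s <= L -> sqd x' y' <= 1 ->
      doubling c K u s x' y' <= doubling c K u t0 x0 y0.
    move=> sL d'; have Yle : Y <= doubling c K u t0 x0 y0.
      by have := Gmax (t, (x, y - x)); rewrite inE => /(_ inKK); rewrite /= subrK.
    have [x'M|x'M] := leP (V x') M.
      have := Gmax (s, (x', y' - x')); rewrite inE /= subrK; apply.
      split=> /=; first by rewrite in_itv.
      split=> //=; have := sqd_shift x' (y' - x'); rewrite subrK => h.
      by move: d'; rewrite h; lra.
    apply: le_trans Yle.
    have h1 : 26 * k ^+ 2 * m x' <= Y.
      have V0 := V_gt0 x'.
      have h2 : 26 * k ^+ 2 / Y <= V x' by apply: ltW (le_lt_trans _ x'M); rewrite /M lerDr (ltW (V_gt0 x)).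
      have h3 : 26 * k ^+ 2 <= Y * V x' by move: h2; rewrite ler_pdivrMr// [V x' * _]mulrC.
      apply: (@le_trans _ _ (26 * k ^+ 2 * Vinv x')).
        rewrite ler_wpM2l//; first lra.
        by rewrite /Vinv2 ler_piMl ?Vinv_le1// (ltW (Vinv_gt0 _)).
      by rewrite /Vinv ler_pdivrMr.
    apply: le_trans h1; rewrite /doubling.
    have := num s x' y' sL d'.
    have : 0 <= K * (sqd x' y' * m x') by exact: mulr_ge0 K0 (mulr_ge0 (sqd_ge0 _ _) (ltW (Vinv2_gt0 _))).
    lra.
  have d0le : sqd x0 y0 <= 1 by rewrite sqd_shift; lra.
  have Y0 : 0 < doubling c K u t0 x0 y0 by apply: lt_le_trans Y1 (Ymax _ _ _ t1L d1).
  have m0 := Vinv2_gt0 x0.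
  have t0p : 0 < t0.
    rewrite lt_neqAle (andP t0L).1 andbT eq_sym; apply/eqP => t00.
    move: Y0; rewrite t00 /doubling mulr0 expR0 mul1r !(so_init su).
    have := fLam x0 y0 d0le; rewrite expr2.
    have := ux2 0 x0; rewrite lexx (ltW L0) !(so_init su) => /(_ isT) h1 h2.
    have h3 : sqd x0 y0 * (f x0 * f x0) <= sqd x0 y0 * (k ^+ 2 * m x0).
      by rewrite ler_wpM2l// sqd_ge0.
    have h4 : 0 <= sqd x0 y0 * (k ^+ 2 * m x0) by exact: mulr_ge0 (sqd_ge0 _ _) (mulr_ge0 k2 (ltW m0)).
    rewrite /K; lra.
  have d0lt : sqd x0 y0 < 1.
    rewrite lt_neqAle d0le andbT; apply/eqP => dE.
    move: Y0; rewrite /doubling dE; have := num t0 x0 y0 t0L d0le; rewrite dE.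
    have := mulr_ge0 Lam0 (ltW m0); rewrite /K; lra.
  have uK : expR (- c * t0) * (u t0 x0 * u t0 x0) <= K * m x0.
    apply: (@le_trans _ _ (u t0 x0 * u t0 x0)).
      by rewrite ler_piMl ?e1 ?(ltW t0p)// -expr2 sqr_ge0.
    apply: le_trans (ux2 _ _ t0L) _; apply: ler_wpM2r (ltW m0) _ _ _.
    by rewrite /K; lra.
  have := HS c K f u t0 x0 y0 su t0p d0lt K0 uK Y0.
  have mx s x' y' : 0 <= s <= t0 -> sqd x' y' <= 1 ->
      doubling c K u s x' y' <= doubling c K u t0 x0 y0.
    move=> /andP[s0 st]; apply: Ymax; rewrite s0 (le_trans st)//.
    by case/andP: t0L.
  by move=> /(_ mx); rewrite /c; lra.
exists (K * expR (c * L)); first by rewrite mulr_ge0 ?expR_ge0.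
move=> t x y tL d1; have := main t x y tL d1; rewrite /doubling.
set e := expR (- c * t) => h.
have e0 : 0 < e := expR_gt0 _.
have h1 : e * (u t x - u t y) ^+ 2 <= K * (sqd x y * m x).
  have : 0 <= e * (sqd x y * (u t x * u t x)).
    have uu : 0 <= u t x * u t x by rewrite -expr2 sqr_ge0.
    exact: mulr_ge0 (ltW e0) (mulr_ge0 (sqd_ge0 _ _) uu).
  by rewrite expr2; lra.
have dm : 0 <= K * (sqd x y * m x) by exact: mulr_ge0 K0 (mulr_ge0 (sqd_ge0 _ _) (ltW (Vinv2_gt0 _))).
rewrite -ler_pdivlMl// in h1; apply: le_trans h1 _.
have -> : e^-1 = expR (c * t) by rewrite /e mulNr expRN invrK.
have -> : K * expR (c * L) * sqd x y * m x = expR (c * L) * (K * (sqd x y * m x)) by ring.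
rewrite ler_wpM2r// ler_expR ler_wpM2l//; last by case/andP: tL.
by rewrite /c; lra.
Qed.

Lemma gradient_of_lipschitz (h : E -> R) (K : R) i x : 0 <= K -> classC 1 h ->
  (forall y, sqd x y <= 1 -> (h x - h y) ^+ 2 <= K * sqd x y * m x) ->
  partial i h x ^+ 2 <= K * m x.
Proof.
move=> K0 Ch H; have m0 := Vinv2_gt0 x.
have Km : 0 <= K * m x by rewrite mulr_ge0// ltW.
pose kr := Num.sqrt (K * m x).
have kr0 : 0 <= kr := sqrtr_ge0 _.
have kr2 : kr ^+ 2 = K * m x by rewrite sqr_sqrtr.
have D := proj1 (lineE _ _ _ _) (classC_derive x i Ch).
suff P : `|partial i h x| <= kr.
  by rewrite -kr2 -real_normK ?num_real// ler_pXn2r ?nnegrE.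
apply: (@le_add_eps _ _ _ 1) => // e e0; rewrite mulr1.
have [h0 h00 Hh] := is_derive_eps D e0.
have [s [s0 sh /ltW s1]] := small_pos h00 (@ltr01 R).
have := Hh s; rewrite gtr0_norm// => /(_ sh); rewrite add0r scale0r add0r.
have Es : sqd x (s *: delta_mx 0 i + x) = s ^+ 2.
  rewrite sqd_shift /V addrAC subrr add0r (bigD1 i)//= !mxE !eqxx mulr1 big1 ?addr0// => j /negbTE ji.
  by rewrite !mxE ji andbF mulr0 expr0n.
have hs : `|h (s *: delta_mx 0 i + x) - h x| <= kr * s.
  have := H (s *: delta_mx 0 i + x); rewrite Es expr_le1 ?(ltW s0)// => /(_ s1).
  rewrite mulrAC -kr2 -exprMn -sqrrN opprB => h1.
  by rewrite -ler_sqr ?nnegrE ?mulr_ge0 ?(ltW s0)// real_normK ?num_real.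
set w := h _ in hs *; move=> h2.
have : `|partial i h x * s| <= kr * s + e * s.
  have -> : partial i h x * s = (w - h x) - (w - h x - partial i h x * s) by ring.
  by apply: le_trans (ler_normB _ _) _; apply: lerD.
by rewrite normrM (gtr0_norm s0) -mulrDl ler_pM2r.
Qed.

End Lipschitz.

(** * The semigroup and its generator *)

Section LocallyUniform.
Context {R : realType} {n : nat}.
Local Notation E := 'rV[R]_n.
Implicit Types (f g h : E -> R) (x : E).

Lemma bounded_fun_abs f : bounded_fun f <-> exists M : R, forall x, `|f x| <= M.
Proof.
split=> [[M [_ HM]]|[M HM]].
  by exists (M + 1) => x; apply: (HM (M + 1)) => //; rewrite ltrDl.
by exists M; split=> [|c Mc x _ /=]; [exact: num_real|exact: le_trans (HM x) (ltW Mc)].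
Qed.

Lemma cvg_taucP (G : set_system (E -> R)) f : Filter G ->
  cvg_tauc G f <-> forall M e, 0 < e ->
    G [set h | forall x, V x <= M -> `|h x - f x| <= e].
Proof.
move=> FG; split=> [/fam_cvgP H M e e0|H].
  apply: (H _ (@compact_sublevel R n M)); apply/uniform_nbhs.
  exists [set z : R * R | ball z.1 e z.2]; split; first by rewrite -entourage_ballE; exists e.
  move=> h /= Hh x xM; have := Hh x xM; rewrite /ball /= distrC => k; exact: ltW.
apply/fam_cvgP => K cK P /uniform_nbhs[S [entS HS]].
have [M _ KM] := compact_V_bounded cK.
move: entS; rewrite -entourage_ballE => -[e /= e0 eS].
have e20 : 0 < e / 2 by rewrite divr_gt0.
apply: (filterS _ (H M _ e20)) => h /= Hh; apply: HS => x Kx; apply: eS.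
rewrite /= /ball /= distrC; apply: le_lt_trans (Hh x (KM x Kx)) _.
by rewrite ltr_pdivrMr// ltr_pMr// ltr1n.
Qed.

Lemma abs_le_supnorm f x : (`|f x|%:E <= supnorm f)%E.
Proof. by apply: ereal_sup_ubound; exists x. Qed.

Lemma supnorm_le f (k : R) : (forall x, `|f x| <= k) -> (supnorm f <= k%:E)%E.
Proof. by move=> H; apply: ge_ereal_sup => _ [x _ <-]; rewrite lee_fin. Qed.

Lemma supnorm_ge0 f : (0 <= supnorm f)%E.
Proof. by apply: le_trans (abs_le_supnorm f 0); rewrite lee_fin. Qed.

Lemma ereal_sup_ltP (S : set \bar R) :
  (ereal_sup S < +oo)%E <-> exists C : R, forall y, S y -> (y <= C%:E)%E.
Proof.
split=> [|[C HC]]; last by apply: le_lt_trans (ltry C); apply: ge_ereal_sup.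
have := @ereal_sup_ubound _ S; case: (ereal_sup S) => [c H _|//|H _].
  by exists c.
by exists 0 => y /H /le_trans; apply; exact: leNye.
Qed.

End LocallyUniform.

Section GeneratorBounds.
Context {R : realType} {n : nat}.
Local Notation E := 'rV[R]_n.
Variable T : R -> (E -> R) -> (E -> R).
Implicit Types (f g h : E -> R) (x : E) (t : R).

(** The definition of the generator with the topology and the extended reals
    spelled out as estimates. *)
Record generates f g : Prop := {
  ge_Cb : Cb f;
  ge_Cb' : Cb g;
  ge_local : forall M e, 0 < e -> exists2 d, 0 < d &
    forall t x, 0 < t < d -> V x <= M -> `|T t f x - f x - t * g x| <= e * t;
  ge_bound : exists2 C, 0 <= C &
    forall t x, 0 < t <= 1 -> `|T t f x - f x| <= C * t }.

Lemma is_genP f g : is_gen T f g <-> forall M e, 0 < e -> exists2 d, 0 < d &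
    forall t x, 0 < t < d -> V x <= M -> `|T t f x - f x - t * g x| <= e * t.
Proof.
rewrite /is_gen; split=> [/cvg_taucP H M e e0|H].
  have [d /= d0 Hd] := H M e e0; exists d => // t x /andP[t0 td] xM.
  have := Hd t; rewrite /= sub0r normrN gtr0_norm// => /(_ td t0 x xM).
  rewrite /diff_quotient => k; have -> : T t f x - f x - t * g x = ((T t f x - f x) / t - g x) * t.
    by field; rewrite gt_eqF.
  by rewrite normrM (gtr0_norm t0) ler_wpM2r// (ltW t0).
apply/cvg_taucP => M e e0; have [d d0 Hd] := H M e e0.
exists d => //= t; rewrite /= sub0r normrN => td t0 x xM.
rewrite (gtr0_norm t0) in td; have := Hd t x; rewrite t0 td => /(_ isT xM).
rewrite /diff_quotient; have -> : T t f x - f x - t * g x = ((T t f x - f x) / t - g x) * t.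
  by field; rewrite gt_eqF.
by rewrite normrM (gtr0_norm t0) ler_pM2r.
Qed.

Lemma gen_domainP f : gen_domain T f <-> exists g, generates f g.
Proof.
split=> [[Cf [g [Cg /is_genP Hg]] /ereal_sup_ltP[C HC]]|[g [Cf Cg Hg [C C0 HC]]]].
  exists g; split=> //; exists `|C| => // t x t01; have /andP[t0 t1] := t01.
  have h1 : (`|T t f x - f x|%:E * (t^-1)%:E <= C%:E)%E.
    apply: (@le_trans _ _ (supnorm (fun x => (T t f x - f x)%R) * (t^-1)%:E)%E).
      apply: lee_wpmul2r; first by rewrite lee_fin invr_ge0 ltW.
      exact: (abs_le_supnorm (fun x => T t f x - f x)).
    by apply: HC; exists t => //=; rewrite in_itv /= t0.
  rewrite -EFinM lee_fin ler_pdivrMr// in h1; apply: le_trans h1 _.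
  by rewrite ler_wpM2r ?ler_norm ?(ltW t0).
split=> //; first by exists g; split=> //; apply/is_genP.
apply/ereal_sup_ltP; exists C => y [t /=]; rewrite in_itv /= => /andP[t0 t1] <- {y}.
apply: (@le_trans _ _ ((C * t)%:E * (t^-1)%:E)%E).
  apply: lee_wpmul2r; first by rewrite lee_fin invr_ge0 ltW.
  by apply: supnorm_le => x; apply: HC; rewrite t0.
by rewrite -EFinM lee_fin -mulrA divff ?gt_eqF// mulr1.
Qed.

Lemma is_gen_uniq f g h : is_gen T f g -> is_gen T f h -> g = h.
Proof.
move=> /is_genP Hg /is_genP Hh; apply/funext => x; apply/eqP.
rewrite -subr_eq0 -normr_le0; apply: (@le_add_eps _ _ _ 2) => // e e0.
have [d1 d10 H1] := Hg (V x) e e0; have [d2 d20 H2] := Hh (V x) e e0.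
have [t [t0 t1 t2]] := small_pos d10 d20.
have := H1 t x; rewrite t0 t1 lexx => /(_ isT isT) k1.
have := H2 t x; rewrite t0 t2 lexx => /(_ isT isT) k2.
rewrite add0r -(ler_pM2r t0) -{1}(gtr0_norm t0) -normrM.
have -> : (g x - h x) * t = (T t f x - f x - t * h x) - (T t f x - f x - t * g x) by ring.
apply: le_trans (ler_normB _ _) _; lra.
Qed.

Lemma generates_gen f g : generates f g -> gen T f = g.
Proof.
case=> _ _ /is_genP Hg _; apply: (is_gen_uniq _ Hg); rewrite /gen.
by apply: xgetPex; exists g.
Qed.

End GeneratorBounds.

Section Semigroup.
Context {R : realType} {n q : nat}.
Local Notation E := 'rV[R]_n.
Variables (fb : 'I_q -> 'I_n) (Q : E -> 'M[R]_q) (B : 'M[R]_n) (F : E -> 'rV[R]_q).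
Hypothesis reg : regular_coefficients Q F.
Local Notation solves := (solves fb Q B F).
Local Notation A := (Aop fb Q B F).
Implicit Types (f g h : E -> R) (x y : E) (t s : R) (u : R -> E -> R).

Lemma Cb_lin (c : R) f g : Cb f -> Cb g -> Cb (fun x => c * f x + g x).
Proof.
move=> [cf /bounded_fun_abs[M HM]] [cg /bounded_fun_abs[K HK]]; split.
  by move=> x; exact: (cvgD (cvgM (cvg_cst c) (cf x)) (cg x)).
apply/bounded_fun_abs; exists (`|c| * M + K) => x.
apply: le_trans (ler_normD _ _) _; rewrite normrM lerD//.
by rewrite ler_wpM2l.
Qed.

Lemma Cb_scale (c : R) f : Cb f -> Cb (fun x => c * f x).
Proof.
move=> Cf; have := Cb_lin (c - 1) Cf Cf.
have -> // : (fun x => (c - 1) * f x + f x) = fun x => c * f x.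
by apply/funext => x; ring.
Qed.

Lemma shift_quotient (g : R -> R) s t :
  (fun k : R => k^-1 *: (((fun t => g (t + s)) \o shift t) (k *: (1 : R)) - g (t + s))) =
  (fun k : R => k^-1 *: ((g \o shift (t + s)) (k *: (1 : R)) - g (t + s))).
Proof. by apply/funext => k /=; rewrite addrA. Qed.

Lemma derive_shift (g : R -> R) s t : 'D_1 (fun t => g (t + s)) t = 'D_1 g (t + s).
Proof. by rewrite /derive shift_quotient. Qed.

Lemma derivable_shift (g : R -> R) s t : derivable g (t + s) 1 ->
  derivable (fun t => g (t + s)) t 1.
Proof. by rewrite /derivable shift_quotient. Qed.

Lemma solves_shift f u s : 0 <= s -> solves f u ->
  solves (u s) (fun t => u (t + s)).
Proof.
move=> s0 su.
have pos t : 0 < t -> 0 < t + s by move=> t0; rewrite ltr_wpDr.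
pose sh (z : R * E) : R * E := (z.1 + s, z.2).
have csh : continuous sh.
  apply: pairing_continuous => z; last exact: cvg_snd.
  exact: (cvgD cvg_fst (cvg_cst s)).
have C (G : R * E -> R) : {in [set z : R * E | 0 < z.1], continuous G} ->
    {in [set z : R * E | 0 < z.1], continuous (fun z => G (sh z))}.
  move=> cG z; rewrite inE /= => z0.
  apply: (@continuous_comp _ _ _ sh G); first exact: csh.
  by apply: cG; rewrite inE /=; exact: pos.
split.
- move=> t x /pos t0; apply: (@derivable_shift (u^~ x)); exact: so_t_derivable su _ _ t0.
- have := C _ (so_t_continuous su); rewrite /sh /=.
  have -> // : (fun z : R * E => 'D_1 (u^~ z.2) (z.1 + s)) =
    fun z : R * E => 'D_1 ((fun t => u (t + s))^~ z.2) z.1.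
  by apply/funext => z; rewrite -(derive_shift (u^~ z.2)).
- move=> t x i /pos t0; exact: so_x_derivable su _ _ _ t0.
- move=> i; exact: C _ (so_x_continuous su i).
- move=> t x i j /pos t0; exact: so_xx_derivable su _ _ _ _ t0.
- move=> i j; exact: C _ (so_xx_continuous su i j).
- apply: (@continuous_within_map R (R * E)%type (R * E)%type [set z : R * E | 0 <= z.1] _
    sh (fun z : R * E => u z.1 z.2) csh _ (so_continuous su)).
  by move=> z /= z0; exact: addr_ge0.
- move=> T0 T00; have [|M HM] := so_bounded su (T0 + s); first exact: pos.
  exists M => t x /andP[t0 tT]; apply: HM.
  by rewrite addr_ge0//= lerD2r.
- move=> t x t0; rewrite (derive_shift (u^~ x)); exact: so_eq su _ _ (pos _ t0).
- by move=> x; rewrite add0r.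
Qed.

(** Mass does not escape to infinity in bounded time: what an initial value does
    where V is large is felt only through the weight V, whose growth the
    Lyapunov estimate controls. *)
Lemma solution_tight : exists2 c, 0 <= c & forall f u (e H M : R), solves f u ->
  0 < M -> 0 <= H -> 0 <= e -> (forall x, `|f x| <= H) ->
  (forall x, V x <= M -> `|f x| <= e) ->
  forall t x, 0 <= t -> `|u t x| <= e + H / M * (expR (c * t) * V x).
Proof.
have [c c0 Hc] := Lyapunov fb B reg.
exists c => // f u e H M su M0 H0 e0 fH fe t x t0.
have HM : 0 <= H / M by rewrite divr_ge0// ltW.
apply: (solution_abs_le_weight reg su (classC_V 2) c0 _ _ HM _ _ t0).
- by move=> y; rewrite ltW// V_gt0.
- by move=> y; have [h _ _ _ _] := Hc y; apply: le_trans h; exact: ler_norm.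
move=> y; have Vy := V_gt0 y; have [yM|yM] := leP (V y) M.
  apply: le_trans (fe y yM) _; rewrite lerDl mulr_ge0// ltW//.
apply: le_trans (fH y) _; apply: (@le_trans _ _ (H / M * V y)); last by rewrite lerDr.
by rewrite mulrAC ler_pdivlMr// ler_wpM2l// ltW.
Qed.

Variable T : R -> (E -> R) -> E -> R.
Hypothesis hT : forall f, Cb f -> solves f (T^~ f) /\
  forall u, solves f u -> forall t x, 0 <= t -> u t x = T t f x.

Lemma T_solves f : Cb f -> solves f (T^~ f). Proof. by move=> /hT[]. Qed.

Lemma T0 f : Cb f -> T 0 f = f.
Proof. by move=> /T_solves su; apply/funext => x; rewrite (so_init su). Qed.

Lemma T_abs_le f (M : R) t x : Cb f -> (forall x, `|f x| <= M) -> 0 <= t ->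
  `|T t f x| <= M.
Proof. move=> /T_solves su fM; exact: (solution_bound reg su fM). Qed.

Lemma T_Cb f t : Cb f -> 0 <= t -> Cb (T t f).
Proof.
move=> Cf; rewrite le_eqVlt => /predU1P[<-|t0]; first by rewrite T0.
split; first exact: classC_cont (solves_classC2 (T_solves Cf) t0).
have [cf /bounded_fun_abs[M HM]] := Cf.
by apply/bounded_fun_abs; exists M => x; apply: T_abs_le => //; exact: ltW.
Qed.

Lemma T_lin (c : R) f g t x : Cb f -> Cb g -> 0 <= t ->
  T t (fun x => c * f x + g x) x = c * T t f x + T t g x.
Proof.
move=> Cf Cg t0; have [_ H] := hT (Cb_lin c Cf Cg).
by rewrite -(H _ (solves_lin c (T_solves Cf) (T_solves Cg)))//.
Qed.

Lemma T_scale (c : R) f t x : Cb f -> 0 <= t ->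
  T t (fun x => c * f x) x = c * T t f x.
Proof.
move=> Cf t0; have := T_lin (c - 1) x Cf Cf t0.
have -> : (fun x => (c - 1) * f x + f x) = fun x => c * f x.
  by apply/funext => y; ring.
by move=> ->; ring.
Qed.

Lemma T_add f t s : Cb f -> 0 <= t -> 0 <= s -> T (t + s) f = T t (T s f).
Proof.
move=> Cf t0 s0; have [_ H] := hT (T_Cb Cf s0); apply/funext => x.
by rewrite -(H _ (solves_shift s0 (T_solves Cf))).
Qed.

(** Right difference quotients of T(t) f at t are T(t) applied to those at 0. The
    latter converge locally uniformly and boundedly, so by tightness the former
    converge too; the two-sided derivative exists because T(t) f is a solution. *)
Lemma generates_derive f g t x : generates T f g -> 0 < t ->
  is_derive t 1 (fun t => T t f x) (T t g x).
Proof.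
case=> Cf Cg loc [C C0 HC] t0.
have [c c0 tight] := solution_tight.
have [_ /bounded_fun_abs[Mg HMg]] := Cg.
have Mg0 : 0 <= Mg by apply: le_trans (HMg 0).
have D := solves_dt x (T_solves Cf) t0.
suff <- : A (T t f) x = T t g x by [].
apply/eqP; rewrite -subr_eq0 -normr_le0.
apply: (@le_add_eps _ _ _ 3) => // e e0; rewrite add0r.
pose W := expR (c * t) * V x; have W0 : 0 < W by rewrite mulr_gt0 ?expR_gt0 ?V_gt0.
pose H := C + Mg; have H0 : 0 <= H by exact: addr_ge0.
pose M := (H + 1) * W / e.
have H1 : 0 < H + 1 by exact: ltr_wpDl.
have M0 : 0 < M := divr_gt0 (mulr_gt0 H1 W0) e0.
have HM : H / M * W <= e.
  have -> : H / M * W = e * (H / (H + 1)).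
    by rewrite /M; field; rewrite !gt_eqF.
  by rewrite ler_piMr ?(ltW e0)// ler_pdivrMr; lra.
have [d1 d10 Hd1] := is_derive_eps D e0.
have [d2 d20 Hd2] := loc M e e0.
have [d3 [d30 d31 d32]] := small_pos d10 d20.
have [k [k0 kd3 /ltW k3]] := small_pos d30 (@ltr01 R).
have [k1 k2] := (lt_trans kd3 d31, lt_trans kd3 d32).
have Cd : Cb (fun y => -1 * f y + T k f y).
  by apply: Cb_lin => //; apply: T_Cb => //; exact: ltW.
have Cq := Cb_scale k^-1 Cd.
pose r y := -1 * g y + k^-1 * (-1 * f y + T k f y).
have Cr : Cb r by exact: Cb_lin.
have rE y : r y * k = T k f y - f y - k * g y.
  by rewrite /r; field; rewrite gt_eqF.
have Tr : T t r x = -1 * T t g x + k^-1 * (-1 * T t f x + T (t + k) f x).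
  rewrite /r (T_lin _ _ Cg Cq (ltW t0)) (T_scale _ _ Cd (ltW t0)).
  rewrite (T_lin _ _ Cf (T_Cb Cf (ltW k0)) (ltW t0)).
  by rewrite (T_add Cf (ltW t0) (ltW k0)).
have rM y : V y <= M -> `|r y| <= e.
  move=> yM; have := Hd2 k y; rewrite k0 k2 -rE => /(_ isT yM).
  by rewrite normrM (gtr0_norm k0) ler_pM2r.
have rH y : `|r y| <= H.
  rewrite -(ler_pM2r k0) -{1}(gtr0_norm k0) -normrM rE.
  have := HC k y; rewrite k0 k3 => /(_ isT) h1.
  have h2 : `|k * g y| <= Mg * k by rewrite normrM (gtr0_norm k0) mulrC ler_pM2r.
  by apply: le_trans (ler_normB _ _) _; rewrite /H; lra.
have := tight r (T^~ r) e H M (T_solves Cr) M0 H0 (ltW e0) rH rM t x (ltW t0).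
rewrite -/W Tr => h1.
have := Hd1 k; rewrite gtr0_norm// => /(_ k1) h2.
rewrite -(ler_pM2r k0) -{1}(gtr0_norm k0) -normrM.
have h3 : `|(-1 * T t g x + k^-1 * (-1 * T t f x + T (t + k) f x)) * k| <= 2 * e * k.
  by rewrite normrM (gtr0_norm k0) ler_pM2r//; lra.
have -> : (A (T t f) x - T t g x) * k =
  (-1 * T t g x + k^-1 * (-1 * T t f x + T (t + k) f x)) * k
  - (T (t + k) f x - T t f x - A (T t f) x * k).
  by field; rewrite gt_eqF.
apply: le_trans (ler_normB _ _) _; lra.
Qed.

End Semigroup.

(** * Limits of smooth functions belong to the domain *)

Section UniformContinuity.
Context {R : realType} {n : nat}.
Local Notation E := 'rV[R]_n.

(** Heine's theorem, with the second point outside the compact set. *)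
Lemma compact_uniform (X : pseudoMetricType R) (K : set X) (G : X -> R) :
  compact K -> (forall x, K x -> {for x, continuous G}) -> forall e, 0 < e ->
  exists2 d, 0 < d & forall x y, K x -> ball x d y -> `|G x - G y| <= e.
Proof.
move=> /compact_near_coveringP cK cG e e0.
have e2 : 0 < e / 2 by rewrite divr_gt0.
have [|d /= d0 Hd] := cK R (0^'+) (fun d x => forall y, ball x d y -> `|G x - G y| <= e) _.
  move=> x0 Kx0; have k : nbhs x0 (fun z => `|G x0 - G z| < e / 2).
    by exact: (cG x0 Kx0 _ (nbhsx_ballx (G x0) _ e2)).
  have [d /= d0 Hd] := proj1 (nbhs_ballP _ _) k.
  have d20 : 0 < d / 2 by rewrite divr_gt0.
  exists (ball x0 (d / 2), [set i | 0 < i < d / 2]) => /=.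
    split; first exact: nbhsx_ballx.
    exists (d / 2) => //= i; rewrite /= sub0r normrN => id i0.
    by rewrite i0 -(gtr0_norm i0).
  move=> [x i] /= [x0x /andP[i0 id]] y xy.
  have h1 : `|G x0 - G x| < e / 2.
    by apply: Hd; apply: le_ball x0x; lra.
  have h2 : `|G x0 - G y| < e / 2.
    apply: Hd; rewrite (splitr d); apply: ball_triangle x0x _.
    by apply: le_ball xy; exact: ltW.
  have -> : G x - G y = (G x0 - G y) - (G x0 - G x) by ring.
  by apply: le_trans (ler_normB _ _) _; lra.
exists (d / 2); first by rewrite divr_gt0.
move=> x y Kx; apply: Hd => //; first by rewrite /= sub0r normrN gtr0_norm ?divr_gt0//; lra.
by rewrite divr_gt0.
Qed.

Lemma sqd_ball (x y : E) (d : R) : 0 < d -> sqd x y <= (d / 2) ^+ 2 -> ball x d y.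
Proof.
move=> d0 h; have d2 : 0 <= d / 2 by lra.
rewrite -ball_normE /=; apply: (@le_lt_trans _ _ (d / 2)); last by lra.
apply: rV_norm_le => // i; rewrite !mxE.
rewrite -ler_sqr ?nnegrE// real_normK ?num_real//.
exact: le_trans (coord_sq_le_sqd x y i) h.
Qed.

Lemma sublevel_uniform (g : E -> R) (M e : R) : continuous g -> 0 < e ->
  exists2 d, 0 < d & forall x y, V x <= M -> sqd x y <= d -> `|g x - g y| <= e.
Proof.
move=> cg e0.
have [d d0 Hd] := compact_uniform (@compact_sublevel R n M) (fun x _ => cg x) e0.
exists ((d / 2) ^+ 2); first by rewrite exprn_gt0// divr_gt0.
by move=> x y xM xy; apply: Hd => //; exact: sqd_ball.
Qed.

End UniformContinuity.

Section ShortTime.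
Context {R : realType} {n q : nat}.
Local Notation E := 'rV[R]_n.
Variables (fb : 'I_q -> 'I_n) (Q : E -> 'M[R]_q) (B : 'M[R]_n) (F : E -> 'rV[R]_q).
Hypothesis reg : regular_coefficients Q F.
Local Notation solves := (solves fb Q B F).
Local Notation A := (Aop fb Q B F).
Implicit Types (f g h : E -> R) (x y : E) (t s : R) (u : R -> E -> R).

(** A smooth initial value h moves at speed at most a at the point x0, when
    A h <= a near x0: far away A h is only bounded, but this is paid for by a
    multiple of the squared distance to x0, which the operator increases at a
    bounded rate. *)
Lemma short_time_upper : exists C c : R, [/\ 0 <= C, 0 < c &
  forall h u (H k k' a eta : R) x0, solves h u -> classC 2 h ->
  (forall x, `|h x| <= H) -> (forall x, A h x <= k) -> 0 <= k' ->
  (forall x, sqd x x0 <= eta -> A h x <= a) -> k <= a + k' * eta ->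
  forall t, 0 <= t <= c ->
  u t x0 <= h x0 + (a * t + k' * (C * V x0 * t ^+ 2))].
Proof.
have [C0 C00 HC] := Aop_sqd_bound fb B reg.
(* The derivative of s + c s^2 absorbs the rate 3 C0 at which A increases the
   squared distance, as long as c s <= 1. *)
pose c := 3 * C0 + 1; have c0 : 0 < c by rewrite /c; lra.
exists (4 * C0), c^-1; split; [lra|by rewrite invr_gt0|].
move=> h u H k k' a eta x0 su Ch hH hk k'0 ha kae t tL.
pose b (s : R) y := h y + (a * s + k' * ((s + c * (s * s)) * sqd y x0 + 4 * C0 * V x0 * (s * s))).
have Cd := classC_sqd 2 x0.
pose bt (s : R) y := a + k' * ((1 + c * (2 * s)) * sqd y x0 + 4 * C0 * V x0 * (2 * s)).
have Cp s : classC 2 (fun y => (s + c * (s * s)) * sqd y x0) := classC_scale _ Cd.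
have Cq s := classC_add (Cp s) (classC_cst 2 (4 * C0 * V x0 * (s * s))).
have Ck s := classC_scale k' (Cq s).
have Cr s := classC_add (classC_cst 2 (a * s)) (Ck s).
have Cb s : classC 2 (b s) := classC_add Ch (Cr s).
have L0 : 0 < c^-1 by rewrite invr_gt0.
have hc : continuous h := classC_cont Ch.
have dc : continuous (sqd^~ x0 : E -> R) := classC_cont Cd.
have H0 : 0 <= H by apply: le_trans (hH x0).
have V0 := V_gt0 x0.
have := @solution_le_barrier R n q fb Q B F reg h u b bt c^-1 (H + `|a| * c^-1) su L0.
have -> : h x0 + (a * t + k' * (4 * C0 * V x0 * t ^+ 2)) = b t x0.
  by rewrite /b sqdxx; ring.
move=> Hb; apply: (Hb _ _ _ _ _ _ t x0 tL); clear Hb.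
- apply: continuous_subspaceT => z.
  have c1 : continuous (fst : R * E -> R) by move=> w; exact: cvg_fst.
  have ch : continuous (fun w : R * E => h w.2).
    by move=> w; apply: (@continuous_comp _ _ _ snd h); [exact: cvg_snd|exact: hc].
  have cd : continuous (fun w : R * E => sqd w.2 x0).
    move=> w; apply: (@continuous_comp _ _ _ snd (sqd^~ x0)); first exact: cvg_snd.
    exact: dc.
  have cs : continuous (fun w : R * E => w.1 * w.1) by move=> w; exact: (cvgM (c1 w) (c1 w)).
  have cp : continuous (fun w : R * E => w.1 + c * (w.1 * w.1)).
    by move=> w; exact: (cvgD (c1 w) (cvgM (cvg_cst c) (cs w))).
  have ca : continuous (fun w : R * E => a * w.1) by move=> w; exact: (cvgM (cvg_cst a) (c1 w)).
  have ce : continuous (fun w : R * E => 4 * C0 * V x0 * (w.1 * w.1)).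
    by move=> w; exact: (cvgM (cvg_cst (4 * C0 * V x0)) (cs w)).
  have cq : continuous (fun w : R * E => (w.1 + c * (w.1 * w.1)) * sqd w.2 x0).
    by move=> w; exact: (cvgM (cp w) (cd w)).
  exact: (cvgD (ch z) (cvgD (ca z) (cvgM (cvg_cst k') (cvgD (cq z) (ce z))))).
- by move=> s _; exact: Cb.
- move=> s y s0; have d1 : is_derive s 1 (fun s : R => s) 1 by exact: is_derive_id.
  have d2 := is_derive_mul d1 d1.
  have d3 := is_derive_scale (sqd y x0) (is_derive_add d1 (is_derive_scale c d2)).
  have d4 := is_derive_scale k' (is_derive_add d3 (is_derive_scale (4 * C0 * V x0) d2)).
  have d5 := is_derive_add (is_derive_scale a d1) d4.
  have d6 := is_derive_add (is_derive_cst (h y) s 1) d5.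
  rewrite /b (_ : (fun _ => _) = (fun s => cst (h y) s + (a * s +
     k' * (sqd y x0 * (s + c * (s * s)) + 4 * C0 * V x0 * (s * s))))); last first.
    by apply/funext => r /=; ring.
  by apply: is_derive_eq d6 _; rewrite /bt; ring.
- move=> s y /andP[s0 sL].
  have -> : A (b s) y = A h y + k' * ((s + c * (s * s)) * A (sqd^~ x0) y).
    rewrite /b (Aop_add _ _ _ _ _ Ch (Cr s)) (Aop_add _ _ _ _ _ (classC_cst 2 (a * s)) (Ck s)).
    rewrite (Aop_scale _ _ _ _ _ _ (Cq s)) (Aop_add _ _ _ _ _ (Cp s) (classC_cst 2 _)).
    by rewrite !Aop_cst (Aop_scale _ _ _ _ _ _ Cd) add0r addr0.
  have d0 := sqd_ge0 y x0.
  have h1 : A h y <= a + k' * sqd y x0.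
    have [dle|dgt] := leP (sqd y x0) eta.
      by apply: le_trans (ha y dle) _; rewrite lerDl mulr_ge0.
    apply: le_trans (hk y) _; apply: le_trans kae _.
    by rewrite lerD2l ler_wpM2l// ltW.
  have cs : c * s <= 1 by rewrite mulrC -ler_pdivlMr// div1r.
  have h2 : A (sqd^~ x0) y <= C0 * (2 * V x0 + 3 * sqd y x0).
    apply: le_trans (ler_norm _) _; apply: le_trans (HC x0 y) _.
    by rewrite ler_wpM2l//; have := V_le_sqd y x0; lra.
  have p0 : 0 <= s + c * (s * s) by rewrite addr_ge0 ?mulr_ge0 ?ltW.
  have h3 : (s + c * (s * s)) * A (sqd^~ x0) y <= c * (2 * s) * sqd y x0 + 4 * C0 * V x0 * (2 * s).
    apply: (@le_trans _ _ (2 * s * (C0 * (2 * V x0 + 3 * sqd y x0)))).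
      apply: (@le_trans _ _ ((s + c * (s * s)) * (C0 * (2 * V x0 + 3 * sqd y x0)))).
        by rewrite ler_wpM2l.
      apply: ler_wpM2r; first by rewrite mulr_ge0//; lra.
      have : s * (c * s) <= s * 1 by rewrite ler_wpM2l// ltW.
      lra.
    have e1 : 0 <= s * sqd y x0 by rewrite mulr_ge0// ltW.
    have e2 : 0 <= s * (C0 * V x0) by exact: mulr_ge0 (ltW s0) (mulr_ge0 C00 (ltW V0)).
    rewrite /c; lra.
  have := ler_wpM2l k'0 h3; rewrite /bt; lra.
- by move=> y; rewrite /b !(mulr0, mul0r, addr0).
- move=> s y /andP[s0 sL]; rewrite /b.
  have h1 : - H <= h y by have := hH y; rewrite ler_norml => /andP[].
  have h2 : - (`|a| * c^-1) <= a * s.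
    have : `|a * s| <= `|a| * c^-1 by rewrite normrM (ger0_norm s0) ler_wpM2l.
    by rewrite ler_norml => /andP[].
  have h3 : 0 <= k' * ((s + c * (s * s)) * sqd y x0 + 4 * C0 * V x0 * (s * s)).
    rewrite mulr_ge0// addr_ge0// mulr_ge0 ?sqd_ge0 ?addr_ge0 ?mulr_ge0 ?(ltW c0)//.
    exact: ltW.
  lra.
Qed.

End ShortTime.

Section Superset.
Context {R : realType} {n q : nat}.
Local Notation E := 'rV[R]_n.
Variables (fb : 'I_q -> 'I_n) (Q : E -> 'M[R]_q) (B : 'M[R]_n) (F : E -> 'rV[R]_q).
Hypothesis reg : regular_coefficients Q F.
Local Notation solves := (solves fb Q B F).
Local Notation A := (Aop fb Q B F).
Implicit Types (f g h : E -> R) (x y : E) (t s : R) (u : R -> E -> R).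

Lemma short_time_estimate : exists C c : R, [/\ 0 <= C, 0 < c &
  forall h u (H k a e eta : R) x0, solves h u -> classC 2 h ->
  (forall x, `|h x| <= H) -> (forall x, `|A h x| <= k) -> 0 < eta ->
  (forall x, sqd x x0 <= eta -> `|A h x - a| <= e) ->
  forall t, 0 <= t <= c ->
  `|u t x0 - h x0 - a * t| <= e * t + 2 * k / eta * (C * V x0 * t ^+ 2)].
Proof.
have [C [c [C0 c0 HC]]] := short_time_upper fb B reg.
exists C, c; split=> // h u H k a e eta x0 su Ch hH hk eta0 ha t tc.
have k0 : 0 <= k by apply: le_trans (hk x0).
have kk : 2 * k / eta * eta = 2 * k by rewrite divfK// gt_eqF.
have k'0 : 0 <= 2 * k / eta by rewrite divr_ge0 ?mulr_ge0// ltW.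
have ax0 : `|A h x0 - a| <= e by apply: ha; rewrite sqdxx ltW.
have Ax0 := hk x0; rewrite !ler_norml in ax0 Ax0.
have [/andP[a1 a2] /andP[k1 k2]] := (ax0, Ax0).
have Dh x : A (fun y => - h y) x = - A h x.
  rewrite (_ : (fun y => - h y) = fun y => -1 * h y); last by apply/funext => y; rewrite mulN1r.
  by rewrite Aop_scale// mulN1r.
have Ch' : classC 2 (fun y => - h y).
  rewrite (_ : (fun y => - h y) = fun y => -1 * h y); first exact: classC_scale.
  by apply/funext => y; rewrite mulN1r.
rewrite ler_norml; apply/andP; split.
  have := HC (fun y => - h y) (fun t y => - u t y) H k (2 * k / eta) (- a + e) eta x0
    (solves_opp su) Ch' _ _ k'0 _ _ t tc.
  have P1 x : `|- h x| <= H by rewrite normrN.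
  have P2 x : A (fun y => - h y) x <= k.
    by rewrite Dh; have := hk x; rewrite ler_norml => /andP[]; rewrite lerNl.
  have P3 x : sqd x x0 <= eta -> A (fun y => - h y) x <= - a + e.
    by rewrite Dh => /ha; rewrite ler_norml => /andP[]; lra.
  by move=> /(_ P1 P2 P3); rewrite kk; lra.
have := HC h u H k (2 * k / eta) (a + e) eta x0 su Ch hH _ k'0 _ _ t tc.
have P2 x : A h x <= k by apply: le_trans (hk x); exact: ler_norm.
have P3 x : sqd x x0 <= eta -> A h x <= a + e.
  by move=> /ha; rewrite ler_norml => /andP[]; lra.
by move=> /(_ P2 P3); rewrite kk; lra.
Qed.

Definition locally_uniform (fn : nat -> E -> R) f :=
  forall M e, 0 < e -> exists N, forall k, (N <= k)%N -> forall x, V x <= M ->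
    `|fn k x - f x| <= e.

Lemma cvg_tauc_seqP (fn : nat -> E -> R) f :
  cvg_tauc (fn @ \oo) f <-> locally_uniform fn f.
Proof.
split=> [/cvg_taucP H M e e0|H].
  by have [N _ HN] := H M e e0; exists N => k Nk; exact: HN.
apply/cvg_taucP => M e e0; have [N HN] := H M e e0.
by exists N => // k Nk; exact: HN.
Qed.

Variable T : R -> (E -> R) -> E -> R.
Hypothesis hT : forall f, Cb f -> solves f (T^~ f) /\
  forall u, solves f u -> forall t x, 0 <= t -> u t x = T t f x.

Lemma T_cvg (fn : nat -> E -> R) f (H e t : R) x : (forall k, Cb (fn k)) -> Cb f ->
  (forall k x, `|fn k x| <= H) -> (forall x, `|f x| <= H) ->
  locally_uniform fn f -> 0 <= t -> 0 < e ->
  exists N, forall k, (N <= k)%N -> `|T t (fn k) x - T t f x| <= e.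
Proof.
move=> Cfn Cf fnH fH lu t0 e0.
have [c c0 tight] := solution_tight fb B reg.
pose W := expR (c * t) * V x; have W0 : 0 < W by rewrite mulr_gt0 ?expR_gt0 ?V_gt0.
have H0 : 0 <= H by apply: le_trans (fH 0).
have H1 : 0 < 2 * H + 1 by lra.
pose M := (2 * H + 1) * W / (e / 2).
have e2 : 0 < e / 2 by lra.
have M0 : 0 < M := divr_gt0 (mulr_gt0 H1 W0) e2.
have HM : 2 * H / M * W <= e / 2.
  have -> : 2 * H / M * W = (e / 2) * (2 * H / (2 * H + 1)).
    by rewrite /M; field; rewrite !gt_eqF.
  by rewrite ler_piMr ?(ltW e2)// ler_pdivrMr; lra.
have [N HN] := lu M _ e2; exists N => k Nk.
pose r y := -1 * f y + fn k y.
have Cr : Cb r by exact: Cb_lin.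
have rM y : V y <= M -> `|r y| <= e / 2.
  by move=> yM; rewrite /r mulN1r addrC; exact: HN.
have rH y : `|r y| <= 2 * H.
  rewrite /r mulN1r; apply: le_trans (ler_normD _ _) _; rewrite normrN.
  by have := fH y; have := fnH k y; lra.
have H20 : 0 <= 2 * H by lra.
have := tight r (T^~ r) _ _ _ (T_solves hT Cr) M0 H20 (ltW e2) rH rM t x t0.
rewrite -/W (T_lin hT _ _ Cf (Cfn k) t0) mulN1r addrC => h; apply: le_trans h _; lra.
Qed.

(** Boundedness and local uniform convergence are enough to pass to the limit in
    the short-time estimates, because mass does not escape to infinity. *)
Lemma generates_limit (fn : nat -> E -> R) f g (K : R) :
  (forall k, classC 2 (fn k)) -> Cb f -> Cb g -> (forall k x, `|fn k x| <= K) ->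
  (forall k x, `|A (fn k) x| <= K) -> locally_uniform fn f ->
  locally_uniform (fun k => A (fn k)) g -> generates T f g.
Proof.
move=> C2 Cf Cg fnK AK lf lg.
have Cfn k : Cb (fn k).
  split; first exact: classC_cont (C2 k).
  by apply/bounded_fun_abs; exists K; exact: fnK.
have K0 : 0 <= K by apply: le_trans (fnK 0%N 0).
have fK x : `|f x| <= K.
  apply: (@le_add_eps _ _ _ 1) => // e e0; have [N HN] := lf (V x) e e0.
  have := HN N (leqnn _) x (lexx _); rewrite distrC => h.
  have -> : f x = f x - fn N x + fn N x by ring.
  by apply: le_trans (ler_normD _ _) _; have := fnK N x; lra.
have [C [c [C0 c0 HC]]] := short_time_estimate.
have lim t x (w b : R) : 0 <= t ->
    (exists N, forall k, (N <= k)%N -> `|T t (fn k) x - fn k x - w| <= b) ->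
    `|T t f x - f x - w| <= b.
  move=> t0 [N1 H1]; apply: (@le_add_eps _ _ _ 2) => // e e0.
  have [N2 H2] := T_cvg x Cfn Cf fnK fK lf t0 e0.
  have [N3 H3] := lf (V x) e e0.
  pose k := maxn N1 (maxn N2 N3).
  have := H1 k (leq_maxl _ _).
  have k2 : (N2 <= k)%N by rewrite /k leq_max leq_maxl orbT.
  have k3 : (N3 <= k)%N by rewrite /k leq_max leq_maxr orbT.
  have := H2 k k2; have := H3 k k3 x (lexx _); clearbody k => h3 h2 h1.
  have -> : T t f x - f x - w = (T t (fn k) x - fn k x - w) + (fn k x - f x)
    - (T t (fn k) x - T t f x) by ring.
  apply: le_trans (ler_normB _ _) _; have := ler_normD (T t (fn k) x - fn k x - w) (fn k x - f x).
  lra.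
split=> //.
- move=> M e e0.
  have e4 : 0 < e / 4 by lra.
  have [_ cg] := (Cg, proj1 Cg).
  have [d d0 Hd] := sublevel_uniform M cg e4.
  pose eta := Num.min d 1; have eta0 : 0 < eta by rewrite /eta lt_min d0 ltr01.
  have eta1 : eta <= 1 by rewrite /eta ge_min lexx orbT.
  have etad : eta <= d by rewrite /eta ge_min lexx.
  have [N HN] := lg (2 * M + 2) _ e4.
  pose Mp := Num.max M 1.
  have Mp1 : 1 <= Mp by rewrite /Mp le_max lexx orbT.
  have MMp : M <= Mp by rewrite /Mp le_max lexx.
  pose S := 2 * K / eta * (C * Mp).
  have S0 : 0 <= S by rewrite !mulr_ge0 ?invr_ge0 ?(ltW eta0)//; lra.
  pose d' := Num.min c (e / 2 / (S + 1)).
  have S1 : 0 < S + 1 by lra.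
  have d'0 : 0 < d' by rewrite /d' lt_min c0/= !divr_gt0.
  exists d' => // t x /andP[t0 td] xM.
  have tc : 0 <= t <= c.
    by rewrite (ltW t0)/= (le_trans (ltW td))// /d' ge_min lexx.
  have tS : (S + 1) * t <= e / 2.
    rewrite mulrC -ler_pdivlMr//; apply: le_trans (ltW td) _.
    by rewrite /d' ge_min lexx orbT.
  apply: (lim t x (t * g x)); first exact: ltW.
  exists N => k Nk.
  have P y : sqd y x <= eta -> `|A (fn k) y - g x| <= e / 2.
    move=> yx; have h1 : `|A (fn k) y - g y| <= e / 4.
      by apply: HN => //; have := V_le_sqd y x; lra.
    have h2 : `|g x - g y| <= e / 4 by apply: Hd => //; rewrite sqdC; lra.
    have -> : A (fn k) y - g x = (A (fn k) y - g y) - (g x - g y) by ring.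
    by apply: le_trans (ler_normB _ _) _; lra.
  have := HC (fn k) (T^~ (fn k)) K K (g x) (e / 2) eta x (T_solves hT (Cfn k)) (C2 k)
    (fnK k) (AK k) eta0 P t tc.
  rewrite [g x * t]mulrC => h; apply: le_trans h _.
  have h1 : 2 * K / eta * (C * V x * t ^+ 2) <= S * t ^+ 2.
    rewrite mulrA ler_wpM2r ?sqr_ge0// /S ler_wpM2l//.
      by rewrite divr_ge0 ?mulr_ge0// ltW.
    by rewrite ler_wpM2l// (le_trans xM).
  have h2 : S * t ^+ 2 <= e / 2 * t.
    rewrite expr2 mulrA ler_wpM2r ?(ltW t0)//; apply: le_trans tS.
    by rewrite ler_wpM2r ?(ltW t0)//; lra.
  lra.
(* For t > c, the crude bound 2 K is at most (2 K / c) t. *)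
exists (K + 2 * K / c); first by rewrite addr_ge0 ?divr_ge0 ?(ltW c0)//; lra.
move=> t x /andP[t0 t1].
have [tc|tc] := leP t c; last first.
  have h1 : `|T t f x| <= K := T_abs_le reg hT x Cf fK (ltW t0).
  apply: le_trans (ler_normB _ _) _; have := fK x.
  have h2 : 2 * K <= 2 * K / c * t.
    by rewrite mulrAC ler_pdivlMr// ler_wpM2l ?(ltW tc)//; lra.
  have : 0 <= K * t by rewrite mulr_ge0// ltW.
  lra.
have Kc : 0 <= 2 * K / c * t by rewrite mulr_ge0 ?(ltW t0)// divr_ge0 ?(ltW c0)//; lra.
have VC : 0 <= 2 * K * (C * V x * t ^+ 2).
  have K20 : 0 <= 2 * K by lra.
  exact: mulr_ge0 K20 (mulr_ge0 (mulr_ge0 C0 (ltW (V_gt0 x))) (sqr_ge0 t)).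
suff h : `|T t f x - f x - 0| <= K * t.
  by rewrite subr0 in h; apply: le_trans h _; rewrite mulrDl lerDl.
(* With a = 0 and e = K the estimate holds for every radius eta = e^-1. *)
apply: (lim t x 0 _ (ltW t0)); exists 0%N => k _.
apply: (@le_add_eps _ _ _ (2 * K * (C * V x * t ^+ 2))) => // e e0.
have P y : sqd y x <= e^-1 -> `|A (fn k) y - 0| <= K by rewrite subr0 => _; exact: AK.
have tc' : 0 <= t <= c by rewrite (ltW t0).
have e'0 : 0 < e^-1 by rewrite invr_gt0.
have := HC (fn k) (T^~ (fn k)) K K 0 K e^-1 x (T_solves hT (Cfn k)) (C2 k)
  (fnK k) (AK k) e'0 P t tc'.
by rewrite mul0r invrK => h; apply: le_trans h _; lra.
Qed.

End Superset.

(** * Cutoff functions *)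

Section CutoffProfile.
Context {R : realType}.
Implicit Types (s : R).

(** The cube of the positive part of s, which is of class C^2, and its derivatives,
    in a form to which the product rule applies. *)
Definition ramp s : R := (s * (s * s) + s * (s * `|s|)) / 2.
Definition ramp1 s : R := 3 / 2 * (s * s + s * `|s|).
Definition ramp2 s : R := 3 * (s + `|s|).

Lemma is_derive_mul_abs s : is_derive s 1 (fun s => s * `|s|) (2 * `|s|).
Proof.
apply: eps_is_derive => e e0; exists e => // h he.
have h2 : `|h| * `|h| <= e * `|h| by rewrite ler_wpM2r// ltW.
apply: le_trans h2; rewrite -normrM ger0_norm; last by rewrite -expr2 sqr_ge0.
rewrite ler_norml; have [s0|s0] := leP 0 s; have [sh|sh] := leP 0 (s + h);
  rewrite ?(ger0_norm s0) ?(ltr0_norm s0) ?(ger0_norm sh) ?(ltr0_norm sh);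
  apply/andP; split; nra.
Qed.

Lemma is_derive_ramp s : is_derive s 1 ramp (ramp1 s).
Proof.
have d1 : is_derive s 1 (fun s : R => s) 1 by exact: is_derive_id.
have d2 := is_derive_mul d1 (is_derive_mul d1 d1).
have d3 := is_derive_mul d1 (is_derive_mul_abs s).
have d4 := is_derive_scale 2^-1 (is_derive_add d2 d3).
rewrite /ramp (_ : (fun _ => _) = fun s => 2^-1 * (s * (s * s) + s * (s * `|s|))); last first.
  by apply/funext => r; rewrite mulrC.
by apply: is_derive_eq d4 _; rewrite /ramp1; field.
Qed.

Lemma is_derive_ramp1 s : is_derive s 1 ramp1 (ramp2 s).
Proof.
have d1 : is_derive s 1 (fun s : R => s) 1 by exact: is_derive_id.
have d4 := is_derive_scale (3 / 2) (is_derive_add (is_derive_mul d1 d1) (is_derive_mul_abs s)).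
by apply: is_derive_eq d4 _; rewrite /ramp2; field.
Qed.

Lemma ramp_neg s : s <= 0 -> [/\ ramp s = 0, ramp1 s = 0 & ramp2 s = 0].
Proof. by move=> s0; rewrite /ramp /ramp1 /ramp2 (ler0_norm s0); split; ring. Qed.

Lemma ramp_pos s : 0 <= s -> [/\ ramp s = s ^+ 3, ramp1 s = 3 * s ^+ 2 & ramp2 s = 6 * s].
Proof. by move=> s0; rewrite /ramp /ramp1 /ramp2 (ger0_norm s0); split; field. Qed.

Lemma ramp_ge0 s : 0 <= ramp s.
Proof.
have [s0|s0] := leP 0 s; last by have [->] := ramp_neg (ltW s0).
by have [-> _ _] := ramp_pos s0; exact: exprn_ge0.
Qed.

Lemma ramp_le1 s : s <= 1 -> [/\ ramp s <= 1, 0 <= ramp1 s <= 3 & 0 <= ramp2 s <= 6].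
Proof.
move=> s1; have [s0|s0] := leP 0 s; last first.
  by have [-> -> ->] := ramp_neg (ltW s0); rewrite !lexx ler01 !ler0n.
have [-> -> ->] := ramp_pos s0; have s2 := exprn_ge0 2 s0.
have e2 : s ^+ 2 <= 1 by rewrite exprn_ile1.
by split; [rewrite exprn_ile1|apply/andP; split; lra|apply/andP; split; lra].
Qed.

Lemma ramp_ge1 s : 1 <= s -> 1 <= ramp s.
Proof.
by move=> s1; have [-> _ _] := ramp_pos (le_trans ler01 s1); exact: exprn_ege1.
Qed.

Variable M : R.
Hypothesis M0 : 0 < M.

Definition cutv s : R := M^-1 * s + -1.
Definition cutw s : R := 1 + -1 * ramp (cutv s).
Definition cut s : R := ramp (cutw s).
Definition cut1 s : R := ramp1 (cutw s) * (-1 * (ramp1 (cutv s) * M^-1)).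
Definition cut2 s : R :=
  ramp1 (cutw s) * (-1 * (ramp2 (cutv s) * M^-1 * M^-1))
  + -1 * (ramp1 (cutv s) * M^-1) * (ramp2 (cutw s) * (-1 * (ramp1 (cutv s) * M^-1))).

Lemma is_derive_cutv s : is_derive s 1 cutv M^-1.
Proof.
have d1 : is_derive s 1 (fun s : R => s) 1 by exact: is_derive_id.
have d := is_derive_add (is_derive_scale M^-1 d1) (is_derive_cst (-1 : R) s 1).
by apply: is_derive_eq d _; ring.
Qed.

Lemma is_derive_cutw s : is_derive s 1 cutw (-1 * (ramp1 (cutv s) * M^-1)).
Proof.
have d := is_derive_compE (is_derive_ramp (cutv s)) (is_derive_cutv s).
have d2 := is_derive_add (is_derive_cst (1 : R) s 1) (is_derive_scale (-1) d).
by apply: is_derive_eq d2 _; rewrite add0r.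
Qed.

Lemma is_derive_cut s : is_derive s 1 cut (cut1 s).
Proof. exact: is_derive_compE (is_derive_ramp (cutw s)) (is_derive_cutw s). Qed.

Lemma is_derive_cut1 s : is_derive s 1 cut1 (cut2 s).
Proof.
have d1 := is_derive_compE (is_derive_ramp1 (cutw s)) (is_derive_cutw s).
have d2 := is_derive_compE (is_derive_ramp1 (cutv s)) (is_derive_cutv s).
have d3 := is_derive_scale (-1) (is_derive_mul d2 (is_derive_cst (M^-1 : R) s 1)).
have d := is_derive_mul d1 d3; apply: is_derive_eq d _.
by rewrite /cut2 /cst /=; ring.
Qed.

Lemma cut2_continuous : continuous cut2.
Proof.
have cr2 : continuous (ramp2 : R -> R).
  move=> s; exact: (cvgM (cvg_cst (3 : R)) (cvgD cvg_id (@norm_continuous _ R s))).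
have cof (f : R -> R) (f' : R -> R) : (forall s : R, is_derive s 1 f (f' s)) -> continuous f.
  by move=> H s; apply: differentiable_continuous; apply/derivable1_diffP; have [] := H s.
have cv := cof _ _ is_derive_cutv; have cw := cof _ _ is_derive_cutw.
have cr1 := cof _ _ is_derive_ramp1.
have c1 : continuous (fun s => ramp1 (cutw s)) by move=> s; apply: continuous_comp; [exact: cw|exact: cr1].
have c2 : continuous (fun s => ramp1 (cutv s)) by move=> s; apply: continuous_comp; [exact: cv|exact: cr1].
have c3 : continuous (fun s => ramp2 (cutw s)) by move=> s; apply: continuous_comp; [exact: cw|exact: cr2].
have c4 : continuous (fun s => ramp2 (cutv s)) by move=> s; apply: continuous_comp; [exact: cv|exact: cr2].
have c5 : continuous (fun s => -1 * (ramp1 (cutv s) * M^-1)).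
  by move=> s; exact: (cvgM (cvg_cst (-1 : R)) (cvgM (c2 s) (cvg_cst (M^-1 : R)))).
have c6 : continuous (fun s => -1 * (ramp2 (cutv s) * M^-1 * M^-1)).
  by move=> s; exact: (cvgM (cvg_cst (-1 : R)) (cvgM (cvgM (c4 s) (cvg_cst (M^-1 : R))) (cvg_cst (M^-1 : R)))).
by move=> s; exact: (cvgD (cvgM (c1 s) (c6 s)) (cvgM (c5 s) (cvgM (c3 s) (c5 s)))).
Qed.

Lemma cut_inner s : s <= M -> [/\ cut s = 1, cut1 s = 0 & cut2 s = 0].
Proof.
move=> sM; have v0 : cutv s <= 0.
  by have h : s / M <= 1; [rewrite ler_pdivrMr// mul1r|rewrite /cutv mulrC; lra].
rewrite /cut /cut1 /cut2 /cutw; have [-> -> ->] := ramp_neg v0.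
by rewrite !(mulr0, mul0r, addr0); have [-> _ _] := ramp_pos ler01; rewrite expr1n.
Qed.

Lemma cut_outer s : 2 * M <= s -> [/\ cut s = 0, cut1 s = 0 & cut2 s = 0].
Proof.
move=> sM; have v0 : 1 <= cutv s.
  by have h : 2 <= s / M; [rewrite ler_pdivlMr|rewrite /cutv mulrC; lra].
have w0 : cutw s <= 0 by rewrite /cutw; have := ramp_ge1 v0; lra.
by rewrite /cut /cut1 /cut2; have [-> -> ->] := ramp_neg w0; rewrite !(mulr0, mul0r, addr0).
Qed.

Lemma cut_bounds s : [/\ 0 <= cut s <= 1, `|cut1 s| <= 9 / M & `|cut2 s| <= 72 / M ^+ 2].
Proof.
have iM : 0 <= M^-1 by rewrite invr_ge0 ltW.
have [sM|sM] := leP (2 * M) s.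
  have [-> -> ->] := cut_outer sM; rewrite !normr0 lexx ler01.
  by split=> //; rewrite divr_ge0// ?exprn_ge0// ltW.
have v1 : cutv s <= 1.
  by have h : s / M <= 2; [rewrite ler_pdivrMr// ltW|rewrite /cutv mulrC; lra].
have w1 : cutw s <= 1 by rewrite /cutw; have := ramp_ge0 (cutv s); lra.
have [_ /andP[a0 a3] /andP[b0 b6]] := ramp_le1 v1.
have [r1 /andP[c0 c3] /andP[d0 d6]] := ramp_le1 w1.
split; first by rewrite /cut ramp_ge0.
  rewrite /cut1 mulN1r mulrN normrN mulrA ger0_norm; last exact: mulr_ge0 (mulr_ge0 c0 a0) iM.
  rewrite ler_wpM2r//.
  apply: (@le_trans _ _ (3 * 3)); last lra.
  by apply: ler_pM.
have e1 : 0 <= ramp1 (cutw s) * ramp2 (cutv s) <= 18.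
  rewrite (mulr_ge0 c0 b0)/=; apply: (@le_trans _ _ (3 * 6)); last lra.
  exact: ler_pM.
have e2 : 0 <= ramp2 (cutw s) * (ramp1 (cutv s) * ramp1 (cutv s)) <= 54.
  rewrite (mulr_ge0 d0 (mulr_ge0 a0 a0))/=; apply: (@le_trans _ _ (6 * (3 * 3))); last lra.
  by apply: ler_pM => //; [exact: mulr_ge0|exact: ler_pM].
have -> : cut2 s = (ramp2 (cutw s) * (ramp1 (cutv s) * ramp1 (cutv s)) -
   ramp1 (cutw s) * ramp2 (cutv s)) / M ^+ 2 by rewrite /cut2; field; rewrite gt_eqF.
rewrite normrM (ger0_norm (x := (M ^+ 2)^-1)) ?invr_ge0 ?sqr_ge0// ler_wpM2r ?invr_ge0 ?sqr_ge0//.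
by rewrite ler_norml; case/andP: e1 => *; case/andP: e2 => *; apply/andP; split; lra.
Qed.

End CutoffProfile.

Section Cutoff.
Context {R : realType} {n q : nat}.
Local Notation E := 'rV[R]_n.
Variables (fb : 'I_q -> 'I_n) (Q : E -> 'M[R]_q) (B : 'M[R]_n) (F : E -> 'rV[R]_q).
Hypothesis reg : regular_coefficients Q F.
Local Notation A := (Aop fb Q B F).
Local Notation Gam := (Gam fb Q).
Implicit Types (f g h : E -> R) (x y : E) (M : R).

(** Equal to 1 where V <= M and to 0 where V >= 2 M. *)
Definition theta M x : R := cut M (V x).

Lemma cut2_V_continuous M : continuous (fun x : E => cut2 M (V x)).
Proof.
have cV : continuous (V : E -> R) := classC_cont (classC_V 0).
move=> x; apply: (@continuous_comp _ _ _ V (cut2 M)); first exact: cV.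
exact: cut2_continuous.
Qed.

Lemma classC_theta M : classC 2 (theta M).
Proof.
exact: (classC2_comp (classC_V 2) (fun x => is_derive_cut M (V x))
  (fun x => is_derive_cut1 M (V x)) (@cut2_V_continuous M)).
Qed.

Lemma Aop_theta M x : A (theta M) x = cut1 M (V x) * A V x + cut2 M (V x) * Gam V V x.
Proof.
exact: (Aop_comp _ _ _ _ _ (classC_V 2) (fun x => is_derive_cut M (V x))
  (fun x => is_derive_cut1 M (V x)) (@cut2_V_continuous M)).
Qed.

Lemma Aop_theta_mul M h x : classC 2 h ->
  A (fun y => theta M y * h y) x = theta M x * A h x
   + h x * (cut1 M (V x) * A V x + cut2 M (V x) * Gam V V x)
   + 2 * (cut1 M (V x) * Gam V h x).
Proof.
move=> Ch; rewrite (Aop_mul _ _ _ _ (coef_sym reg) (classC_theta M) Ch) Aop_theta.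
by rewrite (Gam_comp _ _ _ (classC_V 1) (is_derive_cut M (V x))).
Qed.

Lemma Aop_theta_inner M h x : 0 < M -> classC 2 h -> V x <= M ->
  A (fun y => theta M y * h y) x = A h x.
Proof.
move=> M0 Ch xM; rewrite Aop_theta_mul// /theta.
by have [-> -> ->] := cut_inner M0 xM; rewrite !mul0r !addr0 !mulr0 !addr0 mul1r.
Qed.

Lemma bf_scalel (S : 'M[R]_q) (c : R) (a b : 'rV[R]_q) : bf S (c *: a) b = c * bf S a b.
Proof. by rewrite /bf -!scalemxAl mxE. Qed.

Lemma bf_scaler (S : 'M[R]_q) (c : R) (a b : 'rV[R]_q) : bf S a (c *: b) = c * bf S a b.
Proof. by rewrite /bf linearZ /= -scalemxAr mxE. Qed.

Lemma Gam_amgm f g x (l : R) : 0 < l ->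
  2 * `|Gam f g x| <= l * Gam f f x + l^-1 * Gam g g x.
Proof.
move=> l0; rewrite !GamE; set a := gradq fb f x; set b := gradq fb g x.
have H1 := bf_ge0 reg x (l *: a + b); have H2 := bf_ge0 reg x (l *: a - b).
rewrite !(bfDl, bfDr, bfNl, bfNr) !bf_scalel !bf_scaler (bfC b a (coef_sym reg x)) in H1 H2.
move: H1 H2; move: (bf _ a a) (bf _ a b) (bf _ b b) => u v w h1 h2.
rewrite -(ler_pM2l l0) mulrDr (mulrA l l^-1) divff ?gt_eqF// mul1r mulrCA.
have [v0|v0] := leP 0 v; rewrite ?(ger0_norm v0) ?(ltr0_norm v0); lra.
Qed.

Lemma Gam_le_weight : exists2 C, 0 <= C & forall h (K : R) x, 0 <= K ->
  (forall i, partial i h x ^+ 2 <= K * Vinv2 x) -> Gam h h x <= C * (K * Vinv x).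
Proof.
have [C C0 HC] := coef_growth reg.
exists (q%:R * (q%:R * C)); first by rewrite !mulr_ge0.
move=> h K x K0 hK; have [HQ _] := HC x.
have V0 := V_gt0 x.
have T i j : Q x i j * (partial (fb i) h x * partial (fb j) h x) <= C * (K * Vinv x).
  apply: le_trans (ler_norm _) _; rewrite normrM.
  have p : `|partial (fb i) h x * partial (fb j) h x| <= K * Vinv2 x.
    have := two_mul_le (partial (fb i) h x) (partial (fb j) h x).
    rewrite normrM (ger0_norm (x := 2))//; have := hK (fb i); have := hK (fb j); lra.
  apply: (@le_trans _ _ (C * V x * (K * Vinv2 x))).
    by apply: ler_pM => //; exact: HQ.
  rewrite le_eqVlt; apply/orP; left; apply/eqP.
  by rewrite /Vinv2 /Vinv; field; rewrite gt_eqF.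
have sum_cst (z : R) : \sum_(i < q) \sum_(j < q) z = q%:R * (q%:R * z).
  by rewrite !sumr_const !card_ord !mulr_natl.
have -> : q%:R * (q%:R * C) * (K * Vinv x) = q%:R * (q%:R * (C * (K * Vinv x))).
  by rewrite !mulrA.
rewrite -sum_cst; apply: ler_sum => i _; apply: ler_sum => j _; exact: T.
Qed.

(** The cutoff does not disturb A h at infinity, because h and its gradient
    decay like the weight. *)
Lemma cutoff_estimate : exists2 C, 0 <= C & forall M h (k K e : R), 1 <= M ->
  classC 2 h -> 0 <= k -> 0 <= K -> 0 < e -> (forall x, `|h x| <= k * Vinv x) ->
  (forall i x, partial i h x ^+ 2 <= K * Vinv2 x) -> forall x,
  `|A (fun y => theta M y * h y) x - theta M x * A h x| <=
     C * (k / M + e + K / (e * M)).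
Proof.
have [c c0 Hc] := Lyapunov fb B reg.
have [C C0 HC] := Gam_le_weight.
exists (18 * c + 288 * c + 36 * c + 9 * C); first lra.
move=> M h k K e M1 Ch k0 K0 e0 hk hK x.
have M0 : 0 < M by lra.
have RHS0 : 0 <= k / M + e + K / (e * M).
  by rewrite !addr_ge0 ?divr_ge0 ?mulr_ge0 ?(ltW M0) ?(ltW e0).
have CC0 : 0 <= 18 * c + 288 * c + 36 * c + 9 * C by lra.
have [xM|xM] := leP (V x) M.
  rewrite Aop_theta_inner// /theta; have [-> _ _] := cut_inner M0 xM.
  by rewrite mul1r subrr normr0; exact: mulr_ge0 CC0 RHS0.
rewrite Aop_theta_mul//; set S := (X in _ + X + _); set G := (X in _ + X - _).
have -> : theta M x * A h x + S + G - theta M x * A h x = S + G by ring.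
have [xM2|xM2] := leP (2 * M) (V x).
  rewrite /S /G; have [_ -> ->] := cut_outer M0 xM2.
  by rewrite !(mul0r, mulr0, addr0) normr0; exact: mulr_ge0 CC0 RHS0.
have [AV GV _ _ _] := Hc x.
have [_ X1 X2] := cut_bounds M0 (V x).
have V0 := V_gt0 x.
have VM : Vinv x <= M^-1 by rewrite /Vinv lef_pV2 ?posrE// ltW.
have iM : 0 < M^-1 by rewrite invr_gt0.
have G0 : 0 <= Gam V V x by exact: (Gam_ge0 fb reg).
have GV4 : Gam V V x <= 4 * c * M ^+ 2.
  apply: le_trans GV _; have : V x ^+ 2 <= (2 * M) ^+ 2.
    by rewrite ler_pXn2r ?nnegrE ?mulr_ge0 ?(ltW V0) ?(ltW M0)// ltW.
  by move=> h1; have := ler_wpM2l c0 h1; rewrite exprMn; lra.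
have e1 : `|cut1 M (V x) * A V x| <= 18 * c.
  rewrite normrM; apply: (@le_trans _ _ (9 / M * (c * (2 * M)))).
    apply: ler_pM => //; apply: le_trans AV _; by rewrite ler_wpM2l// ltW.
  by rewrite le_eqVlt; apply/orP; left; apply/eqP; field; rewrite gt_eqF.
have e2 : `|cut2 M (V x) * Gam V V x| <= 288 * c.
  rewrite normrM (ger0_norm G0); apply: (@le_trans _ _ (72 / M ^+ 2 * (4 * c * M ^+ 2))).
    exact: ler_pM.
  by rewrite le_eqVlt; apply/orP; left; apply/eqP; field; rewrite gt_eqF.
have eS : `|S| <= (18 * c + 288 * c) * (k / M).
  rewrite /S normrM mulrC; apply: ler_pM => //.
    by apply: le_trans (ler_normD _ _) _; exact: lerD.
  by apply: le_trans (hk x) _; rewrite ler_wpM2l.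
have eG : `|G| <= 36 * c * e + 9 * C * (K / (e * M)).
  have l0 : 0 < e / M by rewrite divr_gt0.
  have := Gam_amgm V h x l0.
  have h1 : e / M * Gam V V x <= e / M * (4 * c * M ^+ 2) by rewrite ler_wpM2l// ltW.
  have h2 : (e / M)^-1 * Gam h h x <= (e / M)^-1 * (C * (K * M^-1)).
    rewrite ler_wpM2l ?invr_ge0 ?(ltW l0)//; apply: le_trans (HC h K x K0 (hK^~ x)) _.
    by rewrite ler_wpM2l// ler_wpM2l.
  rewrite /G normrM (ger0_norm (x := 2))// normrM => h3.
  apply: (@le_trans _ _ (9 / M * (e / M * (4 * c * M ^+ 2) + (e / M)^-1 * (C * (K * M^-1))))).
    rewrite mulrCA; apply: ler_pM => //; lra.
  rewrite le_eqVlt; apply/orP; left; apply/eqP; field.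
  by rewrite !gt_eqF.
have p1 : 0 <= k / M by rewrite divr_ge0// ltW.
have p2 : 0 <= K / (e * M) by rewrite divr_ge0// mulr_ge0// ltW.
apply: le_trans (ler_normD _ _) _; move: eS eG p1 p2.
set a := k / M; set b := K / (e * M) => eS eG p1 p2.
have q1 := mulr_ge0 c0 p1; have q2 := mulr_ge0 c0 p2; have q3 := mulr_ge0 c0 (ltW e0).
have q4 := mulr_ge0 C0 p1; have q5 := mulr_ge0 C0 p2; have q6 := mulr_ge0 C0 (ltW e0).
lra.
Qed.

End Cutoff.

(** * Elements of the domain are limits of smooth functions *)

Section ResolventSums.
Context {R : realType}.
Implicit Types (U G : R -> R) (a b e s : R).

(** One step of the Riemann sum of the integral of exp(-s) (G - U), where
    G = U', whose primitive is exp(-s) U(s). *)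
Lemma resolvent_step U G a b e : 0 < a < b ->
  (forall s : R, 0 < s -> is_derive s 1 U (G s)) ->
  (forall s, a <= s <= b -> `|U s - U a| <= e /\ `|G s - G a| <= e) ->
  `|expR (- b) * U b - expR (- a) * U a - (expR (- a) - expR (- b)) * (G a - U a)|
    <= 2 * e * (b - a).
Proof.
move=> /andP[a0 ab] dU H.
have dexp (s : R) : is_derive s 1 (fun s => expR (-1 * s)) (-1 * expR (-1 * s)).
  exact: is_derive_exp_lin.
(* A multiple of exp(-s) is added to the primitive so that the derivative vanishes
   at a. *)
pose Z s := expR (-1 * s) * (U s + (G a - U a)).
have dZ s : 0 < s -> is_derive s 1 Z (expR (-1 * s) * (G s - G a - (U s - U a))).
  move=> s0; have d := is_derive_mul (dexp s) (is_derive_add (dU s s0) (is_derive_cst (G a - U a) s 1)).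
  by apply: is_derive_eq d _; rewrite /cst /=; ring.
have [||c] := @MVT R Z (fun s => expR (-1 * s) * (G s - G a - (U s - U a))) a b ab.
- move=> s; rewrite in_itv /= => /andP[sa _]; apply: dZ; exact: lt_trans sa.
- apply: derivable_within_continuous => s; rewrite in_itv /= => /andP[sa _].
  by have [] := dZ s (lt_le_trans a0 sa).
rewrite in_itv /= => /andP[ac cb] E.
have -> : expR (- b) * U b - expR (- a) * U a - (expR (- a) - expR (- b)) * (G a - U a)
    = Z b - Z a by rewrite /Z !mulN1r; ring.
rewrite E normrM (gtr0_norm (x := b - a)) ?subr_gt0// ler_wpM2r//; first by rewrite subr_ge0 ltW.
have [|h1 h2] := H c; first by rewrite !ltW.
have e1 : expR (-1 * c) <= 1 by rewrite -[leRHS]expR0 ler_expR mulN1r oppr_le0 ltW// (lt_trans a0).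
rewrite normrM ger0_norm ?expR_ge0//.
apply: (@le_trans _ _ (1 * `|G c - G a - (U c - U a)|)); first by rewrite ler_wpM2r.
by rewrite mul1r; apply: le_trans (ler_normB _ _) _; lra.
Qed.

Lemma resolvent_sum U G (t : nat -> R) e (P : nat) : 0 < t 0%N ->
  (forall k, t k < t k.+1) -> (forall s : R, 0 < s -> is_derive s 1 U (G s)) ->
  (forall k s, (k < P)%N -> t k <= s <= t k.+1 ->
     `|U s - U (t k)| <= e /\ `|G s - G (t k)| <= e) ->
  `|expR (- t P) * U (t P) - expR (- t 0%N) * U (t 0%N)
    - \sum_(k < P) (expR (- t k) - expR (- t k.+1)) * (G (t k) - U (t k))|
    <= 2 * e * (t P - t 0%N).
Proof.
move=> t0 tS dU; have tpos k : 0 < t k by elim: k => // k /lt_trans; exact.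
elim: P => [|P IH] H; first by rewrite big_ord0 !subrr normr0 mulr0.
have IH' := IH (fun k s kP => H k s (ltnW kP)).
have S : 0 < t P < t P.+1 by rewrite tpos tS.
have := resolvent_step S dU (fun s => H P s (ltnSn P)).
rewrite big_ord_recr /=; set Sm := \sum_(i < P) _ in IH' *; move: IH'.
set w := (X in _ - (Sm + X)); move=> h1 h2.
have -> : expR (- t P.+1) * U (t P.+1) - expR (- t 0%N) * U (t 0%N) - (Sm + w) =
  (expR (- t P) * U (t P) - expR (- t 0%N) * U (t 0%N) - Sm) +
  (expR (- t P.+1) * U (t P.+1) - expR (- t P) * U (t P) - w) by ring.
by apply: le_trans (ler_normD _ _) _; lra.
Qed.

End ResolventSums.

Section CompactSupport.
Context {R : realType} {n : nat}.
Local Notation E := 'rV[R]_n.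
Implicit Types (f : E -> R) (x y : E).

Lemma continuous_sublevel_bounded f (M : R) : continuous f ->
  exists2 K, 0 <= K & forall x, V x <= M -> `|f x| <= K.
Proof.
move=> cf; have [K [_ HK]] := compact_bounded
  (continuous_compact (continuous_subspaceT cf) (@compact_sublevel R n M)).
exists (`|K| + 1); first by rewrite addr_ge0.
move=> x xM; apply: (HK (`|K| + 1)); last by exists x.
by apply: le_lt_trans (ler_norm K) _; rewrite ltrDl.
Qed.

Lemma partial_zero_open (U : set E) f i : open U -> (forall x, U x -> f x = 0) ->
  forall x, U x -> partial i f x = 0.
Proof.
move=> oU f0 x Ux; apply: is_derive_partial; apply/lineE.
have cl : {for (0 : R), continuous (fun s : R => s *: 'e_i + x)}.
  exact: (cvgD (cvgZr_tmp (@cvg_id _ _)) (cvg_cst x)).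
have k : nbhs (0 : R) (fun s => U (s *: 'e_i + x)).
  apply: (cl U); rewrite /= scale0r add0r.
  exact: open_nbhs_nbhs.
have [d /= d0 Hd] := proj1 (nbhs_ballP _ _) k.
apply: eps_is_derive => e e0; exists d => // h hd.
have fh : f (h *: 'e_i + x) = 0.
  by apply: f0; apply: (Hd h); rewrite -ball_normE /= sub0r normrN.
by rewrite add0r mul0r subr0 scale0r add0r fh (f0 x Ux) subr0 normr0 mulr_ge0// ltW.
Qed.

Definition outside_zero (M : R) f := forall x, M < V x -> f x = 0.

Lemma partial_outside_zero M f i : outside_zero M f -> outside_zero M (partial i f).
Proof.
move=> f0; apply: (partial_zero_open i (U := [set x | M < V x]) _ f0).
have cV : continuous (V : E -> R) := classC_cont (classC_V 0).
by apply: (@open_comp _ _ (V : E -> R) [set y | M < y]); [move=> x _; exact: cV|exact: open_gt].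
Qed.

Lemma Cb2_compact f M : classC 2 f -> outside_zero M f -> Cb2 f.
Proof.
move=> C2 f0; split=> // alpha; rewrite /mlength /mpartial.
pose P k (g : E -> R) := classC k g /\ outside_zero M g.
have PS k g i : P k.+1 g -> P k (partial i g).
  by case=> Cg g0; split; [exact: classC_partial|exact: partial_outside_zero].
have Pi j k g i : P (j + k)%N g -> P k (iter j (partial i) g).
  elim: j k g => [//|j IH] k g Pg; apply: PS; apply: IH.
  by rewrite addnS -addSn.
have Pf (s : seq 'I_n) k : (\sum_(i <- s) alpha i + k <= 2)%N ->
    P k (foldr (fun i g => iter (alpha i) (partial i) g) f s).
  elim: s k => [|i s IH] k.
    by rewrite big_nil add0n => k2; split=> //; exact: classC_le k2 C2.
  by rewrite big_cons /= => h; apply: Pi; apply: IH; rewrite addnCA addnA.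
move=> a2; have [] := Pf (enum 'I_n) 0%N; first by rewrite addn0 big_enum.
move: (foldr _ _ _) => g Cg g0; apply/bounded_fun_abs.
have [K K0 HK] := continuous_sublevel_bounded M (classC_cont Cg).
exists K => x; have [/HK//|/g0 ->] := leP (V x) M.
by rewrite normr0.
Qed.

(** A continuously differentiable function with compact support decays like any
    weight, and so do its increments over distances at most 1. *)
Lemma compact_weighted f M : classC 1 f -> outside_zero M f ->
  exists k L : R, [/\ 0 <= k, 0 <= L, forall x, `|f x| <= k * Vinv x &
    forall x y, sqd x y <= 1 -> (f x - f y) ^+ 2 <= L * sqd x y * Vinv2 x].
Proof.
(* M2 and M3 bound V at distance at most 1 from the sublevels of M1 and M2. *)
move=> C1 f0; pose M1 := `|M| + 1; pose M2 := 2 * M1 + 2; pose M3 := 2 * M2 + 2.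
have MM1 : M <= M1 by rewrite /M1; have := ler_norm M; lra.
have M10 : 0 < M1 by rewrite /M1 ltr_wpDl.
have [K0 K00 HK0] := continuous_sublevel_bounded M1 (classC_cont C1).
have HK i : exists K, 0 <= K /\ forall x, V x <= M3 -> `|partial i f x| <= K.
  have [K Kp HK] := continuous_sublevel_bounded M3 (classC_cont (classC_partial i C1)).
  by exists K.
have [Ki HKi] := choice HK.
pose G := \sum_i (Ki i) ^+ 2.
have G0 : 0 <= G by apply: sumr_ge0 => i _; exact: sqr_ge0.
exists (K0 * M1), (G * M2 ^+ 2).
have VM2 x y : V x <= M1 -> sqd x y <= 1 -> V y <= M2.
  by move=> xM; have := V_le_sqd y x; rewrite sqdC /M2; lra.
split.
- by rewrite mulr_ge0// ltW.
- exact: mulr_ge0 G0 (sqr_ge0 M2).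
- move=> x; have [xM|xM] := leP (V x) M1; last first.
    rewrite (f0 x (le_lt_trans MM1 xM)) normr0.
    exact: mulr_ge0 (mulr_ge0 K00 (ltW M10)) (ltW (Vinv_gt0 x)).
  apply: le_trans (HK0 x xM) _; rewrite -mulrA ler_peMr//.
  by rewrite /Vinv ler_pdivlMr ?V_gt0// mul1r.
move=> x y d1; have d0 := sqd_ge0 x y; have M20 : 0 <= M2 by rewrite /M2; lra.
have [xM|xM] := leP (V x) M2; last first.
  have fx : f x = 0 by apply: f0; move: xM; rewrite /M2; lra.
  have fy : f y = 0.
    apply: f0; apply: (le_lt_trans MM1); rewrite ltNge; apply/negP => yM.
    by have := VM2 y x yM; rewrite sqdC => /(_ d1); lra.
  rewrite fx fy subrr expr0n /=.
  exact: mulr_ge0 (mulr_ge0 (mulr_ge0 G0 (sqr_ge0 M2)) d0) (ltW (Vinv2_gt0 x)).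
have D (s : R) : is_derive s 1 (fun s => f (s *: (y - x) + x))
    (\sum_i (y - x) 0 i * partial i f (s *: (y - x) + x)).
  by apply: is_derive_line; exact: classC_dir C1.
have [xi xi1] := MVT_abs 1 D; rewrite normr1 in xi1.
rewrite scale1r subrK scale0r add0r mulr1 => E.
set z := xi *: (y - x) + x in E.
have zx : sqd z x <= 1.
  apply: le_trans d1; rewrite /sqd; apply: ler_sum => i _; rewrite !mxE addrK.
  rewrite -[in leRHS]sqrrN opprB exprMn ler_piMl ?sqr_ge0//.
  by rewrite -real_normK ?num_real// expr_le1.
have zM : V z <= M3 by have := V_le_sqd z x; rewrite /M3; lra.
rewrite -sqrrN opprB E; apply: le_trans (cauchy_schwarz _ _) _.
have h1 : \sum_i (y - x) 0 i ^+ 2 = sqd x y.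
  by rewrite sqdC; apply: eq_bigr => i _; rewrite !mxE.
have h2 : \sum_i partial i f z ^+ 2 <= G.
  apply: ler_sum => i _; rewrite -real_normK ?num_real// ler_pXn2r ?nnegrE//.
    by have [_] := HKi i; apply.
  by have [] := HKi i.
rewrite h1; apply: (@le_trans _ _ (sqd x y * G)); first by rewrite ler_wpM2l.
have h3 : 1 <= M2 ^+ 2 * Vinv2 x.
  have V0 := V_gt0 x; have h : 1 <= M2 * Vinv x by rewrite /Vinv ler_pdivlMr// mul1r.
  have -> : M2 ^+ 2 * Vinv2 x = (M2 * Vinv x) ^+ 2 by rewrite /Vinv2; ring.
  exact: exprn_ege1.
have -> : G * M2 ^+ 2 * sqd x y * Vinv2 x = (sqd x y * G) * (M2 ^+ 2 * Vinv2 x) by ring.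
by rewrite ler_peMr// mulr_ge0.
Qed.

End CompactSupport.

Section Subset.
Context {R : realType} {n q : nat}.
Local Notation E := 'rV[R]_n.
Variables (fb : 'I_q -> 'I_n) (Q : E -> 'M[R]_q) (B : 'M[R]_n) (F : E -> 'rV[R]_q).
Hypothesis reg : regular_coefficients Q F.
Local Notation solves := (solves fb Q B F).
Local Notation A := (Aop fb Q B F).
Implicit Types (f g h psi : E -> R) (x y : E) (t s : R) (u : R -> E -> R).
Variable T : R -> (E -> R) -> E -> R.
Hypothesis hT : forall f, Cb f -> solves f (T^~ f) /\
  forall u, solves f u -> forall t x, 0 <= t -> u t x = T t f x.

Lemma ball_pair (t s d : R) x : `|t - s| < d -> 0 < d -> ball ((t, x) : R * E) d (s, x).
Proof.
by move=> ts d0; split => /=; [rewrite -ball_normE|exact: ballxx].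
Qed.

Lemma T_time_uniform f (L M e : R) : Cb f -> 0 < e -> exists2 d, 0 < d &
  forall t s x, 0 <= t <= L -> 0 <= s -> `|t - s| < d -> V x <= M ->
    `|T t f x - T s f x| <= e.
Proof.
move=> Cf e0; have su := T_solves hT Cf.
pose mp (z : R * E) : R * E := (Num.max z.1 0, z.2).
have cmp : continuous mp.
  apply: pairing_continuous => z; last exact: cvg_snd.
  by apply: (@continuous_comp _ _ _ (fst : R * E -> R) (fun t => Num.max t 0));
    [exact: cvg_fst|apply: continuous_max; [exact: cvg_id|exact: cvg_cst]].
have cG : {within setT, continuous (fun z : R * E => T (mp z).1 f (mp z).2)}.
  apply: (@continuous_within_map R (R * E)%type (R * E)%type [set z : R * E | 0 <= z.1] setT
    mp (fun z : R * E => T z.1 f z.2) cmp _ (so_continuous su)).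
  by move=> z _ /=; rewrite le_max lexx orbT.
have cG' : continuous (fun z : R * E => T (mp z).1 f (mp z).2).
  exact: (proj2 (continuous_subspace_setT (fun z : R * E => T (mp z).1 f (mp z).2)) cG).
have cK : compact (`[0, L]%classic `*` [set x : E | V x <= M]).
  by apply: compact_setX; [exact: segment_compact|exact: compact_sublevel].
have [d d0 Hd] := compact_uniform cK (fun z _ => cG' z) e0.
exists d => // t s x tL s0 ts xM.
have := Hd (t, x) (s, x); rewrite /mp /= (max_idPl _) ?(max_idPl s0); last by case/andP: tL.
by apply; [split=> //=; rewrite in_itv|exact: ball_pair].
Qed.

Lemma T_derivative_uniform f (d0 L M e : R) : Cb f -> 0 < d0 -> 0 < e ->
  exists2 d, 0 < d & forall t s x, d0 <= t <= L -> `|t - s| < d -> V x <= M -> 0 < s ->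
    `|A (T t f) x - A (T s f) x| <= e.
Proof.
move=> Cf d00 e0; have su := T_solves hT Cf.
have cK : compact (`[d0, L]%classic `*` [set x : E | V x <= M]).
  by apply: compact_setX; [exact: segment_compact|exact: compact_sublevel].
have cG (z : R * E) : (`[d0, L]%classic `*` [set x : E | V x <= M]) z ->
    {for z, continuous (fun z : R * E => 'D_1 (fun t => T t f z.2) z.1)}.
  move=> [/=]; rewrite in_itv /= => /andP[z1 _] _.
  by apply: (so_t_continuous su); rewrite inE /=; exact: lt_le_trans z1.
have [d dp Hd] := compact_uniform cK cG e0.
exists d => // t s x /andP[t1 t2] ts xM s0.
have t0 : 0 < t := lt_le_trans d00 t1.
rewrite -(so_eq su)// -(so_eq su)//.
apply: (Hd (t, x) (s, x)); last exact: ball_pair.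
by split=> //=; rewrite in_itv /= t1.
Qed.

(** The semigroup itself smooths the source, and a cutoff makes it compactly
    supported. *)
Lemma smoothed_source psi (Psi M e : R) : Cb psi -> (forall x, `|psi x| <= Psi) ->
  1 <= M -> 0 < e -> exists psi' : E -> R, [/\ Cb psi', forall x, `|psi' x| <= Psi,
    forall x, V x <= M -> `|psi' x - psi x| <= e &
    exists k L : R, [/\ 0 <= k, 0 <= L, forall x, `|psi' x| <= k * Vinv x &
    forall x y, sqd x y <= 1 -> (psi' x - psi' y) ^+ 2 <= L * sqd x y * Vinv2 x]].
Proof.
move=> Cp pP M1 e0; have M0 : 0 < M by lra.
have [d d0 Hd] := T_time_uniform 0 M Cp e0.
have s0 : 0 < d / 2 by rewrite divr_gt0.
have C2 := solves_classC2 (T_solves hT Cp) s0.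
set h := T (d / 2) psi in C2.
have Cp' := classC_mul (classC_theta (n := n) M) C2.
have b1 x : `|theta M x * h x| <= Psi.
  have [/andP[a0 a1] _ _] := cut_bounds M0 (V x).
  rewrite normrM (ger0_norm (x := theta M x))//.
  apply: le_trans (T_abs_le reg hT x Cp pP (ltW s0)); rewrite -/h ler_piMl//.
exists (fun x => theta M x * h x); split=> //.
- split; first exact: classC_cont Cp'.
  by apply/bounded_fun_abs; exists Psi.
- move=> x xM; rewrite /theta; have [-> _ _] := cut_inner M0 xM; rewrite mul1r.
  have := Hd 0 (d / 2) x; rewrite (T0 hT Cp) lexx => /(_ isT (ltW s0)).
  rewrite sub0r normrN gtr0_norm// distrC => H; apply: H xM; lra.
apply: (compact_weighted (classCS Cp') (M := 2 * M)) => x xM.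
by rewrite /theta; have [-> _ _] := cut_outer M0 (ltW xM); rewrite mul0r.
Qed.

Lemma T_decay psi (k Lam L : R) : Cb psi -> 0 < L -> 0 <= k -> 0 <= Lam ->
  (forall x, `|psi x| <= k * Vinv x) ->
  (forall x y, sqd x y <= 1 -> (psi x - psi y) ^+ 2 <= Lam * sqd x y * Vinv2 x) ->
  exists k' K : R, [/\ 0 <= k', 0 <= K,
    forall t x, 0 < t <= L -> `|T t psi x| <= k' * Vinv x &
    forall t x i, 0 < t <= L -> `|partial i (T t psi) x| <= K * Vinv x].
Proof.
move=> Cp L0 k0 Lam0 pk pLam; have su := T_solves hT Cp.
have [c c0 Hc] := Lyapunov fb B reg.
pose k' := k * expR (c * L).
have k'0 : 0 <= k' by rewrite mulr_ge0 ?expR_ge0.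
have H1 t x : 0 <= t <= L -> `|T t psi x| <= k' * Vinv x.
  move=> /andP[t0 tL].
  have Vi y : 0 <= Vinv y :> R := ltW (Vinv_gt0 y).
  have AVi y : A (@Vinv R n) y <= c * Vinv y.
    by have [_ _ h _ _] := Hc y; apply: le_trans h; exact: ler_norm.
  have pk0 y : `|psi y| <= 0 + k * Vinv y by rewrite add0r.
  have := solution_abs_le_weight reg su (@classC_Vinv R n) c0 Vi AVi k0 pk0 x t0.
  rewrite add0r => h; apply: le_trans h _; rewrite /k' -mulrA ler_wpM2l// ler_wpM2r//.
  by rewrite ler_expR ler_wpM2l.
have [K K0 HK] := weighted_lipschitz reg su L0 k'0 Lam0 H1 pLam.
exists k', (Num.sqrt K); split=> //.
  by move=> t x /andP[t0 tL]; apply: H1; rewrite (ltW t0).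
move=> t x i /andP[t0 tL]; have tL' : 0 <= t <= L by rewrite (ltW t0).
have := gradient_of_lipschitz i K0 (classCS (solves_classC2 su t0)) (fun y => HK t x y tL').
move=> h; rewrite -ler_sqr ?nnegrE ?mulr_ge0 ?(ltW (Vinv_gt0 x))//.
by rewrite real_normK ?num_real// exprMn sqr_sqrtr.
Qed.

End Subset.

Section Mesh.
Context {R : realType}.
Variables (d L : R) (P : nat).
Hypotheses (d0 : 0 < d) (dL : d < L) (P0 : (0 < P)%N).

Definition node (k : nat) : R := d + k%:R * ((L - d) / P%:R).
Definition weight (k : nat) : R := expR (- node k) - expR (- node k.+1).

Lemma step_gt0 : 0 < (L - d) / P%:R.
Proof. by rewrite divr_gt0 ?subr_gt0// ltr0n. Qed.

Lemma nodeS k : node k.+1 = node k + (L - d) / P%:R.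
Proof. by rewrite /node -natr1; ring. Qed.

Lemma node_lt k : node k < node k.+1.
Proof. by rewrite nodeS ltrDl step_gt0. Qed.

Lemma node0 : node 0 = d.
Proof. by rewrite /node mul0r addr0. Qed.

Lemma node_last : node P = L.
Proof.
have P0' : P%:R != 0 :> R by rewrite pnatr_eq0 -lt0n.
by rewrite /node; field.
Qed.

Lemma node_bounds k : (k <= P)%N -> d <= node k <= L.
Proof.
move=> kP; have s0 := ltW step_gt0; rewrite /node lerDl mulr_ge0//=.
rewrite -[leRHS]node_last /node lerD2l ler_wpM2r//.
by rewrite ler_nat.
Qed.

Lemma weight_ge0 k : 0 <= weight k.
Proof. by rewrite /weight subr_ge0 ler_expR lerN2 ltW// node_lt. Qed.

(** The weights are increments of exp(-t), so they sum to at most 1. *)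
Lemma weighted_sum_le (a : 'I_P -> R) (c : R) : 0 <= c -> (forall k, `|a k| <= c) ->
  `|\sum_(k < P) weight k * a k| <= c.
Proof.
move=> c0 Ha; apply: le_trans (ler_norm_sum _ _ _) _.
have S : \sum_(k < P) weight k <= 1.
  have tele (m : nat) : \sum_(k < m) weight k = expR (- node 0) - expR (- node m).
    elim: m => [|m IH]; first by rewrite big_ord0 subrr.
    by rewrite big_ord_recr /= IH /weight; ring.
  rewrite tele.
  have := expR_ge0 (- node P); rewrite node0.
  have : expR (- d) <= 1 by rewrite -[leRHS]expR0 ler_expR oppr_le0 ltW.
  lra.
apply: (@le_trans _ _ (\sum_(k < P) weight k * c)).
  by apply: ler_sum => k _; rewrite normrM ger0_norm ?weight_ge0// ler_wpM2l// weight_ge0.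
by rewrite -mulr_suml ler_piMl.
Qed.

Lemma mesh_estimate (U G : R -> R) (e d1 : R) : (L - d) / P%:R < d1 ->
  (forall s : R, 0 < s -> is_derive s 1 U (G s)) ->
  (forall t s, d <= t <= L -> 0 < s -> `|t - s| < d1 ->
     `|U t - U s| <= e /\ `|G t - G s| <= e) ->
  `|expR (- L) * U L - expR (- d) * U d
    - \sum_(k < P) weight k * (G (node k) - U (node k))| <= 2 * e * (L - d).
Proof.
move=> h1 dU H.
have n0 : 0 < node 0 by rewrite node0.
have := @resolvent_sum R U G node e P n0 node_lt dU; rewrite node_last node0; apply.
move=> k s kP /andP[s1 s2]; have nk := node_bounds (ltnW kP).
have [||u1 g1] := H (node k) s nk.
- by apply: lt_le_trans s1; apply: lt_le_trans d0 _; case/andP: nk.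
- rewrite distrC ger0_norm ?subr_ge0//; apply: le_lt_trans h1.
  by move: s2; rewrite nodeS; lra.
by rewrite (distrC (U s)) (distrC (G s)).
Qed.

End Mesh.

Lemma mesh_size {R : realType} (l d : R) : 0 <= l -> 0 < d ->
  exists2 P : nat, (0 < P)%N & l / P%:R < d.
Proof.
move=> l0 d0; exists (Num.bound (l / d)).+1 => //.
have h : l / d < (Num.bound (l / d)).+1%:R.
  apply: lt_le_trans (archi_boundP _) _; first by rewrite divr_ge0// ltW.
  by rewrite ler_nat.
by rewrite ltr_pdivrMr ?ltr0n// mulrC -ltr_pdivrMr.
Qed.

Section Approximation.
Context {R : realType} {n q : nat}.
Local Notation E := 'rV[R]_n.
Variables (fb : 'I_q -> 'I_n) (Q : E -> 'M[R]_q) (B : 'M[R]_n) (F : E -> 'rV[R]_q).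
Hypothesis reg : regular_coefficients Q F.
Local Notation solves := (solves fb Q B F).
Local Notation A := (Aop fb Q B F).
Implicit Types (f g h psi : E -> R) (x y : E) (t s : R) (u : R -> E -> R).
Variable T : R -> (E -> R) -> E -> R.
Hypothesis hT : forall f, Cb f -> solves f (T^~ f) /\
  forall u, solves f u -> forall t x, 0 <= t -> u t x = T t f x.

(** A Riemann sum of the resolvent R(1, A) psi, the integral of exp(-t) T(t) psi,
    over [d, L] only: near t = 0 there is no control of the time derivative, and
    the tail is negligible. *)
Definition resolvent_approx (d L : R) (P : nat) psi x : R :=
  \sum_(k < P) weight d L P k * T (node d L P k) psi x.

Lemma resolvent_approx_C2 d L P psi : 0 < d -> d < L -> (0 < P)%N -> Cb psi ->
  classC 2 (resolvent_approx d L P psi) /\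
  forall x, A (resolvent_approx d L P psi) x =
    \sum_(k < P) weight d L P k * A (T (node d L P k) psi) x.
Proof.
move=> d0 dL P0 Cp.
have C2 (k : 'I_P) : classC 2 (T (node d L P k) psi).
  apply: (solves_classC2 (T_solves hT Cp)).
  by have /andP[dn _] := node_bounds dL P0 (ltnW (ltn_ord k)); exact: lt_le_trans dn.
split; first by apply: classC_sum => k; exact: classC_scale.
move=> x; rewrite /resolvent_approx Aop_sum; last by move=> k; exact: classC_scale.
by apply: eq_bigr => k _; rewrite Aop_scale.
Qed.

Lemma resolvent_approx_partial d L P psi i x : 0 < d -> d < L -> (0 < P)%N -> Cb psi ->
  partial i (resolvent_approx d L P psi) x =
    \sum_(k < P) weight d L P k * partial i (T (node d L P k) psi) x.
Proof.
move=> d0 dL P0 Cp; apply: is_derive_partial; apply: is_derive_sumE => k.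
apply: is_derive_scale; apply: (classC_derive (k := 1)).
apply: (solves_classC2 (T_solves hT Cp)).
by have /andP[dn _] := node_bounds dL P0 (ltnW (ltn_ord k)); exact: lt_le_trans dn.
Qed.

Lemma small_start f psi (Fb Psi C m e : R) : Cb psi -> 0 <= C -> 0 <= Fb -> 0 <= Psi -> 0 < e ->
  (forall x, `|f x| <= Fb) -> (forall t x, 0 < t <= 1 -> `|T t f x - f x| <= C * t) ->
  (forall t x, 0 <= t -> `|T t f x| <= Fb) ->
  exists d, [/\ 0 < d, d < 1, 1 - expR (- d) <= e / (Psi + 1),
    forall x, `|expR (- d) * T d f x - f x| <= e &
    forall x, V x <= m -> `|T d psi x - psi x| <= e].
Proof.
move=> Cp C0 Fb0 Psi0 e0 fFb HC TFb.
have [d1 d10 Hd1] := T_time_uniform hT 0 m Cp e0.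
pose k := Num.min (Num.min (d1 / 2) 2^-1) (Num.min (e / (C + Fb + 1)) (e / (Psi + 1))).
have C1 : 0 < C + Fb + 1 by lra.
have P1 : 0 < Psi + 1 by lra.
have k0 : 0 < k.
  by rewrite !lt_min !divr_gt0//= invr_gt0 ltr0n.
have k1 : k <= d1 / 2 by rewrite !ge_min lexx.
have k2 : k <= 2^-1 by rewrite !ge_min lexx orbT.
have k3 : k <= e / (C + Fb + 1) by rewrite !ge_min lexx !orbT.
have k4 : k <= e / (Psi + 1) by rewrite !ge_min lexx !orbT.
clearbody k.
have ek1 : 1 - expR (- k) <= k by have := expR_ge1Dx (- k); lra.
have ek2 : expR (- k) <= 1 by rewrite -[leRHS]expR0 ler_expR oppr_le0 ltW.
exists k; split=> //; [lra|lra| |].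
- move=> x; rewrite ler_pdivlMr// in k3.
  have -> : expR (- k) * T k f x - f x = (T k f x - f x) - (1 - expR (- k)) * T k f x by ring.
  apply: le_trans (ler_normB _ _) _.
  have h1 : `|T k f x - f x| <= C * k by apply: HC; rewrite k0; lra.
  have h2 : `|(1 - expR (- k)) * T k f x| <= k * Fb.
    by rewrite normrM ger0_norm ?subr_ge0//; apply: ler_pM; rewrite ?subr_ge0// TFb// ltW.
  lra.
move=> x xm; have := Hd1 0 k x; rewrite (T0 hT Cp) lexx => /(_ isT (ltW k0)).
by rewrite sub0r normrN gtr0_norm// distrC => H; apply: H xm; lra.
Qed.

Lemma large_time (S e : R) : 0 <= S -> 0 < e -> exists2 L, 1 <= L & expR (- L) * S <= e.
Proof.
move=> S0 e0; have Se : 0 <= S / e by rewrite divr_ge0// ltW.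
exists (1 + S / e); first by rewrite lerDl.
have h : S / e <= expR (1 + S / e) by have := expR_ge1Dx (1 + S / e); lra.
by rewrite expRN mulrC ler_pdivrMr ?expR_gt0// mulrC -ler_pdivrMr.
Qed.

(** By tightness, replacing the source psi outside a large sublevel changes T(t) psi
    very little on a given one; the new source decays with its increments, hence so
    do T(t) psi' and its gradient. *)
Lemma close_source psi (Psi L m e : R) : Cb psi -> 0 <= Psi -> 0 < L -> 0 < e ->
  (forall x, `|psi x| <= Psi) -> exists psi' : E -> R, [/\ Cb psi',
    forall x, `|psi' x| <= Psi,
    forall t x, 0 <= t <= L -> V x <= m -> `|T t psi' x - T t psi x| <= e &
    exists k K : R, [/\ 0 <= k, 0 <= K,
      forall t x, 0 < t <= L -> `|T t psi' x| <= k * Vinv x &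
      forall t x i, 0 < t <= L -> `|partial i (T t psi') x| <= K * Vinv x]].
Proof.
move=> Cp Psi0 L0 e0 pP.
have [c c0 tight] := solution_tight fb B reg.
have e2 : 0 < e / 2 by rewrite divr_gt0.
pose W := expR (c * L) * (`|m| + 1).
have W0 : 0 < W by rewrite mulr_gt0 ?expR_gt0// ltr_wpDl.
pose M := 1 + 2 * Psi * W / (e / 2).
have PW : 0 <= 2 * Psi * W / (e / 2) by exact: divr_ge0 (mulr_ge0 (mulr_ge0 (ler0n _ 2) Psi0) (ltW W0)) (ltW e2).
have M1 : 1 <= M by rewrite /M lerDl.
have M0 : 0 < M by lra.
have [psi' [Cp' pP' near [k [Lam [k0 Lam0 pk pLam]]]]] := smoothed_source reg hT Cp pP M1 e2.
have decay := T_decay reg hT Cp' L0 k0 Lam0 pk pLam.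
exists psi'; split=> //.
move=> t x /andP[t0 tL] xm.
pose r y := -1 * psi y + psi' y; have Cr : Cb r by exact: Cb_lin.
have rM y : V y <= M -> `|r y| <= e / 2.
  by move=> yM; rewrite /r mulN1r addrC; exact: near.
have rH y : `|r y| <= 2 * Psi.
  rewrite /r mulN1r; apply: le_trans (ler_normD _ _) _; rewrite normrN.
  by have := pP y; have := pP' y; lra.
have P20 : 0 <= 2 * Psi by lra.
have := tight r (T^~ r) _ _ _ (T_solves hT Cr) M0 P20 (ltW e2) rH rM t x t0.
rewrite (T_lin hT _ _ Cp Cp' t0) mulN1r addrC => h; apply: le_trans h _.
have h1 : expR (c * t) * V x <= W.
  apply: ler_pM; rewrite ?expR_ge0 ?(ltW (V_gt0 x))//.
    by rewrite ler_expR ler_wpM2l.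
  by apply: le_trans xm _; apply: le_trans (ler_norm m) _; rewrite lerDl.
have h2 : 2 * Psi / M * (expR (c * t) * V x) <= 2 * Psi / M * W.
  by rewrite ler_wpM2l// divr_ge0// ltW.
have h3 : 2 * Psi / M * W <= e / 2.
  rewrite mulrAC ler_pdivrMr// [leRHS]mulrC -ler_pdivrMr//.
  by rewrite /M lerDr.
lra.
Qed.

End Approximation.

Section Approximation.
Context {R : realType} {n q : nat}.
Local Notation E := 'rV[R]_n.
Variables (fb : 'I_q -> 'I_n) (Q : E -> 'M[R]_q) (B : 'M[R]_n) (F : E -> 'rV[R]_q).
Hypothesis reg : regular_coefficients Q F.
Local Notation solves := (solves fb Q B F).
Local Notation A := (Aop fb Q B F).
Implicit Types (f g h psi : E -> R) (x y : E) (t s : R) (u : R -> E -> R).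
Variable T : R -> (E -> R) -> E -> R.
Hypothesis hT : forall f, Cb f -> solves f (T^~ f) /\
  forall u, solves f u -> forall t x, 0 <= t -> u t x = T t f x.

Lemma large_cutoff (C k K e m : R) : 0 <= C -> 0 <= k -> 0 <= K -> 0 < e ->
  exists M e', [/\ 1 <= M, m <= M, 0 < e' & C * (k / M + e' + K / (e' * M)) <= e].
Proof.
move=> C0 k0 K0 e0; have C1 : 0 < 3 * (C + 1) by lra.
pose e' := e / (3 * (C + 1)); have e'0 : 0 < e' by rewrite divr_gt0.
have S0 : 0 <= k + K / e' by rewrite addr_ge0// divr_ge0// ltW.
pose M := 1 + `|m| + (k + K / e') / e'.
have Se : 0 <= (k + K / e') / e' by rewrite divr_ge0// ltW.
have m0 := normr_ge0 m.
have M1 : 1 <= M by rewrite /M; lra.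
have M0 : 0 < M by lra.
exists M, e'; split=> //; first by rewrite /M; have := ler_norm m; lra.
have h : k / M + K / (e' * M) <= e'.
  have -> : k / M + K / (e' * M) = (k + K / e') / M by field; rewrite !gt_eqF.
  rewrite ler_pdivrMr// [leRHS]mulrC -ler_pdivrMr// /M lerDr; lra.
apply: (@le_trans _ _ (C * (2 * e'))); first by rewrite ler_wpM2l//; lra.
have -> : C * (2 * e') = e * (2 * C / (3 * (C + 1))) by rewrite /e'; field; rewrite gt_eqF//; lra.
by rewrite ler_piMr ?(ltW e0)// ler_pdivrMr//; lra.
Qed.

Lemma norm_budget_f (e a b c d w : R) : `|c - d + b| <= e -> `|a - b| <= e ->
  `|d - w| <= e -> `|c| <= e -> `|a - w| <= 5 * e.
Proof.
rewrite !ler_norml => /andP[? ?] /andP[? ?] /andP[? ?] /andP[? ?].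
by apply/andP; split; lra.
Qed.

Lemma norm_budget_g (e a b c d w z u v : R) : `|c - (w - d) - (b - a)| <= e ->
  `|a - u| <= 5 * e -> `|c| <= e -> `|w - z| <= e -> `|z - v| <= e -> `|d| <= e ->
  `|b - (u - v)| <= 10 * e.
Proof.
rewrite !ler_norml => /andP[? ?] /andP[? ?] /andP[? ?] /andP[? ?] /andP[? ?] /andP[? ?].
by apply/andP; split; lra.
Qed.

Lemma norm_budget_A (e p a b c d : R) : `|c - d - (b - a)| <= e ->
  `|c| <= p -> `|d| <= p -> `|a| <= p -> `|b| <= 3 * p + e.
Proof.
rewrite !ler_norml => /andP[? ?] /andP[? ?] /andP[? ?] /andP[? ?].
by apply/andP; split; lra.
Qed.

Lemma norm_budget_h (p : R) : 0 <= p -> 1 * p <= 3 * p + 1.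
Proof. lra. Qed.

Lemma norm_budget_phi (e p : R) : e <= 1 / 10 -> e + (3 * p + e) <= 3 * p + 1.
Proof. lra. Qed.

Lemma div_succ_le (e p : R) : 0 <= e -> 0 <= p -> e / (p + 1) * p <= e.
Proof.
by move=> e0 p0; rewrite mulrAC -mulrA ler_piMr// ler_pdivrMr; lra.
Qed.

Lemma two_steps (e L d : R) : 0 < e -> 1 <= L -> 0 < d -> 2 * (e / (2 * L)) * (L - d) <= e.
Proof.
move=> e0 L1 d0; have L0 : 0 < L by lra.
have -> : 2 * (e / (2 * L)) * (L - d) = e * ((L - d) / L) by field; rewrite gt_eqF.
by rewrite ler_piMr ?(ltW e0)// ler_pdivrMr//; lra.
Qed.

(** The discrete form of f = R(1, A) (f - A f): the derivative of exp(-t) T(t) f is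
    - exp(-t) T(t) psi, so the increments of this function along the mesh add up to
    the Riemann sum. *)
Lemma resolvent_approx_inverse f g psi d L P (d1 e1 : R) x : generates T f g ->
  (forall y, psi y = f y - g y) -> Cb psi -> 0 < d -> d < L -> (0 < P)%N ->
  (L - d) / P%:R < d1 ->
  (forall t s, d <= t <= L -> 0 < s -> `|t - s| < d1 ->
     `|T t f x - T s f x| <= e1 /\ `|T t g x - T s g x| <= e1) ->
  `|expR (- L) * T L f x - expR (- d) * T d f x + resolvent_approx T d L P psi x|
     <= 2 * e1 * (L - d).
Proof.
move=> gen psiE Cp d0 dL P0 Pd H; have [Cf Cg _ _] := gen.
have dT (s : R) (s0 : 0 < s) := generates_derive reg hT x gen s0.
have := mesh_estimate d0 dL P0 Pd dT H.
have -> // : \sum_(k < P) weight d L P k * (T (node d L P k) g x - T (node d L P k) f x) =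
    - resolvent_approx T d L P psi x.
  rewrite /resolvent_approx -sumrN; apply: eq_bigr => k _.
  have /andP[dn _] := node_bounds dL P0 (ltnW (ltn_ord k)).
  have n0 : 0 <= node d L P k by apply: le_trans dn; exact: ltW.
  have -> : psi = fun y => -1 * g y + f y by apply/funext => y; rewrite psiE; ring.
  by rewrite (T_lin hT _ _ Cg Cf n0); ring.
by rewrite opprK.
Qed.

(** If f is in the domain and g = A f, then f = R(1, A) psi with psi = f - g. The
    source psi is replaced by one with compact support, the resolvent by a Riemann
    sum h, which is of class C^2, and h by its product with a cutoff theta. On the
    sublevel of 2 M where theta lives, A h is close to h - psi' for a fine mesh;
    A (theta h) - theta A h is small for M large because h and its gradient decay
    at a rate that depends on psi' and L, but not on the mesh. This dictates the
    order of the choices: d, L, psi', M, and the mesh last. *)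
Lemma smooth_approximation f g : generates T f g -> exists2 K, 0 <= K & forall m e, 0 < e <= 1 ->
  exists phi : E -> R, [/\ classC 2 phi, exists M, outside_zero M phi,
    forall x, `|phi x| <= K, forall x, `|A phi x| <= K &
    forall x, V x <= m -> `|phi x - f x| <= e /\ `|A phi x - g x| <= e].
Proof.
move=> gen; have [Cf Cg loc [C C0 HC]] := gen.
have [_ /bounded_fun_abs[Fb HFb]] := Cf; have [_ /bounded_fun_abs[Gb HGb]] := Cg.
have Fb0 : 0 <= Fb by apply: le_trans (HFb 0).
have Gb0 : 0 <= Gb by apply: le_trans (HGb 0).
pose psi y := -1 * g y + f y; have Cp : Cb psi by exact: Cb_lin.
have psiE y : psi y = f y - g y by rewrite /psi; ring.
pose Psi := Fb + Gb; have Psi0 : 0 <= Psi by exact: addr_ge0.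
have pP x : `|psi x| <= Psi by rewrite psiE; apply: le_trans (ler_normB _ _) _; exact: lerD.
have [CC CC0 HCC] := cutoff_estimate fb B reg.
(* Up to small errors, A h = h + exp(-L) T(L) psi' - exp(-d) T(d) psi'. *)
exists (3 * Psi + 1); first lra.
move=> m e /andP[e0 e1]; pose ep := e / 10; have ep0 : 0 < ep by rewrite divr_gt0.
have TFb t x : 0 <= t -> `|T t f x| <= Fb by exact: (T_abs_le reg hT x Cf HFb).
have [d [d0 d1 hd hdf hdp]] := small_start hT m Cp C0 Fb0 Psi0 ep0 HFb HC TFb.
have FP0 : 0 <= Fb + Psi by exact: addr_ge0.
have [L L1 HL] := large_time FP0 ep0.
have L0 : 0 < L := lt_le_trans ltr01 L1.
have dL : d < L := lt_le_trans d1 L1.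
have [psi' [Cp' pP' near [k [K [k0 K0 hk hK]]]]] := close_source reg hT m Cp Psi0 L0 ep0 pP.
have [M [e' [M1 mM e'0 HM]]] := large_cutoff m CC0 k0 (sqr_ge0 K) ep0.
have M0 : 0 < M := lt_le_trans ltr01 M1.
(* The error of the Riemann sums is 2 e2 (L - d). *)
pose e2 := ep / (2 * L); have e20 : 0 < e2 by rewrite divr_gt0 ?mulr_gt0.
have [a1 a10 H1] := T_time_uniform hT L (2 * M) Cp' e20.
have [a2 a20 H2] := T_derivative_uniform hT L (2 * M) Cp' d0 e20.
have [a3 a30 H3] := T_time_uniform hT L m Cf e20.
have [a4 a40 H4] := T_time_uniform hT L m Cg e20.
pose a := Num.min (Num.min a1 a2) (Num.min a3 a4).
have a0 : 0 < a by rewrite !lt_min a10 a20 a30 a40.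
have [aa1 aa2 aa3 aa4] : [/\ a <= a1, a <= a2, a <= a3 & a <= a4].
  by split; rewrite !ge_min lexx ?orbT.
clearbody a.
have Ld : 0 <= L - d by rewrite subr_ge0 ltW.
have [P P0 HP] := mesh_size Ld a0.
have small := two_steps ep0 L1 d0; rewrite -/e2 in small.
have tpos t : d <= t <= L -> 0 <= t <= L.
  by move=> /andP[dt ->]; rewrite (le_trans (ltW d0) dt).
have E1 x : V x <= m ->
    `|expR (- L) * T L f x - expR (- d) * T d f x + resolvent_approx T d L P psi x| <= ep.
  move=> xm; apply: le_trans small.
  apply: (resolvent_approx_inverse gen psiE Cp d0 dL P0 HP) => t s tL s0 ts.
  split; [apply: H3 => //|apply: H4 => //]; rewrite ?tpos ?(ltW s0)//; exact: lt_le_trans ts _.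
set h := resolvent_approx T d L P psi'.
have [Ch Ah] := resolvent_approx_C2 hT d0 dL P0 Cp'; rewrite -/h in Ch Ah.
have E2 x : V x <= 2 * M ->
    `|expR (- L) * T L psi' x - expR (- d) * T d psi' x - (A h x - h x)| <= ep.
  move=> xM; apply: le_trans small.
  have -> : A h x - h x = \sum_(k < P) weight d L P k *
     (A (T (node d L P k) psi') x - T (node d L P k) psi' x).
    by rewrite Ah /h /resolvent_approx -sumrB; apply: eq_bigr => j _; rewrite mulrBr.
  apply: (mesh_estimate d0 dL P0 HP (U := fun t => T t psi' x)
     (G := fun t => A (T t psi') x)) => [s s0|t s tL s0 ts].
    exact: solves_dt x (T_solves hT Cp') s0.
  split; [apply: H1 => //; rewrite ?tpos ?(ltW s0)//|apply: H2 => //]; exact: lt_le_trans ts _.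
have nodeL (j : 'I_P) : 0 < node d L P j <= L.
  have /andP[dn ->] := node_bounds dL P0 (ltnW (ltn_ord j)).
  by rewrite (lt_le_trans d0 dn).
have E3 x : V x <= m -> `|h x - resolvent_approx T d L P psi x| <= ep.
  move=> xm; rewrite /h /resolvent_approx -sumrB.
  under eq_bigr do rewrite -mulrBr.
  apply: (weighted_sum_le d0 dL P0 (ltW ep0)) => j; have /andP[j0 jL] := nodeL j.
  by apply: near => //; rewrite (ltW j0).
have hP x : `|h x| <= Psi.
  apply: (weighted_sum_le d0 dL P0 Psi0) => j; have /andP[j0 jL] := nodeL j.
  exact (T_abs_le reg hT x Cp' pP' (ltW j0)).
have hkV x : `|h x| <= k * Vinv x.
  apply: (weighted_sum_le d0 dL P0); first by rewrite mulr_ge0// ltW// Vinv_gt0.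
  by move=> j; exact: hk.
have hKV i x : partial i h x ^+ 2 <= K ^+ 2 * Vinv2 x.
  have KV0 : 0 <= K * Vinv x by rewrite mulr_ge0// ltW// Vinv_gt0.
  have : `|partial i h x| <= K * Vinv x.
    rewrite (resolvent_approx_partial hT i x d0 dL P0 Cp').
    by apply: (weighted_sum_le d0 dL P0) => // j; exact: hK.
  have -> : K ^+ 2 * Vinv2 x = (K * Vinv x) ^+ 2 by rewrite /Vinv2; ring.
  by move=> h1; rewrite -real_normK ?num_real// ler_pXn2r ?nnegrE.
have eL : 0 <= expR (- L) := expR_ge0 _.
have ed : 0 <= 1 - expR (- d).
  by rewrite subr_ge0 -[leRHS]expR0 ler_expR oppr_le0 ltW.
have edP : (1 - expR (- d)) * Psi <= ep.
  apply: (@le_trans _ _ (ep / (Psi + 1) * Psi)); first by rewrite ler_wpM2r.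
  exact: div_succ_le (ltW ep0) Psi0.
have LT (w : R) (c : R) : 0 <= c <= Fb + Psi -> `|w| <= c -> `|expR (- L) * w| <= ep.
  move=> /andP[c0 cF] wc; rewrite normrM ger0_norm//; apply: le_trans HL.
  by rewrite ler_wpM2l// (le_trans wc).
have h_f x : V x <= m -> `|h x - f x| <= 5 * ep.
  move=> xm; have p1 := E1 x xm; have p2 := E3 x xm; have p3 := hdf x.
  have p4 : `|expR (- L) * T L f x| <= ep.
    by apply: (LT _ Fb); rewrite ?Fb0 ?lerDl//; apply: TFb; exact: ltW.
  exact: norm_budget_f p1 p2 p3 p4.
have TLp x : `|expR (- L) * T L psi' x| <= ep.
  apply: (LT _ Psi); first by rewrite Psi0 lerDr.
  exact (T_abs_le reg hT x Cp' pP' (ltW L0)).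
have A_g x : V x <= m -> `|A h x - g x| <= 10 * ep.
  move=> xm; have p1 := E2 x; have p2 := h_f x xm; have p3 := TLp x.
  have xM : V x <= 2 * M by apply: (le_trans xm); apply: (le_trans mM); rewrite ler_peMl ?(ltW M0)// ler1n.
  have p4 : `|T d psi' x - T d psi x| <= ep by apply: near => //; rewrite (ltW d0) ltW.
  have p5 := hdp x xm.
  have p6 : `|(1 - expR (- d)) * T d psi' x| <= ep.
    apply: le_trans edP; rewrite normrM ger0_norm// ler_wpM2l//.
    exact (T_abs_le reg hT x Cp' pP' (ltW d0)).
  have -> : g x = f x - psi x by rewrite psiE opprB addrC subrK.
  move: (p1 xM); have -> : expR (- d) * T d psi' x = T d psi' x - (1 - expR (- d)) * T d psi' x.
    by rewrite mulrBl mul1r opprB addrC subrK.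
  by move=> p1'; exact: norm_budget_g p1' p2 p3 p4 p5 p6.
have eE : 10 * ep = e by rewrite /ep; field.
exists (fun x => theta M x * h x); split.
- exact: classC_mul (classC_theta M) Ch.
- exists (2 * M) => x xM.
  by rewrite /theta; have [-> _ _] := cut_outer M0 (ltW xM); rewrite mul0r.
- move=> x; have [/andP[t0 t1] _ _] := cut_bounds M0 (V x).
  rewrite normrM (ger0_norm t0); apply: (@le_trans _ _ (1 * Psi)); last exact: norm_budget_h.
  exact: ler_pM.
- move=> x; have [/andP[t0 t1] _ _] := cut_bounds M0 (V x).
  have := HCC M h k (K ^+ 2) e' M1 Ch k0 (sqr_ge0 K) e'0 hkV hKV x.
  move=> /le_trans /(_ HM) q1.
  have q2 : `|theta M x * A h x| <= 3 * Psi + ep.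
    have [xM|xM] := leP (V x) (2 * M); last first.
      rewrite /theta; have [-> _ _] := cut_outer M0 (ltW xM); rewrite mul0r normr0.
      exact: addr_ge0 (mulr_ge0 (ler0n _ 3) Psi0) (ltW ep0).
    rewrite normrM (ger0_norm (x := theta M x))//; apply: (@le_trans _ _ (1 * (3 * Psi + ep))); last by rewrite mul1r.
    apply: ler_pM => //.
    have p2 : `|expR (- L) * T L psi' x| <= Psi.
      rewrite normrM ger0_norm//; apply: (@le_trans _ _ (1 * Psi)); last by rewrite mul1r.
      apply: ler_pM => //; last exact (T_abs_le reg hT x Cp' pP' (ltW L0)).
      by rewrite -[leRHS]expR0 ler_expR oppr_le0 ltW.
    have p3 : `|expR (- d) * T d psi' x| <= Psi.
      rewrite normrM ger0_norm ?expR_ge0//; apply: (@le_trans _ _ (1 * Psi)); last by rewrite mul1r.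
      apply: ler_pM => //; [by rewrite -subr_ge0|exact (T_abs_le reg hT x Cp' pP' (ltW d0))].
    exact: norm_budget_A (E2 x xM) p2 p3 (hP x).
  rewrite -[X in `|X|](subrK (theta M x * A h x)); apply: le_trans (ler_normD _ _) _.
  apply: le_trans (lerD q1 q2) _; have ep1 : ep <= 1 / 10 by rewrite ler_pM2r ?invr_gt0.
  exact: norm_budget_phi.
move=> x xm; have xM := le_trans xm mM.
rewrite Aop_theta_inner// /theta; have [-> _ _] := cut_inner M0 xM; rewrite mul1r -eE.
by split; [apply: le_trans (h_f x xm) _; rewrite ler_pM2r// ler_nat|exact: A_g].
Qed.

End Approximation.

(** * Integration of continuous functions with compact support *)

Section OneDimension.
Context {R : realType}.
Implicit Types (f g h : R -> R) (c K : R).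
Local Notation mu := (@lebesgue_measure R).

Lemma integrable_seg h c : continuous h -> mu.-integrable `[(- c), c] (EFin \o h).
Proof.
move=> ch; apply: continuous_compact_integrable; first exact: segment_compact.
exact: continuous_subspaceT.
Qed.

Lemma Rintegral_seg h c : (forall t, c < `|t| -> h t = 0) ->
  \int[mu]_t h t = \int[mu]_(t in `[(- c), c]) h t.
Proof.
move=> h0; rewrite [RHS]Rintegral_mkcond; congr (Rintegral _ _ _).
apply/funext => t; rewrite patchE; case: ifPn => // tc.
apply: h0; rewrite ltNge; apply: contra tc => tc.
by rewrite inE /= in_itv /= -ler_norml.
Qed.

Lemma Rintegral_lin h g (a c : R) : continuous h -> continuous g ->
  (forall t, c < `|t| -> h t = 0) -> (forall t, c < `|t| -> g t = 0) ->
  \int[mu]_t (a * h t + g t) = a * \int[mu]_t h t + \int[mu]_t g t.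
Proof.
move=> ch cg h0 g0.
have hg0 t : c < `|t| -> a * h t + g t = 0 by move=> tc; rewrite h0// g0// mulr0 addr0.
have cah : continuous (fun t => a * h t) by move=> t; exact: (cvgM (cvg_cst a) (ch t)).
rewrite (Rintegral_seg hg0) (Rintegral_seg h0) (Rintegral_seg g0) RintegralD//; last 2 first.
- exact: integrable_seg.
- exact: integrable_seg.
by rewrite RintegralZl//; exact: integrable_seg.
Qed.

Lemma Rintegral_bound h c K : 0 <= c -> continuous h -> (forall t, c < `|t| -> h t = 0) ->
  (forall t, `|h t| <= K) -> `|\int[mu]_t h t| <= 2 * c * K.
Proof.
move=> c0 ch h0 hK; rewrite (Rintegral_seg h0).
apply: le_trans (le_normr_Rintegral _ _) _ => //; first exact: integrable_seg.
have cn : continuous (fun t => `|h t|).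
  by move=> t; apply: continuous_comp; [exact: ch|exact: norm_continuous].
apply: (@le_trans _ _ (\int[mu]_(t in `[(- c), c]) K)).
  by apply: le_Rintegral => //; apply: integrable_seg => //; exact: cst_continuous.
rewrite Rintegral_cst//= lebesgue_measure_itv /=; case: ifPn => _.
  by rewrite -EFinD /= opprK; have -> : 2 * c * K = K * (c + c) by ring.
have K0 : 0 <= K by apply: le_trans (hK 0).
by rewrite mulr0 !mulr_ge0.
Qed.

Lemma Rintegral_derive (h h' : R -> R) c : 0 <= c -> continuous h' ->
  (forall t : R, is_derive t 1 h (h' t)) -> (forall t, c < `|t| -> h t = 0) ->
  (forall t, c < `|t| -> h' t = 0) -> \int[mu]_t h' t = 0.
Proof.
move=> c0 ch' dh h0 h'0; have c1 : - (c + 1) < c + 1 by lra.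
have ch : continuous h.
  by move=> t; apply: differentiable_continuous; apply/derivable1_diffP; have [] := dh t.
rewrite (@Rintegral_seg h' (c + 1)); last by move=> t tc; apply: h'0; apply: lt_trans tc; rewrite ltrDl.
rewrite /Rintegral (continuous_FTC2 (F := h) c1); first last.
- by move=> t _; rewrite derive1E; have [_ ->] := dh t.
- split; first by move=> t _; have [] := dh t.
    exact: cvg_at_right_filter (ch _).
  exact: cvg_at_left_filter (ch _).
- exact: continuous_subspaceT.
have c1n : `|c + 1| = c + 1 by rewrite ger0_norm//; lra.
have cc1 : c < `|c + 1| by rewrite c1n; lra.
have cc2 : c < `|- (c + 1)| by rewrite normrN.
by rewrite (h0 _ cc1) (h0 _ cc2) /= subrr.
Qed.

End OneDimension.

Section Slices.
Context {R : realType}.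
Implicit Types (c K : R).

(** Continuous functions supported in a cube of side 2 c. *)
Definition Cc n c (f : 'rV[R]_n -> R) : Prop :=
  continuous f /\ forall x, c < `|x| -> f x = 0.

(** The splitting of a vector along which the integral is iterated. *)
Definition join m (t : R) (y : 'rV[R]_m) : 'rV[R]_m.+1 :=
  row_mx (t%:M : 'rV[R]_1) y.

Lemma join0 m t (y : 'rV[R]_m) : join t y 0 ord0 = t.
Proof.
rewrite /join (_ : ord0 = lshift m (ord0 : 'I_1)); last exact: val_inj.
by rewrite (@row_mxEl _ 1 1 m) mxE eqxx.
Qed.

Lemma joinS m t (y : 'rV[R]_m) k : join t y 0 (lift ord0 k) = y 0 k.
Proof.
rewrite /join (_ : lift ord0 k = rshift 1 k); last exact: val_inj.
by rewrite (@row_mxEr _ 1 1 m).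
Qed.

Lemma joinP m (x z : 'rV[R]_m.+1) : x 0 ord0 = z 0 ord0 ->
  (forall k, x 0 (lift ord0 k) = z 0 (lift ord0 k)) -> x = z.
Proof.
move=> h0 hS; apply/rowP => i; have [->//|[k ->]] : i = ord0 \/ exists k, i = lift ord0 k.
  by case: (unliftP ord0 i) => [k|] ->; [right; exists k|left].
exact: hS.
Qed.

Lemma join_norm m t (y : 'rV[R]_m) : `|join t y| <= Num.max `|t| `|y|.
Proof.
apply: rV_norm_le => [|i]; first by rewrite le_max normr_ge0.
case: (unliftP ord0 i) => [k|] ->; rewrite ?join0 ?joinS le_max ?lexx//.
by rewrite coord_le_rV_norm orbT.
Qed.

Lemma norm_join_t m t (y : 'rV[R]_m) : `|t| <= `|join t y|.
Proof. by rewrite -{1}(join0 t y) coord_le_rV_norm. Qed.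

Lemma norm_join_y m t (y : 'rV[R]_m) : `|y| <= `|join t y|.
Proof.
by apply: rV_norm_le => // k; rewrite -(joinS t y) coord_le_rV_norm.
Qed.

Lemma joinB m t s (y z : 'rV[R]_m) : join t y - join s z = join (t - s) (y - z).
Proof.
have sub k (a b : 'rV[R]_k) i : (a - b) 0 i = a 0 i - b 0 i by rewrite !mxE.
by apply: joinP => [|k]; rewrite sub ?join0 ?joinS ?sub.
Qed.

Lemma norm_sublevel n c (x : 'rV[R]_n) : `|x| <= c -> V x <= 1 + \sum_(i < n) c ^+ 2.
Proof.
move=> xc; rewrite /V lerD2l; apply: ler_sum => i _.
have h := le_trans (coord_le_rV_norm x i) xc.
by rewrite -real_normK ?num_real// ler_pXn2r ?nnegrE ?(le_trans (normr_ge0 _) h).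
Qed.

Lemma Cc_uniform n c (f : 'rV[R]_n -> R) e : Cc c f -> 0 < e ->
  exists2 d, 0 < d & forall x z : 'rV[R]_n, `|x - z| < d -> `|f x - f z| <= e.
Proof.
move=> [cf f0] e0; have inM (x : 'rV[R]_n) := @norm_sublevel n c x.
have [d d0 Hd] := compact_uniform (@compact_sublevel R n (1 + \sum_(i < n) c ^+ 2))
  (fun x _ => cf x) e0.
exists d => // x z xz.
have [xc|xc] := leP `|x| c; first by apply: (Hd x z (inM x xc)); rewrite -ball_normE.
have [zc|zc] := leP `|z| c.
  by rewrite distrC; apply: (Hd z x (inM z zc)); rewrite -ball_normE /= distrC.
by rewrite !f0// subrr normr0 ltW.
Qed.

Lemma Cc_slice m c (f : 'rV[R]_m.+1 -> R) t : Cc c f -> Cc c (fun y => f (join t y)).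
Proof.
move=> Cf; have [cf f0] := Cf; split; last first.
  by move=> y yc; apply: f0; apply: lt_le_trans yc (norm_join_y t y).
move=> y; apply: (@continuous_comp _ _ _ (join t) f); last exact: cf.
move=> S /nbhs_ballP[e /= e0 He].
have k : nbhs y (fun z => S (join t z)).
  apply/nbhs_ballP; exists e => // z; rewrite -ball_normE /= => yz.
  apply: He; rewrite -ball_normE /= joinB subrr; apply: le_lt_trans (join_norm _ _) _.
  by rewrite normr0 gt_max e0.
exact: k.
Qed.

Lemma Cc_lin n c a (f g : 'rV[R]_n -> R) : Cc c f -> Cc c g -> Cc c (fun x => a * f x + g x).
Proof.
move=> [cf f0] [cg g0]; split; last by move=> x xc; rewrite f0// g0// mulr0 addr0.
by move=> x; exact: (cvgD (cvgM (cvg_cst a) (cf x)) (cg x)).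
Qed.

Lemma Cc_mul n c (a f : 'rV[R]_n -> R) : continuous a -> Cc c f -> Cc c (fun x => a x * f x).
Proof.
move=> ca [cf f0]; split; last by move=> x xc; rewrite f0// mulr0.
by move=> x; exact: (cvgM (ca x) (cf x)).
Qed.

Lemma Cc_partial n c (f : 'rV[R]_n -> R) i : classC 1 f -> Cc c f -> Cc c (partial i f).
Proof.
move=> C1 [_ f0]; split; first exact: classC_cont (classC_partial i C1).
apply: (partial_zero_open i (U := [set x | c < `|x|]) _ f0).
by apply: (@open_comp _ _ (fun x : 'rV[R]_n => `|x|) [set y | c < y]);
  [move=> x _; exact: norm_continuous|exact: open_gt].
Qed.

Lemma rV_integralS m (f : 'rV[R]_m.+1 -> R) :
  rV_integral f = \int[lebesgue_measure]_t rV_integral (fun y => f (join t y)).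
Proof. by []. Qed.

(** Linearity and the volume bound are proved together, by induction on the
    dimension: in dimension n they make the integrals over slices continuous, which
    gives the integrability needed in dimension n + 1. *)
Definition well_behaved n := forall c : R, 0 <= c ->
  (forall a (f g : 'rV[R]_n -> R), Cc c f -> Cc c g ->
     rV_integral (fun x => a * f x + g x) = a * rV_integral f + rV_integral g) /\
  (forall (f : 'rV[R]_n -> R) K, Cc c f -> (forall x, `|f x| <= K) ->
     `|rV_integral f| <= (2 * c) ^+ n * K).

Lemma slice_integral_continuous m c (f : 'rV[R]_m.+1 -> R) : well_behaved m ->
  0 <= c -> Cc c f -> continuous (fun t => rV_integral (fun y => f (join t y))).
Proof.
move=> W c0 Cf t; have [lin bnd] := W c c0.
have c2 : 0 <= (2 * c) ^+ m by rewrite exprn_ge0// mulr_ge0.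
apply/cvgrPdist_le => e e0.
pose k := (2 * c) ^+ m + 1; have k0 : 0 < k by rewrite /k; lra.
have ek : 0 < e / k by rewrite divr_gt0.
have [d d0 Hd] := Cc_uniform Cf ek.
apply/nbhs_ballP; exists d => //= s; rewrite /ball /= => ts.
have -> : rV_integral (fun y => f (join t y)) - rV_integral (fun y => f (join s y)) =
    rV_integral (fun y => -1 * f (join s y) + f (join t y)).
  by rewrite (lin (-1) _ _ (Cc_slice s Cf) (Cc_slice t Cf)); ring.
apply: (@le_trans _ _ ((2 * c) ^+ m * (e / k))).
  apply: bnd; first exact: Cc_lin (Cc_slice s Cf) (Cc_slice t Cf).
  move=> y; rewrite mulN1r addrC; apply: Hd; rewrite joinB subrr.
  by apply: le_lt_trans (join_norm _ _) _; rewrite normr0 gt_max ts d0.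
by rewrite mulrCA ler_piMr ?(ltW e0)// ler_pdivrMr// mul1r /k lerDl.
Qed.

Lemma slice_integral_zero m c (f : 'rV[R]_m.+1 -> R) t : well_behaved m ->
  0 <= c -> Cc c f -> c < `|t| -> rV_integral (fun y => f (join t y)) = 0.
Proof.
move=> W c0 Cf tc; have [lin bnd] := W c c0.
apply/eqP; rewrite -normr_le0 -[leRHS](mulr0 ((2 * c) ^+ m)).
apply: bnd; first exact: Cc_slice.
move=> y; have [_ ->] := Cf; first by rewrite normr0.
exact: lt_le_trans tc (norm_join_t t y).
Qed.

Lemma rV_integral_well_behaved n : well_behaved n.
Proof.
elim: n => [|m W] c c0.
  by split => [//|f K Cf fK]; rewrite expr0 mul1r; exact: fK.
have [lin bnd] := W c c0; split.
  move=> a f g Cf Cg; rewrite !rV_integralS.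
  rewrite -(Rintegral_lin a (slice_integral_continuous W c0 Cf)
    (slice_integral_continuous W c0 Cg) (fun t => slice_integral_zero W c0 Cf)
    (fun t => slice_integral_zero W c0 Cg)).
  congr (Rintegral _ _ _); apply/funext => t.
  exact: lin (Cc_slice t Cf) (Cc_slice t Cg).
move=> f K Cf fK; rewrite rV_integralS exprS -mulrA.
apply: (Rintegral_bound c0 (slice_integral_continuous W c0 Cf)
  (fun t => slice_integral_zero W c0 Cf)) => t.
by apply: bnd; first exact: Cc_slice.
Qed.

End Slices.

Section Divergence.
Context {R : realType}.
Implicit Types (c : R).

Lemma join_shift0 m (t s : R) (y : 'rV[R]_m) :
  s *: 'e_ord0 + join t y = join (t + s) y.
Proof.
have sub k (a b : 'rV[R]_k) i : (s *: a + b) 0 i = s * a 0 i + b 0 i by rewrite !mxE.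
apply: joinP => [|k]; rewrite sub ?join0 ?joinS mxE eqxx /= ?mulr1 ?mulr0 ?add0r//.
exact: addrC.
Qed.

Lemma join_shiftS m (t s : R) (y : 'rV[R]_m) k :
  s *: 'e_(lift ord0 k) + join t y = join t (s *: 'e_k + y).
Proof.
have sub l (a b : 'rV[R]_l) i : (s *: a + b) 0 i = s * a 0 i + b 0 i by rewrite !mxE.
apply: joinP => [|l]; rewrite sub ?join0 ?joinS ?sub !(mxE, eqxx) /= ?mulr0 ?add0r//.
Qed.

Lemma partial_slice m (G : 'rV[R]_m.+1 -> R) t y k : classC 1 G ->
  is_derive y 'e_k (fun y => G (join t y)) (partial (lift ord0 k) G (join t y)).
Proof.
move=> C1; apply/lineE.
rewrite (_ : (fun s => _) = fun s : R => G (s *: 'e_(lift ord0 k) + join t y)); last first.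
  by apply/funext => s; rewrite join_shiftS.
exact: (proj1 (lineE _ _ _ _) (classC_derive (join t y) (lift ord0 k) C1)).
Qed.

(** Differentiation under the integral sign: the difference quotients converge
    uniformly on the slices, because the partial derivative is uniformly
    continuous. *)
Lemma slice_derive m (G : 'rV[R]_m.+1 -> R) c (t : R) : 0 <= c -> classC 1 G -> Cc c G ->
  is_derive t 1 (fun t : R => rV_integral (fun y => G (join t y)))
    (rV_integral (fun y => partial ord0 G (join t y))).
Proof.
move=> c0 C1 CG; have CdG := Cc_partial ord0 C1 CG.
have [lin bnd] := rV_integral_well_behaved m c0.
have c2 : 0 <= (2 * c) ^+ m by rewrite exprn_ge0// mulr_ge0.
apply: eps_is_derive => e e0.
pose k := (2 * c) ^+ m + 1; have k0 : 0 < k by rewrite /k; lra.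
have ek : 0 < e / k by rewrite divr_gt0.
have [d d0 Hd] := Cc_uniform CdG ek; exists d => // s sd.
set D := fun y => partial ord0 G (join t y).
have CD : Cc c D := Cc_slice t CdG.
have CB := Cc_lin (-1) (Cc_slice t CG) (Cc_slice (t + s) CG).
rewrite (_ : _ - _ - _ = rV_integral (fun y => - s * D y + (-1 * G (join t y) + G (join (t + s) y)))); last first.
  by rewrite (lin (- s) _ _ CD CB) (lin (-1) _ _ (Cc_slice t CG) (Cc_slice (t + s) CG)); ring.
apply: (@le_trans _ _ ((2 * c) ^+ m * (e / k * `|s|))).
  apply: bnd; first exact: Cc_lin CD CB.
  move=> y; have dG (r : R) : is_derive r 1 (fun r => G (r *: 'e_ord0 + join t y))
      (partial ord0 G (r *: 'e_ord0 + join t y)).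
    by apply: is_derive_line; exact: classC_derive C1.
  have [xi xis] := MVT_abs s dG; rewrite scale0r add0r !join_shift0 => E.
  have -> : - s * D y + (-1 * G (join t y) + G (join (t + s) y)) =
      (partial ord0 G (join (t + xi) y) - D y) * s.
    by rewrite mulrBl -E; ring.
  rewrite normrM ler_wpM2r//; apply: Hd; rewrite joinB subrr addrAC subrr add0r.
  apply: le_lt_trans (join_norm _ _) _; rewrite normr0 gt_max d0 andbT.
  exact: le_lt_trans sd.
rewrite mulrA ler_wpM2r//.
by rewrite mulrCA ler_piMr ?(ltW e0)// ler_pdivrMr// mul1r /k lerDl.
Qed.

(** Along the first coordinate this is the fundamental theorem of calculus for the
    integrals over slices; along the other ones it holds slice by slice. *)
Lemma integral_partial n c i (G : 'rV[R]_n -> R) : 0 <= c -> classC 1 G -> Cc c G ->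
  rV_integral (partial i G) = 0.
Proof.
move=> c0; elim: n i G => [[]//|m IH] i G C1 CG; rewrite rV_integralS.
have CdG := Cc_partial i C1 CG.
have W := @rV_integral_well_behaved R m.
case: (unliftP ord0 i) => [k|] iE; rewrite iE in CdG *.
  rewrite (_ : (fun t => _) = fun=> 0); last first.
    apply/funext => t; have P y := is_derive_partial (partial_slice t y k C1).
    rewrite (_ : (fun y => _) = partial k (fun y => G (join t y))); last first.
      by apply/funext => y; rewrite P.
    apply: IH; last exact: Cc_slice CG.
    apply: (classC_is_derive (f' := fun j y => partial (lift ord0 j) G (join t y))).
    - by have [] := Cc_slice t CG.
    - by move=> j y; exact: partial_slice.
    - by move=> j; split=> //; have [] := Cc_slice t (Cc_partial (lift ord0 j) C1 CG).
  by rewrite Rintegral_cst// mul0r.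
apply: (Rintegral_derive c0 (slice_integral_continuous W c0 CdG)
  (fun t => slice_derive t c0 C1 CG) (fun t => slice_integral_zero W c0 CG)
  (fun t => slice_integral_zero W c0 CdG)).
Qed.

End Divergence.

(** * The operator in the sense of distributions *)

Section Duality.
Context {R : realType} {n : nat}.
Local Notation E := 'rV[R]_n.
Implicit Types (f g a phi : E -> R) (c : R).

Lemma rV_integralD c f g : 0 <= c -> Cc c f -> Cc c g ->
  rV_integral (fun x => f x + g x) = rV_integral f + rV_integral g.
Proof.
move=> c0 Cf Cg; have [lin _] := rV_integral_well_behaved n c0.
have := lin 1 f g Cf Cg; rewrite mul1r => <-; congr rV_integral.
by apply/funext => x; rewrite mul1r.
Qed.

Lemma Cc_add c f g : Cc c f -> Cc c g -> Cc c (fun x => f x + g x).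
Proof.
move=> Cf Cg; have := Cc_lin 1 Cf Cg.
by rewrite (_ : (fun x => 1 * f x + g x) = fun x => f x + g x)//; apply/funext => x; rewrite mul1r.
Qed.

Lemma Cc_sum c (I : Type) (s : seq I) (h : I -> E -> R) : 0 <= c -> (forall i, Cc c (h i)) ->
  Cc c (fun x => \sum_(i <- s) h i x) /\
  rV_integral (fun x => \sum_(i <- s) h i x) = \sum_(i <- s) rV_integral (h i).
Proof.
move=> c0 Ch; elim: s => [|i s [IH1 IH2]].
  have C0 : Cc c (fun _ : E => 0) by split=> //; exact: cst_continuous.
  rewrite (_ : (fun x => _) = fun=> 0); last by apply/funext => x; rewrite big_nil.
  split=> //; have [lin _] := rV_integral_well_behaved n c0.
  have := lin (-1) _ _ C0 C0; rewrite [in LHS]mulr0 addr0 => I0.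
  by rewrite big_nil I0 mulN1r addNr.
rewrite (_ : (fun x => _) = fun x => h i x + \sum_(j <- s) h j x); last first.
  by apply/funext => x; rewrite big_cons.
by rewrite big_cons -IH2; split; [exact: Cc_add|exact: rV_integralD IH1].
Qed.

Lemma integral_parts c i f g : 0 <= c -> classC 1 f -> classC 1 g -> Cc c g ->
  dist_of (partial i f) g = dist_partial i (dist_of f) g.
Proof.
move=> c0 Cf Cg Ccg; apply/eqP; rewrite -subr_eq0 opprK; apply/eqP.
have Cfg : Cc c (fun x => f x * g x) by apply: Cc_mul => //; exact: classC_cont Cf.
have C1 := classC_mul Cf Cg.
rewrite -[RHS](integral_partial i c0 C1 Cfg) /dist_of.
rewrite -(rV_integralD (c := c))//; last 2 first.
- by apply: Cc_mul => //; exact: classC_cont (classC_partial i Cf).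
- by apply: Cc_mul; [exact: classC_cont Cf|exact: Cc_partial].
congr rV_integral; apply/funext => x; rewrite partial_mul//.
by rewrite addrC; congr (_ + _); exact: mulrC.
Qed.

Lemma dist_of_cvg c (fn : nat -> E -> R) f phi : 0 <= c -> (forall k, continuous (fn k)) ->
  continuous f -> locally_uniform fn f -> Cc c phi ->
  (fun k => dist_of (fn k) phi) @ \oo --> dist_of f phi.
Proof.
move=> c0 cfn cf lu Cp; have [lin bnd] := rV_integral_well_behaved n c0.
have [cp p0] := Cp.
pose M := 1 + \sum_(i < n) c ^+ 2.
have inM (x : E) : `|x| <= c -> V x <= M by exact: norm_sublevel.
have [K K0 HK] := continuous_sublevel_bounded M cp.
apply/cvgrPdist_le => e e0.
pose k := (2 * c) ^+ n * K + 1.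
have k0 : 0 < k by rewrite /k ltr_wpDl// mulr_ge0// exprn_ge0// mulr_ge0.
have ek : 0 < e / k by rewrite divr_gt0.
have [N HN] := lu M _ ek; exists N => // j /= Nj.
rewrite (_ : _ - _ = rV_integral (fun x => -1 * (fn j x * phi x) + f x * phi x)); last first.
  by rewrite (lin (-1) _ _ (Cc_mul (cfn j) Cp) (Cc_mul cf Cp)) /dist_of; ring.
apply: (@le_trans _ _ ((2 * c) ^+ n * (e / k * K))).
  apply: bnd; first exact: Cc_lin (Cc_mul (cfn j) Cp) (Cc_mul cf Cp).
  move=> x; have [xc|xc] := leP `|x| c; last first.
    by rewrite p0// !mulr0 addr0 normr0 mulr_ge0// ltW.
  have -> : -1 * (fn j x * phi x) + f x * phi x = - (fn j x - f x) * phi x by ring.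
  rewrite normrM normrN; apply: ler_pM => //; first exact: HN (inM x xc).
  exact: HK (inM x xc).
have -> : (2 * c) ^+ n * (e / k * K) = e * ((2 * c) ^+ n * K / k) by ring.
by rewrite ler_piMr ?(ltW e0)// ler_pdivrMr// mul1r /k lerDl.
Qed.

End Duality.

Section WeakOperator.
Context {R : realType} {n q : nat}.
Local Notation E := 'rV[R]_n.
Variables (fb : 'I_q -> 'I_n) (Q : E -> 'M[R]_q) (B : 'M[R]_n) (F : E -> 'rV[R]_q).
Hypothesis reg : regular_coefficients Q F.
Local Notation A := (Aop fb Q B F).
Implicit Types (f g phi : E -> R) (x : E) (c : R).

(** dist_opA for the abstract family fb. *)
Definition dist_Aop (u : (E -> R) -> R) : (E -> R) -> R := fun phi =>
  \sum_i \sum_j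
     dist_mul (fun x => Q x i j) (dist_partial (fb i) (dist_partial (fb j) u)) phi
  + \sum_i \sum_j dist_mul (fun x => B i j * x 0 j) (dist_partial i u) phi
  + \sum_j dist_mul (fun x => F x 0 j) (dist_partial (fb j) u) phi.

Let CQ i j : classC 2 (fun x => Q x i j).
Proof. by have [h _] := coef_classC reg; exact: h. Qed.

Let CF j : classC 2 (fun x => F x 0 j).
Proof. by have [_ h] := coef_classC reg; exact: h. Qed.

Let CB i j : classC 2 (fun x : E => B i j * x 0 j).
Proof. exact: classC_scale (classC_coord 2 j). Qed.

Lemma Aop_continuous f : classC 2 f -> continuous (A f).
Proof.
move=> Cf; have C0 g : classC 2 g -> classC 0 g by exact: classC_le.
have C1 k : classC 0 (partial k f) := classCS (classC_partial k Cf).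
have H1 i j : classC 0 (fun x => Q x i j * partial (fb i) (partial (fb j) f) x) :=
  classC_mul (C0 _ (CQ i j)) (classC_partial _ (classC_partial _ Cf)).
have H2 i j : classC 0 (fun x => B i j * x 0 j * partial i f x) :=
  classC_mul (C0 _ (CB i j)) (C1 i).
have H3 j : classC 0 (fun x => F x 0 j * partial (fb j) f x) :=
  classC_mul (C0 _ (CF j)) (C1 (fb j)).
have S1 := classC_sum (index_enum 'I_q) (fun i => classC_sum (index_enum 'I_q) (H1 i)).
have S2 := classC_sum (index_enum 'I_n) (fun i => classC_sum (index_enum 'I_n) (H2 i)).
have S3 := classC_sum (index_enum 'I_q) H3.
exact: (classC_cont (classC_add (classC_add S1 S2) S3)).
Qed.

Lemma dist_mul_partial c i a f phi : 0 <= c -> classC 1 f -> classC 2 a -> classC 2 phi ->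
  Cc c phi -> dist_mul a (dist_partial i (dist_of f)) phi =
    rV_integral (fun x => a x * partial i f x * phi x).
Proof.
move=> c0 Cf Ca Cp Ccp; rewrite /dist_mul.
have Cap := classCS (classC_mul Ca Cp).
have Ccap : Cc c (fun x => a x * phi x) by apply: Cc_mul => //; exact: classC_cont Ca.
rewrite -(integral_parts i c0 Cf Cap Ccap) /dist_of; congr rV_integral.
by apply/funext => x; rewrite mulrCA mulrA.
Qed.

Lemma dist_mul_partial2 c i j a f phi : 0 <= c -> classC 2 f -> classC 2 a -> classC 2 phi ->
  Cc c phi -> dist_mul a (dist_partial i (dist_partial j (dist_of f))) phi =
    rV_integral (fun x => a x * partial i (partial j f) x * phi x).
Proof.
move=> c0 Cf Ca Cp Ccp; have C1 := classC_partial j Cf.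
rewrite -(dist_mul_partial i c0 C1 Ca Cp Ccp) /dist_mul.
have Cap := classC_mul Ca Cp.
have Ccap : Cc c (fun x => a x * phi x) by apply: Cc_mul => //; exact: classC_cont Ca.
rewrite /dist_partial -/(dist_partial j (dist_of f) (partial i (fun x => a x * phi x))).
rewrite -(integral_parts j c0 (classCS Cf) (classC_partial i Cap)) //.
exact: Cc_partial (classCS Cap) Ccap.
Qed.

(** Integration by parts moves all the derivatives to the products of the
    coefficients by phi, which are of class C^2 with compact support. *)
Lemma dist_of_Aop c f phi : 0 <= c -> classC 2 f -> classC 2 phi -> Cc c phi ->
  dist_of (A f) phi = dist_Aop (dist_of f) phi.
Proof.
move=> c0 Cf Cp Ccp; have C1 := classCS Cf.
pose T1 i j x := Q x i j * partial (fb i) (partial (fb j) f) x * phi x.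
pose T2 i j x := B i j * x 0 j * partial i f x * phi x.
pose T3 j x := F x 0 j * partial (fb j) f x * phi x.
have K1 i j : Cc c (T1 i j).
  apply: Cc_mul => //; have C0 : classC 0 (fun x => Q x i j) := classC_le (isT : (0 <= 2)%N) (CQ i j).
  exact: classC_cont (classC_mul C0 (classC_partial _ (classC_partial _ Cf))).
have K2 i j : Cc c (T2 i j).
  apply: Cc_mul => //; have C0 : classC 0 (fun x : E => B i j * x 0 j) := classC_le (isT : (0 <= 2)%N) (CB i j).
  exact: classC_cont (classC_mul C0 (classC_partial i C1)).
have K3 j : Cc c (T3 j).
  apply: Cc_mul => //; have C0 : classC 0 (fun x => F x 0 j) := classC_le (isT : (0 <= 2)%N) (CF j).
  exact: classC_cont (classC_mul C0 (classC_partial _ C1)).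
have S1 i := Cc_sum (index_enum 'I_q) c0 (K1 i).
have S2 i := Cc_sum (index_enum 'I_n) c0 (K2 i).
have [S3 E3] := Cc_sum (index_enum 'I_q) c0 K3.
have [SS1 E1] := Cc_sum (index_enum 'I_q) c0 (fun i => proj1 (S1 i)).
have [SS2 E2] := Cc_sum (index_enum 'I_n) c0 (fun i => proj1 (S2 i)).
rewrite /dist_of (_ : (fun x => A f x * phi x) = fun x =>
   (\sum_i \sum_j T1 i j x + \sum_i \sum_j T2 i j x) + \sum_j T3 j x); last first.
  apply/funext => x; rewrite /Aop !mulrDl !mulr_suml.
  congr (_ + _ + _); apply: eq_bigr => i _; exact: mulr_suml.
rewrite (rV_integralD c0 (Cc_add SS1 SS2) S3) (rV_integralD c0 SS1 SS2) E1 E2 E3 /dist_Aop.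
congr (_ + _ + _).
- apply: eq_bigr => i _; rewrite (proj2 (S1 i)); apply: eq_bigr => j _.
  by rewrite (dist_mul_partial2 (fb i) (fb j) c0 Cf (CQ i j) Cp Ccp).
- apply: eq_bigr => i _; rewrite (proj2 (S2 i)); apply: eq_bigr => j _.
  by rewrite (dist_mul_partial i c0 C1 (CB i j) Cp Ccp).
by apply: eq_bigr => j _; rewrite (dist_mul_partial (fb j) c0 C1 (CF j) Cp Ccp).
Qed.

Lemma cvg_sum_seq (I : Type) (s : seq I) (u : I -> nat -> R) (l : I -> R) :
  (forall i, u i @ \oo --> l i) ->
  (fun k => \sum_(i <- s) u i k) @ \oo --> \sum_(i <- s) l i.
Proof.
move=> H; elim: s => [|i s IH].
  rewrite big_nil (_ : (fun k => _) = fun=> 0); first exact: cvg_cst.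
  by apply/funext => k; rewrite big_nil.
rewrite big_cons (_ : (fun k => _) = fun k => u i k + \sum_(j <- s) u j k).
  exact: cvgD.
by apply/funext => k; rewrite big_cons.
Qed.

Lemma dist_Aop_cvg c (fn : nat -> E -> R) f phi : 0 <= c -> (forall k, continuous (fn k)) ->
  continuous f -> locally_uniform fn f -> classC 2 phi -> Cc c phi ->
  (fun k => dist_Aop (dist_of (fn k)) phi) @ \oo --> dist_Aop (dist_of f) phi.
Proof.
move=> c0 cfn cf lu Cp Ccp; have D psi := @dist_of_cvg R n c fn f psi c0 cfn cf lu.
have Cap a : classC 2 a -> Cc c (fun x => a x * phi x).
  by move=> Ca; apply: Cc_mul => //; exact: classC_cont Ca.
have D1 i a : classC 2 a -> (fun k => dist_mul a (dist_partial i (dist_of (fn k))) phi) @ \oo -->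
    dist_mul a (dist_partial i (dist_of f)) phi.
  move=> Ca; apply: cvgN; apply: D.
  by apply: Cc_partial; [exact: classCS (classC_mul Ca Cp)|exact: Cap].
have D2 i j a : classC 2 a ->
    (fun k => dist_mul a (dist_partial i (dist_partial j (dist_of (fn k)))) phi) @ \oo -->
    dist_mul a (dist_partial i (dist_partial j (dist_of f))) phi.
  move=> Ca; apply: cvgN; apply: cvgN; apply: D.
  apply: Cc_partial; first exact: classC_partial i (classC_mul Ca Cp).
  by apply: Cc_partial; [exact: classCS (classC_mul Ca Cp)|exact: Cap].
have E1 i j := D2 (fb i) (fb j) _ (CQ i j).
have E2 i j := D1 i _ (CB i j).
have E3 j := D1 (fb j) _ (CF j).
have S1 := cvg_sum_seq (s := index_enum 'I_q) (fun i => cvg_sum_seq (s := index_enum 'I_q) (E1 i)).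
have S2 := cvg_sum_seq (s := index_enum 'I_n) (fun i => cvg_sum_seq (s := index_enum 'I_n) (E2 i)).
have S3 := cvg_sum_seq (s := index_enum 'I_q) E3.
exact: (cvgD (cvgD S1 S2) S3).
Qed.

Lemma dist_Aop_limit (fn : nat -> E -> R) f g phi : (forall k, classC 2 (fn k)) ->
  continuous f -> continuous g -> locally_uniform fn f ->
  locally_uniform (fun k => A (fn k)) g -> test_function phi ->
  dist_of g phi = dist_Aop (dist_of f) phi.
Proof.
move=> C2 cf cg lf lg [Cp cphi].
have [K [_ HK]] := compact_bounded cphi.
pose c := `|K| + 1; have c0 : 0 <= c by rewrite /c addr_ge0.
have Ccp : Cc c phi.
  split; first exact: classC_cont (Cp 0%N).
  move=> x xc; apply/eqP/negPn/negP => px.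
  have : `|x| <= c.
    apply: (HK c); first by apply: le_lt_trans (ler_norm K) _; rewrite ltrDl.
    by apply: subset_closure.
  by rewrite leNgt xc.
have cfn k : continuous (fn k) := classC_cont (C2 k).
have cA k : continuous (A (fn k)) := Aop_continuous (C2 k).
have L1 := dist_of_cvg c0 cA cg lg Ccp.
have L2 := dist_Aop_cvg c0 cfn cf lf (Cp 2%N) Ccp.
have E k := dist_of_Aop c0 (C2 k) (Cp 2%N) Ccp.
move: L1; rewrite (_ : (fun k => dist_of _ _) = fun k => dist_Aop (dist_of (fn k)) phi); last first.
  by apply/funext => k; rewrite E.
by move=> L1; exact: cvg_unique L1 L2.
Qed.

End WeakOperator.

(** * The characterization of the generator *)

Section Characterization.
Context {R : realType} {n q : nat}.
Local Notation E := 'rV[R]_n.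
Variables (fb : 'I_q -> 'I_n) (Q : E -> 'M[R]_q) (B : 'M[R]_n) (F : E -> 'rV[R]_q).
Hypothesis reg : regular_coefficients Q F.
Local Notation solves := (solves fb Q B F).
Local Notation A := (Aop fb Q B F).
Implicit Types (f g h psi : E -> R) (x y : E) (t s : R) (u : R -> E -> R).
Variable T : R -> (E -> R) -> E -> R.
Hypothesis hT : forall f, Cb f -> solves f (T^~ f) /\
  forall u, solves f u -> forall t x, 0 <= t -> u t x = T t f x.

Lemma approximating_sequence f g : generates T f g ->
  exists (fn : nat -> E -> R) (K : R), [/\ forall k, classC 2 (fn k) /\ Cb2 (fn k),
    forall k x, `|fn k x| <= K, forall k x, `|A (fn k) x| <= K,
    locally_uniform fn f & locally_uniform (fun k => A (fn k)) g].
Proof.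
move=> gen; have [K K0 HK] := smooth_approximation reg hT gen.
have e1 (k : nat) : 0 < (k.+1%:R : R)^-1 <= 1 by rewrite invr_gt0 ltr0n /= invf_le1 ?ltr0n// ler1n.
have H k := HK k%:R _ (e1 k).
have [fn Hfn] := choice H.
have small (M e : R) : 0 < e -> exists N, forall k, (N <= k)%N ->
    M <= k%:R /\ (k.+1%:R : R)^-1 <= e.
  move=> e0; pose N := maxn (Num.bound `|M|) (Num.bound e^-1); exists N => k.
  have eV : 0 <= e^-1 by rewrite invr_ge0 ltW.
  rewrite geq_max => /andP[k1 k2]; split.
    apply: le_trans (ler_norm M) _; apply: le_trans (ltW (archi_boundP (normr_ge0 M))) _.
    by rewrite ler_nat.
  rewrite -[leRHS]invrK lef_pV2 ?posrE ?ltr0n ?invr_gt0//.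
  apply: le_trans (ltW (archi_boundP eV)) _; rewrite ler_nat.
  exact: leq_trans k2 (leqnSn k).
exists fn, K; split.
- move=> k; have [C2 [M M0] _ _ _] := Hfn k; split=> //; exact: Cb2_compact C2 M0.
- by move=> k x; have [_ _ h _ _] := Hfn k.
- by move=> k x; have [_ _ _ h _] := Hfn k.
- move=> M e /(small M)[N HN]; exists N => k /HN[Mk ke] x xM.
  by have [_ _ _ _ /(_ x (le_trans xM Mk))[h _]] := Hfn k; exact: le_trans h ke.
move=> M e /(small M)[N HN]; exists N => k /HN[Mk ke] x xM.
by have [_ _ _ _ /(_ x (le_trans xM Mk))[_ h]] := Hfn k; exact: le_trans h ke.
Qed.

Lemma generator_characterization :
  gen_domain T =
    [set f | Cb f /\
      exists (fn : nat -> E -> R) (g : E -> R),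
      [/\ forall n, Cb2 (fn n), Cb g, cvg_tauc (fn @ \oo) f,
          cvg_tauc ((fun n => A (fn n)) @ \oo) g &
          (ereal_sup (range (fun n => supnorm (fn n) + supnorm (A (fn n)))) < +oo)%E]]
  /\
  (forall f, gen_domain T f -> forall phi, test_function phi ->
       dist_of (gen T f) phi = dist_Aop fb Q B F (dist_of f) phi).
Proof.
split; last first.
  move=> f /gen_domainP[g gen] phi tphi; rewrite (generates_gen gen).
  have [fn [K [C2 _ _ lf lg]]] := approximating_sequence gen.
  have [[cf _] [cg _] _ _] := gen.
  exact: (dist_Aop_limit reg (fun k => proj1 (C2 k)) cf cg lf lg tphi).
apply/seteqP; split=> f.
  move=> /gen_domainP[g gen]; have [Cf Cg _ _] := gen.
  have [fn [K [C2 fK AK lf lg]]] := approximating_sequence gen.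
  split=> //; exists fn, g; split=> //.
  - by move=> k; have [] := C2 k.
  - exact/cvg_tauc_seqP.
  - exact/cvg_tauc_seqP.
  apply/ereal_sup_ltP; exists (K + K) => y [k _ <-].
  by rewrite EFinD; apply: leeD; apply: supnorm_le.
move=> [Cf [fn [g [C2 Cg /cvg_tauc_seqP lf /cvg_tauc_seqP lg /ereal_sup_ltP[C HC]]]]].
apply/gen_domainP; exists g.
have HK k : (supnorm (fn k) + supnorm (A (fn k)) <= C%:E)%E by apply: HC; exists k.
apply: (generates_limit reg hT (fn := fn) (K := C)) => //.
- by move=> k; have [] := C2 k.
- move=> k x; rewrite -lee_fin; apply: le_trans (HK k).
  apply: le_trans (abs_le_supnorm (fn k) x) _; exact: leeDl (supnorm_ge0 _).
move=> k x; rewrite -lee_fin; apply: le_trans (HK k).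
apply: le_trans (abs_le_supnorm (A (fn k)) x) _; exact: leeDr (supnorm_ge0 _).
Qed.

End Characterization.

Theorem proposition4p6 (R : realType) (r : nat) (p : 'I_r.+1 -> nat)
    (kappa : nat)
    (Q : 'rV[R]_(\sum_i p i) -> 'M[R]_(p ord0))
    (B : 'M[R]_(\sum_i p i))
    (F : 'rV[R]_(\sum_i p i) -> 'rV[R]_(p ord0))
    (nu : 'rV[R]_(\sum_i p i) -> R)
    (T : R -> ('rV[R]_(\sum_i p i) -> R) -> ('rV[R]_(\sum_i p i) -> R))
    (hA : standing_hyp Q B F kappa nu)
    (hT : is_semigroup Q B F T) :
  gen_domain T =
    [set f | Cb f /\
      exists (fn : nat -> 'rV[R]_(\sum_i p i) -> R)
             (g : 'rV[R]_(\sum_i p i) -> R),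
      [/\ forall n, Cb2 (fn n),
          Cb g,
          cvg_tauc (fn @ \oo) f,
          cvg_tauc ((fun n => opA Q B F (fn n)) @ \oo) g &
          (ereal_sup (range (fun n =>
             supnorm (fn n) + supnorm (opA Q B F (fn n)))) < +oo)%E]]
  /\
  (forall f, gen_domain T f ->
     forall phi, test_function phi ->
       dist_of (gen T f) phi = dist_opA Q B F (dist_of f) phi).
Proof.
have [sz k3 [Qs QC nu0 nui Qe Qg] _ [FC Fg]] := hA.
have p0 : (0 < p ord0)%N := p_gt0 sz ord0.
have reg : regular_coefficients Q F :=
  coefficients_regular p0 k3 Qs QC FC nu0 nui Qe Qg Fg.
have S f u : classical_solution Q B F f u -> solves (@first_block r p) Q B F f u.
  by case=> s1 s2 s3 s4 s5 s6 s7 s8 s9 s10; exact (Build_solves s1 s2 s3 s4 s5 s6 s7 s8 s9 s10).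
have S' f u : solves (@first_block r p) Q B F f u -> classical_solution Q B F f u.
  by case=> s1 s2 s3 s4 s5 s6 s7 s8 s9 s10;
    exact (Build_classical_solution s1 s2 s3 s4 s5 s6 s7 s8 s9 s10).
have hT' f : Cb f -> solves (@first_block r p) Q B F f (T^~ f) /\
    forall u, solves (@first_block r p) Q B F f u ->
    forall t x, 0 <= t -> u t x = T t f x.
  by move=> /hT[/S sf uniq]; split=> // u /S'; exact: uniq.
exact (generator_characterization reg hT').
Qed.
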